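(* Let $M$ be a closed smooth manifold of dimension $n \ge 3$ and let $g_0$ be a $C^2$-Riemannian metric on $M$. Let $u_i, u : M \to \mathbb{R}_{+}$ ($i = 1, 2, \dots$) be positive $C^2$-functions on $M$, and set $g_i := u_i^{\frac{4}{n-2}} g_0$ and $g := u^{\frac{4}{n-2}} g_0$. Assume: (1) $g_i \to g$ on $M$ in the $C^0$-sense as $i \to \infty$; (2) there is a constant $\kappa \in \mathbb{R}$ such that $\int_M R(g_i)\, d\mathrm{vol}_{g_i} \le \kappa$ for all $i$; and, in the case $Y(M, g_0) > 0$, assume additionally: (3) there is a continuous function $\delta \in C^0(M)$ such that $R(g_i) \ge \delta$ on $M$ for all $i$. Then $\int_M R(g)\, d\mathrm{vol}_g \le \kappa$. Moreover, when $Y(M, g_0) > 0$, the same conclusion still holds (assuming (2) and (3)) if (1) is replaced by the following weaker condition: (1)' $u_i \to u$ in $L^{\frac{2n}{n-2}}(M, g_0)$, i.e., $\int_M |u_i - u|^{\frac{2n}{n-2}}\, d\mathrm{vol}_{g_0} \to 0$ as $i \to \infty$.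
   Context: Closed means compact without boundary. For a $C^2$-Riemannian metric $h$ on $M$, $R(h)$ denotes its scalar curvature and $d\mathrm{vol}_h$ its Riemannian volume measure. $C^0$-convergence of metrics on the closed manifold $M$ is uniform convergence of the metric tensors. The Yamabe constant of $g_0$ is $$Y(M, g_0) := \inf\left\{ \frac{\int_M R(h)\, d\mathrm{vol}_h}{\left(\int_M d\mathrm{vol}_h\right)^{\frac{n-2}{n}}} \ \middle|\ h = v^{\frac{4}{n-2}} g_0,\ v \in C^\infty(M),\ v > 0 \text{ on } M \right\}.$$ *)

(* Defs.v *)
From HB Require Import structures.
From mathcomp Require Import all_boot all_order all_algebra.
From mathcomp Require Import all_classical all_reals all_analysis.

Set Implicit Arguments.
Unset Strict Implicit.
Unset Printing Implicit Defensive.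

Import Order.TTheory GRing.Theory Num.Theory.
Import numFieldNormedType.Exports.

Local Open Scope classical_set_scope.
Local Open Scope ring_scope.

Section Euclidean.
Context {R : realType} {n : nat}.

Definition partial (i : 'I_n) (f : 'rV[R]_n -> R) (x : 'rV[R]_n) : R :=
  'D_(delta_mx 0 i) f x.

(* Meant for open U: the values of f outside of U are then irrelevant. *)
Fixpoint Ck_on (k : nat) (U : set 'rV[R]_n) (f : 'rV[R]_n -> R) : Prop :=
  (forall x, U x -> {for x, continuous f}) /\
  if k is k'.+1 then
    forall i : 'I_n, (forall x, U x -> derivable f x (delta_mx 0 i)) /\
                     Ck_on k' U (partial i f)
  else True.

Definition smooth_on (U : set 'rV[R]_n) (f : 'rV[R]_n -> R) : Prop :=
  forall k, Ck_on k U f.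

End Euclidean.

(* Iterated one-dimensional Lebesgue integrals; by Tonelli's theorem this is
   the integral with respect to the n-dimensional Lebesgue measure whenever f
   is Borel and nonnegative. *)
Fixpoint integral_rV {R : realType} (n : nat) : ('rV[R]_n -> \bar R) -> \bar R :=
  if n is m.+1 then
    fun f => (\int[@lebesgue_measure R]_(t in setT)
      integral_rV (fun y : 'rV[R]_m => f (row_mx (t%:M : 'rV[R]_1) y)))%E
  else fun f => f 0.

Record chart (R : realType) (n : nat) (M : topologicalType) := Chart {
  chart_dom : set M ;
  chart_map : M -> 'rV[R]_n ;
  chart_inv : 'rV[R]_n -> M ;
  chart_dom_open : open chart_dom ;
  codom_chart_open : open (chart_map @` chart_dom) ;
  chart_mapK : forall p, chart_dom p -> chart_inv (chart_map p) = p ;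
  chart_map_continuous : {within chart_dom, continuous chart_map} ;
  chart_inv_continuous : {within chart_map @` chart_dom, continuous chart_inv} }.

Definition codom_chart (R : realType) (n : nat) (M : topologicalType)
  (c : chart R n M) : set 'rV[R]_n := chart_map c @` chart_dom c.

(* Charts take values in open subsets of R^n, so there is no boundary. Second
   countability is not required separately: it follows from compactness. *)
Record closed_manifold (R : realType) (n : nat) := ClosedManifold {
  carrier :> ptopologicalType ;
  carrier_hausdorff : hausdorff_space carrier ;
  carrier_compact : compact [set: carrier] ;
  atlas : Type ;
  chart_of : atlas -> chart R n carrier ;
  atlas_cover : forall p : carrier, exists a, chart_dom (chart_of a) p ;
  atlas_smooth : forall (a b : atlas) (k : 'I_n),
    smooth_on (chart_map (chart_of a) @` (chart_dom (chart_of a) `&` chart_dom (chart_of b)))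
      (fun x => chart_map (chart_of b) (chart_inv (chart_of a) x) 0 k) }.

Section Manifold.
Context {R : realType} {n : nat} (M : closed_manifold R n).

Local Notation ch := (@chart_of R n M).

Definition Ck_fun (k : nat) (f : M -> R) : Prop :=
  forall a : atlas M, Ck_on k (codom_chart (ch a)) (f \o chart_inv (ch a)).

Definition smooth_fun (f : M -> R) : Prop := forall k, Ck_fun k f.

(* A (0,2)-tensor field given by its components: g a p i j stands for
   g_p(d/dx^i, d/dx^j) in the chart a; it is only meaningful for p in the
   domain of a. *)
Definition tensor2 := atlas M -> M -> 'M[R]_n.

(* tjac a b p i k is the derivative of the k-th coordinate of the chart b
   with respect to the i-th coordinate of the chart a. *)
Definition tjac (a b : atlas M) (p : M) : 'M[R]_n :=
  \matrix_(i, k) partial i (fun x => chart_map (ch b) (chart_inv (ch a) x) 0 k)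
                           (chart_map (ch a) p).

Definition quad (T : 'M[R]_n) (v : 'rV[R]_n) : R := (v *m T *m v^T) 0 0.

Definition coord_tensor (g : tensor2) (a : atlas M) (x : 'rV[R]_n) : 'M[R]_n :=
  g a (chart_inv (ch a) x).

Record riemannian_metric (k : nat) (g : tensor2) : Prop := RiemannianMetric {
  metric_Ck : forall (a : atlas M) (i j : 'I_n),
    Ck_on k (codom_chart (ch a)) (fun x => coord_tensor g a x i j) ;
  metric_sym : forall (a : atlas M) p, chart_dom (ch a) p -> (g a p)^T = g a p ;
  metric_posdef : forall (a : atlas M) p, chart_dom (ch a) p ->
    forall v : 'rV[R]_n, v != 0 -> 0 < quad (g a p) v ;
  metric_tensorial : forall (a b : atlas M) p,
    chart_dom (ch a) p -> chart_dom (ch b) p ->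
    g a p = tjac a b p *m g b p *m (tjac a b p)^T }.

Section LocalCurvature.
Variable G : 'rV[R]_n -> 'M[R]_n.

(* Gamma^k_ij *)
Definition christoffel (k i j : 'I_n) (x : 'rV[R]_n) : R :=
  2^-1 * \sum_(l < n) invmx (G x) k l *
    (partial i (fun y => G y j l) x + partial j (fun y => G y i l) x
     - partial l (fun y => G y i j) x).

(* The component along d/dx^l of
   (D_i D_j - D_j D_i) d/dx^k, with D the Levi-Civita connection. *)
Definition riemann (l i j k : 'I_n) (x : 'rV[R]_n) : R :=
  partial i (christoffel l j k) x - partial j (christoffel l i k) x
  + \sum_(m < n) (christoffel l i m x * christoffel m j k x
                  - christoffel l j m x * christoffel m i k x).

Definition ricci (j k : 'I_n) (x : 'rV[R]_n) : R :=
  \sum_(i < n) riemann i i j k x.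

Definition local_scalar (x : 'rV[R]_n) : R :=
  \sum_(j < n) \sum_(k < n) invmx (G x) j k * ricci j k x.

End LocalCurvature.

Definition is_scalar_curvature (g : tensor2) (S : M -> R) : Prop :=
  forall (a : atlas M) p, chart_dom (ch a) p ->
    S p = local_scalar (coord_tensor g a) (chart_map (ch a) p).

(* The function given in every chart by the coordinate formula. The default
   value 0 is never used for a C^2 metric, because the formula is then
   invariant under changes of charts. *)
Definition scalar_curvature (g : tensor2) : M -> R :=
  xget (fun=> 0) [set S : M -> R | is_scalar_curvature g S].

Definition borel : measurableType _ := g_sigma_algebraType (@open M).

Definition is_volume (g : tensor2) (mu : {measure set borel -> \bar R}) : Prop :=
  forall (a : atlas M) (A : set borel), measurable A -> A `<=` chart_dom (ch a) ->
    mu A = integral_rV (fun x =>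
      (Num.sqrt (\det (coord_tensor g a x)) * \1_(chart_map (ch a) @` A) x)%:E).

(* The unique Borel measure with density sqrt(det g) in every chart. The
   default (zero) measure is never used for a continuous metric. *)
Definition volume (g : tensor2) : {measure set borel -> \bar R} :=
  xget (mzero : {classic {measure set borel -> \bar R}})
       [set mu | is_volume g mu].

Definition total_scalar (g : tensor2) : R :=
  \int[volume g]_(p in [set: borel]) scalar_curvature g p.

(* u^(4/(n-2)) g *)
Definition conformal (u : M -> R) (g : tensor2) : tensor2 :=
  fun a p => (u p `^ (4 / (n%:R - 2))) *: g a p.

(* An infimum in the extended reals, so that no lower bound is presupposed. *)
Definition yamabe (g0 : tensor2) : \bar R :=
  ereal_inf [set (total_scalar (conformal v g0) /
      fine (volume (conformal v g0) [set: borel]) `^ ((n%:R - 2) / n%:R))%:E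
    | v in [set v : M -> R | smooth_fun v /\ forall p, 0 < v p]].

(* Uniform convergence of (0,2)-tensor fields, for the operator norm induced
   by the background metric b on symmetric bilinear forms; since M is compact
   the choice of b is irrelevant. *)
Definition C0_cvg (b : tensor2) (g_ : nat -> tensor2) (g : tensor2) : Prop :=
  forall eps : R, 0 < eps -> \forall i \near \oo,
    forall (a : atlas M) p (v : 'rV[R]_n), chart_dom (ch a) p ->
      `|quad (g_ i a p - g a p) v| <= eps * quad (b a p) v.

Definition Lp_cvg (g0 : tensor2) (q : R) (u_ : nat -> M -> R) (u : M -> R) :
    Prop :=
  \int[volume g0]_(p in [set: borel]) (`|u_ i p - u p| `^ q)
    @[i --> \oo] --> (0 : R).

End Manifold.

(* Main.v *)
Require Import Defs.
From HB Require Import structures.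
From mathcomp Require Import all_boot all_order all_algebra.
From mathcomp Require Import all_classical all_reals all_analysis measurable_realfun.
From mathcomp Require Import perm ring lra.

Set Implicit Arguments. Unset Strict Implicit. Unset Printing Implicit Defensive.

Import Order.TTheory GRing.Theory Num.Theory.
Import numFieldNormedType.Exports.
Local Open Scope classical_set_scope.
Local Open Scope ring_scope.

(** Write [h = u^(4/(n-2)) g0] and [g_i = v_i^(4/(n-2)) h] with [v_i = u_i / u].
    The conformal law for the scalar curvature and Green's formula give
      [int R(g_i) dvol_(g_i) = int (R(h) v_i^2 + c |d v_i|^2) dvol_h
                            >= int R(h) v_i^2 dvol_h],   [c = 4(n-1)/(n-2)].
    Both (1) and (1)' make [int |v_i - 1|^(2n/(n-2)) dvol_h] small; as the
    exponent is at least 2 and [R(h)] is bounded, the right-hand side tends to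
    [int R(h) dvol_h].

    The chart formula for the Laplacian of a C^2 function is shown to be
    independent of the chart in weak form: only the invariance of
    [<d phi, d f>] is needed, which involves first derivatives of the
    transition maps. The invariance of the scalar curvature and the existence
    of the volume are never needed, because each of them transfers between
    conformal metrics in both directions, and the integrals are 0 when one of
    them fails. *)

(** * Lebesgue measure on row vectors *)

(** Taking the limit metric as base turns the claim into semicontinuity at the constant function 1.
    The curvature law carries the power [-4/(n-2)] of the conformal factor and the volume the power
    [2n/(n-2)]; they add up to 2, which is why [v_i] enters quadratically and why the sign of the
    integral of [v] times its Laplacian is all that Green's formula has to supply. The obstacle is
    that the Laplacian is a chart formula with second derivatives. Green's formula is first proved
    inside one chart, for test functions supported there, from the vanishing of the integral of a
    partial derivative of a compactly supported function. Test functions are differentiated only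
    once, so C^1 bump functions and partitions of unity are enough. As this argument integrates,
    chart independence of the Laplacian, and with it the conformal law, is obtained in the presence
    of a volume measure; hence the case distinctions at the end. Volumes are specified through
    iterated integrals; a sigma-finite Lebesgue measure on rows makes Fubini and monotone
    convergence available for them. *)

Section BorelSets.
Context {R : realType}.

Lemma borel_measurable_fun (T : ptopologicalType) d (T' : measurableType d)
    (D : set T') (f : T' -> g_sigma_algebraType (@open T)) :
  (forall O : set T, open O -> measurable (D `&` f @^-1` O)) ->
  measurable_fun D f.
Proof.
move=> H; apply: (@measurability _ _ _ (g_sigma_algebraType (@open T)) D f (@open T)) => //.
by move=> _ [V oV <-]; exact: H.
Qed.

Lemma open_continuous_borel (T : ptopologicalType) (U : set T) (f : T -> R) :
  open U -> (forall x, U x -> {for x, continuous f}) ->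
  measurable_fun (U : set (g_sigma_algebraType (@open T))) f.
Proof.
move=> oU cf mU; apply: (measurability _ (RGenOpens.measurableE R)) => //.
move=> _ [_ [a [b ->] <-]]; apply: sub_sigma_algebra.
rewrite openE => x [Ux fx]; apply: filterI; first exact: open_nbhs_nbhs.
by apply: (cf x Ux); apply: open_nbhs_nbhs; split=> //; exact: interval_open.
Qed.

Lemma continuous_borel (T : ptopologicalType) (f : T -> R) :
  continuous f -> measurable_fun (setT : set (g_sigma_algebraType (@open T))) f.
Proof. by move=> cf; apply: (open_continuous_borel openT) => x _; exact: cf. Qed.

Definition brV n : measurableType _ := g_sigma_algebraType (@open 'rV[R]_n).

Lemma measurable_coord n (j : 'I_n) :
  measurable_fun setT (fun x : brV n => (x : 'rV[R]_n) 0 j).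
Proof. by apply: continuous_borel; exact: coord_continuous. Qed.

Lemma ball_rVE n (x : 'rV[R]_n) (e : R) (y : 'rV[R]_n) : 0 < e ->
  ball x e y <-> (forall j, `|x 0 j - y 0 j| < e).
Proof.
move=> e0; split=> [[_ H] j|H]; first exact: H.
by split=> // i j; rewrite ord1; exact: H.
Qed.

Lemma rat_ball_dense n (x : 'rV[R]_n) (e : R) : 0 < e ->
  exists q : 'rV[rat]_n, ball (map_mx ratr q : 'rV[R]_n) e x.
Proof.
move=> e0.
have H j : exists q : rat, `|ratr q - x 0 j| < e.
  have ne : ball (x 0 j) e !=set0 by exists (x 0 j); exact: ballxx.
  have [y [xy [q _ qE]]] := dense_rat ne (ball_open _ _).
  by exists q; rewrite qE distrC.
have [q Hq] := choice H.
exists (\row_j q j); apply/ball_rVE => // j; by rewrite !mxE.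
Qed.

(** Around [x] take a ball of radius [e] inside [O] and [k] with [1/(k+1) < e/2]; a rational centre
    within [1/(k+1)] of [x] gives a ball that contains [x] and stays in [O] by the triangle
    inequality. The union is countable, which is what reduces Borel measurability of row-valued maps
    to their coordinates. *)
Lemma open_bigcup_rat_ball n (O : set 'rV[R]_n) : open O ->
  O = \bigcup_(p in [set p : 'rV[rat]_n * nat |
                  ball (map_mx ratr p.1 : 'rV[R]_n) (p.2.+1%:R^-1) `<=` O])
        ball (map_mx ratr p.1 : 'rV[R]_n) (p.2.+1%:R^-1).
Proof.
move=> oO; apply/seteqP; split=> [x Ox|x [p /= pO]]; last exact: pO.
have /nbhs_ballP[e /= e0 eO] : nbhs x O by apply: open_nbhs_nbhs.
have [k /= ke] : exists k : nat, k.+1%:R^-1 < e / 2.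
  have [k _ /(_ k (leqnn _)) /=] := near_infty_natSinv_lt (PosNum (divr_gt0 e0 (ltr0n R 2))).
  by exists k.
have k0 : 0 < k.+1%:R^-1 :> R by [].
have [q qx] := rat_ball_dense x k0.
exists (q, k) => //= y qy; apply: eO.
apply: (@le_ball _ _ x (k.+1%:R^-1 + k.+1%:R^-1)).
  by rewrite [leRHS]splitr lerD ?ltW.
by apply: ball_triangle qy; apply: ball_sym.
Qed.

Lemma measurable_fun_rV n d (T : measurableType d) (f : T -> brV n) :
  (forall j, measurable_fun setT (fun t => (f t : 'rV[R]_n) 0 j)) ->
  measurable_fun setT f.
Proof.
move=> mf; apply: borel_measurable_fun => O /open_bigcup_rat_ball ->.
rewrite setTI preimage_bigcup bigcup_mkcond; apply: countable_bigcupT_measurable.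
  exact: countableP.
move=> [q k]; case: ifP => // _ /=.
have k0 : 0 < k.+1%:R^-1 :> R by [].
rewrite (_ : _ @^-1` _ = \bigcap_(j in [set: 'I_n])
  ((fun t => (f t : 'rV[R]_n) 0 j) @^-1`
    ball (ratr (q 0 j) : R) (k.+1%:R^-1))); last first.
  apply/seteqP; split=> [t /= /ball_rVE-/(_ k0) H j _|t /= H].
    by have := H j; rewrite mxE.
  by apply/ball_rVE => // j; rewrite mxE; exact: H.
apply: fin_bigcap_measurable => // j _; rewrite -[X in measurable X]setTI.
apply: mf => //; apply: open_measurable; exact: ball_open.
Qed.

End BorelSets.

Section LebesgueRow.
Context {R : realType}.
Local Notation rV n := (@brV R n).
Local Notation mT := (measurableTypeR R).

Definition leb1 : {sigma_finite_measure set mT -> \bar R} := @lebesgue_measure R.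

(** The same splitting off of the first coordinate as in [integral_rV], so that the inductions over
    the dimension match. *)
Definition row_cons n (z : mT * rV n) : rV n.+1 :=
  row_mx (z.1%:M : 'rV[R]_1) (z.2 : 'rV[R]_n) : 'rV[R]_(1 + n).

Definition row_split n (x : rV n.+1) : mT * rV n :=
  ((x : 'rV[R]_n.+1) 0 0, rsubmx (x : 'rV[R]_(1 + n)) : 'rV[R]_n).

Lemma row_consK n : cancel (@row_cons n) (@row_split n).
Proof.
move=> [t y]; rewrite /row_cons /row_split /= row_mxKr; congr (_, _).
have -> : (0 : 'I_n.+1) = lshift n (0 : 'I_1) by apply/val_inj.
by rewrite (row_mxEl (t%:M : 'rV[R]_1)) mxE eqxx mulr1n.
Qed.

Lemma row_splitK n : cancel (@row_split n) (@row_cons n).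
Proof.
move=> x; rewrite /row_cons /row_split /=.
rewrite (_ : _%:M = lsubmx (x : 'rV[R]_(1 + n))); first exact: (@hsubmxK R 1 1 n x).
apply/rowP => j; rewrite !mxE !ord1 eqxx mulr1n.
by congr (_ _ _); apply/val_inj.
Qed.

Lemma row_cons0 n (z : mT * rV n) : (row_cons z : 'rV[R]_n.+1) 0 0 = z.1.
Proof. exact: (congr1 fst (row_consK z)). Qed.

Lemma row_consS n (z : mT * rV n) (j : 'I_n) :
  (row_cons z : 'rV[R]_n.+1) 0 (lift ord0 j) = (z.2 : 'rV[R]_n) 0 j.
Proof.
have -> : lift ord0 j = rshift 1 j by apply/val_inj.
by rewrite (row_mxEr (z.1%:M : 'rV[R]_1)).
Qed.

Lemma measurable_row_cons n : measurable_fun setT (@row_cons n).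
Proof.
apply: measurable_fun_rV => j; case: (unliftP ord0 j) => [k ->|->].
  rewrite (_ : (fun t => _) = (fun x : rV n => (x : 'rV[R]_n) 0 k) \o snd); last first.
    by apply/funext => t; rewrite row_consS.
  by apply: measurableT_comp => //; exact: measurable_coord.
rewrite (_ : (fun t => _) = fst); last by apply/funext => t; rewrite row_cons0.
exact: measurable_fst.
Qed.

Lemma measurable_row_consr n (t : R) :
  measurable_fun setT (fun y : rV n => row_cons (t, y)).
Proof.
by apply: (measurableT_comp (@measurable_row_cons n)); apply: measurable_fun_pair.
Qed.

Lemma measurable_row_split n : measurable_fun setT (@row_split n).
Proof.
apply: measurable_fun_pair => /=; first exact: measurable_coord.
apply: measurable_fun_rV => j.
rewrite (_ : (fun t => _) = (fun x : rV n.+1 => (x : 'rV[R]_n.+1) 0 (rshift 1 j))).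
  exact: measurable_coord.
by apply/funext => x; rewrite mxE.
Qed.

Section Step.
Variables (n : nat) (mu : {sigma_finite_measure set (rV n) -> \bar R}).

(** The pushforward of the product measure under [row_cons], kept as a separate function so that the
    measure and sigma-finiteness structures attach to it and the recursion can go on. *)
Definition lebV_step : set (rV n.+1) -> \bar R :=
  fun A => ((leb1 \x mu)%E (@row_cons n @^-1` A)).

Let lebV_step0 : lebV_step set0 = 0%E.
Proof. by rewrite /lebV_step preimage_set0 measure0. Qed.

Let lebV_step_ge0 A : (0 <= lebV_step A)%E.
Proof. exact: measure_ge0. Qed.

Let lebV_step_sigma_additive : semi_sigma_additive lebV_step.
Proof.
pose row_consM : {mfun _ >-> _} :=
  HB.pack (@row_cons n) (isMeasurableFun.Build _ _ _ _ _ (@measurable_row_cons n)).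
exact: (@measure_semi_sigma_additive _ _ _
  (pushforward (leb1 \x mu)%E row_consM)).
Qed.

HB.instance Definition _ := isMeasure.Build _ _ _ lebV_step
  lebV_step0 lebV_step_ge0 lebV_step_sigma_additive.

Lemma lebV_step_sigma_finite : sigma_finite setT lebV_step.
Proof.
have /sigma_finiteP[F [TF ndF Foo]] := sigma_finiteT leb1.
have /sigma_finiteP[G [TG ndG Goo]] := sigma_finiteT mu.
exists (fun i => @row_split n @^-1` (F i `*` G i)).
  rewrite -preimage_bigcup (_ : \bigcup_i _ = setT) ?preimage_setT //.
  rewrite -setXTT TF TG predeqE => -[x y]; split.
    by move=> [k _ []/= ? ?]; split; exists k.
  move=> [/= [k _ Fkx] [l _ Gly]]; exists (maxn k l) => //; split.
  - by move: x Fkx; exact/subsetPset/ndF/leq_maxl.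
  - by move: y Gly; exact/subsetPset/ndG/leq_maxr.
move=> i; have [mFi Fioo] := Foo i; have [mGi Gioo] := Goo i; split.
  rewrite -[X in measurable X]setTI; apply: measurable_row_split => //.
  exact: measurableX.
rewrite /lebV_step -comp_preimage (_ : _ \o _ = id); last first.
  by apply/funext => z; exact: row_consK.
by rewrite preimage_id product_measure1E // lte_mul_pinfty // ge0_fin_numE.
Qed.

HB.instance Definition _ := Measure_isSigmaFinite.Build _ _ _ lebV_step
  lebV_step_sigma_finite.

End Step.

(** In dimension 0 the Dirac mass at the only row matches the value [f 0] taken by [integral_rV]. *)
Fixpoint lebV n : {sigma_finite_measure set (rV n) -> \bar R} :=
  match n with
  | 0 => @dirac _ (rV 0) (0 : 'rV[R]_0) R
  | m.+1 => lebV_step (lebV m)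
  end.

Lemma integral_lebVS n (f : rV n.+1 -> \bar R) :
  measurable_fun setT f -> (forall x, 0 <= f x)%E ->
  (\int[lebV n.+1]_x f x =
   \int[leb1 \x lebV n]_z f (row_cons z))%E.
Proof.
move=> mf f0; rewrite /= (@ge0_integral_pushforward _ _ _ _ _ _ (@measurable_row_cons n)) //.
Qed.

(** Tonelli's theorem, applied once per coordinate. This is the bridge from the iterated integrals
    in [is_volume] to an honest measure. *)
Lemma integral_rV_lebV n (f : rV n -> \bar R) :
  measurable_fun setT f -> (forall x, 0 <= f x)%E ->
  integral_rV f = (\int[lebV n]_x f x)%E.
Proof.
elim: n f => [|n IH] f mf f0.
  by rewrite /= integral_dirac // diracT mul1e.
rewrite integral_lebVS // fubini_tonelli1 //=; last first.
  exact: (measurableT_comp mf (@measurable_row_cons n)).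
apply: eq_integral => t _; rewrite IH //.
exact: (measurableT_comp mf (measurable_row_consr t)).
Qed.

Lemma continuous_row_cons n (t : R) :
  continuous (fun y : 'rV[R]_n => (row_cons (t, y) : 'rV[R]_n.+1)).
Proof.
move=> y A /nbhs_ballP[e /= e0 eA]; apply/nbhs_ballP; exists e => //= z [_ yz].
apply: eA; split=> // i j; rewrite ord1.
case: (unliftP ord0 j) => [k ->|->]; last by rewrite !row_cons0; exact: ballxx.
by rewrite !row_consS; exact: yz.
Qed.

Lemma continuous_row_consl n (y : 'rV[R]_n) :
  continuous (fun t : R => (row_cons (t, y) : 'rV[R]_n.+1)).
Proof.
move=> t A /nbhs_ballP[e /= e0 eA]; apply/nbhs_ballP; exists e => //= s ts.
apply: eA; split=> // i j; rewrite ord1.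
case: (unliftP ord0 j) => [k ->|->]; last by rewrite !row_cons0.
by rewrite !row_consS; exact: ballxx.
Qed.

Lemma norm_row_cons n (z : mT * rV n) :
  `|z.2 : 'rV[R]_n| <= `|row_cons z : 'rV[R]_n.+1|.
Proof.
rewrite [leLHS]/Num.norm /= mx_normrE; apply/bigmax_leP; split=> // -[i j] _ /=.
rewrite ord1 -row_consS [leRHS]/Num.norm /= mx_normrE.
exact: (le_bigmax _ (fun ij => `|(row_cons z : 'rV_n.+1) ij.1 ij.2|) (0, lift ord0 j)).
Qed.

Lemma norm_row_cons0 n (z : mT * rV n) :
  `|z.1| <= `|row_cons z : 'rV[R]_n.+1|.
Proof.
rewrite -{1}(row_cons0 z) [leRHS]/Num.norm /= mx_normrE.
exact: (le_bigmax _ (fun ij => `|(row_cons z : 'rV_n.+1) ij.1 ij.2|) (0, 0)).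
Qed.

Lemma row_consD n (s t : R) (x y : 'rV[R]_n) :
  (row_cons (s + t, x + y) : 'rV[R]_n.+1) = row_cons (s, x) + row_cons (t, y).
Proof.
apply/rowP => j; rewrite [RHS]mxE; case: (unliftP ord0 j) => [k ->|->].
  by rewrite !row_consS /= mxE.
by rewrite !row_cons0.
Qed.

Lemma ball_row_cons n (c : 'rV[R]_n.+1) (r : R) : 0 < r ->
  @row_cons n @^-1` ball c r =
  ball ((row_split c).1 : R) r `*` ball ((row_split c).2 : 'rV[R]_n) r.
Proof.
move=> r0; apply/seteqP; split=> [[t y] /= /(ball_rVE _ _ r0) H|[t y] /= [H1 /(ball_rVE _ _ r0) H2]].
  split; first by have := H 0; rewrite row_cons0.
  apply/ball_rVE => // j; have := H (lift ord0 j); rewrite row_consS mxE.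
  by congr (`|_ - _| < _); congr (c _ _); apply/val_inj.
apply/ball_rVE => // j; case: (unliftP ord0 j) => [k ->|->]; last by rewrite row_cons0.
rewrite row_consS; have := H2 k; rewrite mxE.
by congr (`|_ - _| < _); congr (c _ _); apply/val_inj.
Qed.

Lemma ball_measurable n (c : 'rV[R]_n) (r : R) :
  measurable (ball c r : set (rV n)).
Proof. by apply: sub_sigma_algebra; exact: ball_open. Qed.

Lemma lebV_ball n (c : 'rV[R]_n) (r : R) : 0 < r ->
  (0 < lebV n (ball c r) < +oo)%E.
Proof.
move=> r0; elim: n c => [|n IH] c /=.
  rewrite diracE mem_set ?lte01 ?ltry //.
  by apply/ball_rVE => // -[].
rewrite /lebV_step ball_row_cons // product_measure1E //; first last.
- exact: ball_measurable.
- by apply: open_measurable; exact: ball_open.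
have /andP[h1 h2] := IH (row_split c).2.
have /andP[l1 l2] : (0 < @lebesgue_measure R (ball ((row_split c).1 : R) r) < +oo)%E.
  by rewrite lebesgue_measure_ball ?(ltW r0) // ltry lte_fin pmulrn_rgt0.
apply/andP; split; first exact: mule_gt0.
by apply: lte_mul_pinfty => //; rewrite ge0_fin_numE.
Qed.

(** [G] vanishes outside a ball of finite measure and is bounded on it by the extreme value theorem
    on the closed ball, which is compact. *)
Lemma integrable_compact_support n (B : R) (G : 'rV[R]_n -> R) :
  continuous G -> (forall x, B <= `|x| -> G x = 0) ->
  (lebV n).-integrable setT (EFin \o G).
Proof.
move=> cG G0.
(* [B] may be negative or zero; the ball needs a positive radius. *)
pose b := Num.max B 1.
have b0 : 0 < b by rewrite lt_max ltr01 orbT.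
have mb : measurable (ball (0 : 'rV[R]_n) b : set (rV n)) by exact: ball_measurable.
have -> : EFin \o G = (EFin \o G) \_ (ball (0 : 'rV[R]_n) b).
  apply/funext => x; rewrite patchE; case: ifPn => // /negP H /=; rewrite G0 //.
  rewrite leNgt; apply/negP => xB; apply: H; rewrite inE -ball_normE /= sub0r normrN.
  by rewrite (lt_le_trans xB) // le_max lexx.
rewrite -(integrable_mkcond _ mb).
apply: (@measurable_bounded_integrable _ (rV n) _ (lebV n) G _ mb) => //.
- by case/andP: (lebV_ball (0 : 'rV[R]_n) b0).
- by apply: measurable_funS (continuous_borel cG).
have cN : {within [set x : 'rV[R]_n | `|x| <= b], continuous (fun x => `|G x|)}.
  by apply: continuous_subspaceT => x; apply: (continuous_comp (cG x)); exact: norm_continuous.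
have [||c _ cmax] := EVT_max_rV _ _ cN.
- by exists 0; rewrite /= normr0 ltW.
- apply: bounded_closed_compact.
    by exists b; split=> [|y yb x /= xb]; [exact: num_real|rewrite (le_trans xb) // ltW].
  rewrite (_ : mkset _ = (@Num.norm _ 'rV[R]_n) @^-1` [set y | y <= b]) //.
  by apply: closed_comp => [x _|]; [exact: norm_continuous|exact: closed_le].
exists `|G c|; split=> [|y cy x xb]; first exact: num_real.
apply: (le_trans _ (ltW cy)); apply: cmax; rewrite inE /=.
by move: xb; rewrite /= -ball_normE /= sub0r normrN => /ltW.
Qed.

(** Along the line through [x] in direction [v] both difference quotients are the same function of
    [h], so nothing about continuity or differentiability of [phi] enters. It serves to restrict
    directional derivatives to coordinate lines. *)
Lemma is_derive_affine (V W : normedModType R) (Z : normedModType R) (phi : V -> W)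
    (F : W -> Z) (v : V) (w : W) (x : V) (d : Z) :
  (forall h : R, phi (h *: v + x) = h *: w + phi x) ->
  is_derive (phi x) w F d -> is_derive x v (F \o phi) d.
Proof.
move=> phiE [dF <-].
have E : (fun h : R => h^-1 *: (((F \o phi) \o shift x) (h *: v) - (F \o phi) x)) =
         (fun h : R => h^-1 *: ((F \o shift (phi x)) (h *: w) - F (phi x))).
  by apply/funext => h; rewrite /= /shift /= phiE.
by split; rewrite /derivable /derive E.
Qed.

(** The fundamental theorem of calculus on [[-b, b]], at whose end points [f] vanishes. *)
Lemma integral_derive0 (B : R) (f g : R -> R) :
  continuous g -> (forall t : R, is_derive t 1 f (g t)) ->
  (forall t, B <= `|t| -> f t = 0) -> (forall t, B <= `|t| -> g t = 0) ->
  (\int[@lebesgue_measure R]_t (g t)%:E = 0)%E.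
Proof.
move=> cg df f0 g0.
pose b := Num.max B 1.
have b0 : 0 < b by rewrite lt_max ltr01 orbT.
have bN : - b < b by rewrite gtrN.
have Bb : B <= b by rewrite le_max lexx.
rewrite (_ : (fun t => (g t)%:E) = (EFin \o g) \_ `[-b, b]%classic); last first.
  apply/funext => t; rewrite patchE; case: ifPn => // /negP tb /=.
  rewrite g0 // (le_trans Bb) // leNgt; apply/negP => tb'; apply: tb.
  by rewrite inE /= in_itv /= -ler_norml ltW.
rewrite -integral_mkcond (@continuous_FTC2 _ _ f) //.
- by rewrite !f0 ?normrN ?ger0_norm ?(ltW b0) // subee.
- by apply: continuous_subspaceT.
- have cf t : {for t, continuous f}.
    by apply: differentiable_continuous; apply/derivable1_diffP; case: (df t).
  split; first by move=> t _; case: (df t).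
  + by apply: cvg_at_right_filter; exact: cf.
  + by apply: cvg_at_left_filter; exact: cf.
- by move=> t _; rewrite derive1E; case: (df t).
Qed.

Lemma norm_row_gt n (x : 'rV[R]_n.+1) (B : R) :
  B <= `|(row_split x).1| \/ B <= `|(row_split x).2 : 'rV[R]_n| -> B <= `|x|.
Proof.
rewrite -{3}(row_splitK x) => -[] /le_trans; apply.
  exact: norm_row_cons0.
exact: norm_row_cons.
Qed.

(** The divergence theorem for compact support, by Fubini. If [i] is the first coordinate, it is
    integrated first and the inner integral is 0 by [integral_derive0]; otherwise the first
    coordinate is frozen and the induction hypothesis kills the inner integral. *)
Lemma integral_partial0 n (i : 'I_n) (B : R) (F G : 'rV[R]_n -> R) :
  continuous G -> (forall x, is_derive x (delta_mx 0 i) F (G x)) ->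
  (forall x, B <= `|x| -> F x = 0) -> (forall x, B <= `|x| -> G x = 0) ->
  (\int[lebV n]_x (G x)%:E = 0)%E.
Proof.
elim: n i F G => [[]//|n IH] i F G cG dF F0 G0.
have iG := integrable_compact_support cG G0.
have mrow := @measurable_row_cons n.
have mG : measurable_fun setT (fun z => (G (row_cons z : 'rV[R]_n.+1))%:E).
  by apply/measurable_EFinP; apply: (measurableT_comp (continuous_borel cG) mrow).
have iG2 : (leb1 \x lebV n)%E.-integrable setT (fun z => (G (row_cons z : 'rV[R]_n.+1))%:E).
  apply/integrableP; split=> //.
  move/integrableP : iG => [_]; rewrite integral_lebVS //; last first.
  by apply: measurableT_comp => //; apply/measurable_EFinP; exact: continuous_borel.
transitivity (\int[leb1 \x lebV n]_z (G (row_cons z : 'rV[R]_n.+1))%:E)%E.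
  have mG' : measurable_fun setT (fun x : rV n.+1 => (G x)%:E).
    by apply/measurable_EFinP; exact: continuous_borel.
  apply: (integral_pushforward mrow mG' _ (@measurableT _ (rV n.+1))).
  exact: iG2.
have rsK (z : mT * rV n) : row_split (row_cons z) = z by exact: row_consK.
case: (unliftP ord0 i) dF => [j ->|->] dF.
- rewrite -integral12_prod_meas1 //.
  rewrite (eq_integral (cst 0%E)) ?integral0 // => t _.
  apply: (IH j (fun y => F (row_cons (t, y))) (fun y => G (row_cons (t, y)))).
  + by move=> y; apply: (continuous_comp (@continuous_row_cons n t y)); exact: cG.
  + move=> y; apply: (@is_derive_affine _ _ _ (fun y => row_cons (t, y)) F _ _ _ _ _ (dF _)).
    move=> h; rewrite -[in LHS](add0r t) row_consD; congr (_ + _).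
    apply/rowP => k; case: (unliftP ord0 k) => [l ->|->].
      by rewrite row_consS !mxE /= (inj_eq lift_inj).
    by rewrite row_cons0 !mxE /= mulr0.
  + by move=> y yB; apply: F0; apply: norm_row_gt; rewrite rsK; right.
  + by move=> y yB; apply: G0; apply: norm_row_gt; rewrite rsK; right.
- rewrite -integral21_prod_meas1 //.
  rewrite (eq_integral (cst 0%E)) ?integral0 // => y _.
  have aff (t h : R) : (row_cons (h *: (1 : R^o) + t, y) : 'rV[R]_n.+1) =
      h *: delta_mx 0 0 + row_cons (t, y).
    rewrite -[in LHS](add0r y) row_consD; congr (_ + _).
    apply/rowP => k; case: (unliftP ord0 k) => [l ->|->].
      by rewrite row_consS !mxE /= mulr0.
    by rewrite row_cons0 !mxE /=.
  apply: (@integral_derive0 B (fun t => F (row_cons (t, y))) (fun t => G (row_cons (t, y)))).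
  + by move=> t; apply: (continuous_comp (@continuous_row_consl n y t)); exact: cG.
  + move=> t; apply: (@is_derive_affine R^o _ _ (fun t => row_cons (t, y)) F _ _ _ _ _ (dF _)).
    by move=> h; exact: aff.
  + by move=> t tB; apply: F0; apply: norm_row_gt; rewrite rsK; left.
  + by move=> t tB; apply: G0; apply: norm_row_gt; rewrite rsK; left.
Qed.

End LebesgueRow.

(** * Functions of class C^k on open sets *)

Section Differentiability.
Context {R : realType}.

Lemma mvt_le (f df : R -> R) (a b e : R) :
  (forall s, `|s - a| <= `|b - a| -> is_derive s 1 f (df s)) ->
  (forall s, `|s - a| <= `|b - a| -> `|df s| <= e) ->
  `|f b - f a| <= e * `|b - a|.
Proof.
move=> dfd dfe.
have cf s : `|s - a| <= `|b - a| -> {for s, continuous f}.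
  by move=> /dfd[d _]; apply: differentiable_continuous; exact/derivable1_diffP.
case: (leP a b) => ab.
  have sab s : s \in `[a, b] -> `|s - a| <= `|b - a|.
    by rewrite in_itv /= => /andP[? ?]; rewrite !ger0_norm ?subr_ge0 // lerD2r.
  have [||c cab ->] := @MVT_segment R f df a b ab.
  - by move=> s sI; apply/dfd/sab; apply: subset_itvW sI.
  - by apply: continuous_in_subspaceT => s; rewrite inE => /sab/cf.
  - by rewrite normrM ler_wpM2r // dfe // sab.
have sab s : s \in `[b, a] -> `|s - a| <= `|b - a|.
  by rewrite in_itv /= => /andP[? ?]; rewrite !ler0_norm ?subr_le0 ?(ltW ab) // lerN2 lerD2r.
have [||c cab] := @MVT_segment R f df b a (ltW ab).
- by move=> s sI; apply/dfd/sab; apply: subset_itvW sI.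
- by apply: continuous_in_subspaceT => s; rewrite inE => /sab/cf.
- by rewrite distrC (distrC b) => ->; rewrite normrM ler_wpM2r // dfe // sab.
Qed.

Lemma continuous_at_sum (T : topologicalType) (x : T) I (r : seq I) (P : pred I)
    (F : I -> T -> R) :
  (forall i, {for x, continuous (F i)}) ->
  {for x, continuous (fun y => \sum_(i <- r | P i) F i y)}.
Proof.
move=> cF; elim: r => [|i r IH].
  rewrite (_ : (fun _ => _) = cst 0); first exact: cvg_cst.
  by apply/funext => y; rewrite big_nil.
case Pi: (P i); last first.
  by rewrite (_ : (fun _ => _) = (fun y => \sum_(i <- r | P i) F i y)) //;
    apply/funext => y; rewrite big_cons Pi.
rewrite (_ : (fun _ => _) = (fun y => F i y + \sum_(i <- r | P i) F i y)).
  by apply: cvgD; [exact: cF|exact: IH].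
by apply/funext => y; rewrite big_cons Pi.
Qed.

Lemma continuous_at_prod (T : topologicalType) (x : T) I (r : seq I) (P : pred I)
    (F : I -> T -> R) :
  (forall i, {for x, continuous (F i)}) ->
  {for x, continuous (fun y => \prod_(i <- r | P i) F i y)}.
Proof.
move=> cF; elim: r => [|i r IH].
  rewrite (_ : (fun _ => _) = cst 1); first exact: cvg_cst.
  by apply/funext => y; rewrite big_nil.
case Pi: (P i); last first.
  by rewrite (_ : (fun _ => _) = (fun y => \prod_(i <- r | P i) F i y)) //;
    apply/funext => y; rewrite big_cons Pi.
rewrite (_ : (fun _ => _) = (fun y => F i y * \prod_(i <- r | P i) F i y)).
  by apply: cvgM; [exact: cF|exact: IH].
by apply/funext => y; rewrite big_cons Pi.
Qed.

Lemma coord_le_norm m (h : 'rV[R]_m) k : `|h 0 k| <= `|h|.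
Proof.
rewrite [leRHS]/Num.norm /= mx_normrE.
exact: (le_bigmax _ (fun ij => `|h ij.1 ij.2|) (0, k)).
Qed.

Lemma norm_rV_le m (h : 'rV[R]_m) (e : R) :
  0 <= e -> (forall k, `|h 0 k| <= e) -> `|h| <= e.
Proof.
move=> e0 he; rewrite [leLHS]/Num.norm /= mx_normrE.
by apply/bigmax_leP; split=> // -[i j] _ /=; rewrite ord1.
Qed.

Variable n : nat.
Implicit Types (f : 'rV[R]_n -> R) (x y : 'rV[R]_n) (U : set 'rV[R]_n).

(** The mean value inequality for [s] mapped to [f (s e_k + y) - s c], whose derivative is the
    deviation of the partial derivative from [c]. *)
Lemma partial_increment f y (k : 'I_n) (b c e : R) :
  (forall s, `|s| <= `|b| -> derivable f (s *: delta_mx 0 k + y) (delta_mx 0 k)) ->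
  (forall s, `|s| <= `|b| -> `|partial k f (s *: delta_mx 0 k + y) - c| <= e) ->
  `|f (b *: delta_mx 0 k + y) - f y - b * c| <= e * `|b|.
Proof.
move=> df dfe.
pose phi (s : R) := f (s *: delta_mx 0 k + y) - s * c.
have := @mvt_le phi (fun s => partial k f (s *: delta_mx 0 k + y) - c) 0 b e.
rewrite subr0 /phi scale0r add0r mul0r subr0 addrAC; apply; last first.
  by move=> s; rewrite subr0; exact: dfe.
move=> s; rewrite subr0 => sb; apply: is_deriveB.
  apply: (@is_derive_affine _ R^o _ _ (fun s : R => s *: delta_mx 0 k + y) f).
    by move=> h; rewrite scalerDl [h%:A]mulr1 addrA.
  by apply: derivableP; exact: df.
apply: (@is_derive_affine _ R^o R^o _ (fun s : R => s * c) id 1 c).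
by move=> h; rewrite mulrDl [h%:A]mulr1.
Qed.

(** The classical argument: the increment of [f] is split into increments along the coordinate axes,
    each controlled by continuity of one partial derivative. Differentiability is what the chain
    rule needs, while [Ck_on] speaks of partial derivatives only. *)
Lemma Ck1_differentiable U f x :
  open U -> Ck_on 1 U f -> U x -> differentiable f x.
Proof.
move=> oU [cf df] Ux.
pose c : 'cV[R]_n := \col_k partial k f x.
pose L (h : 'rV[R]_n) : R := \sum_k h 0 k * partial k f x.
have linL : linear (L : 'rV[R]_n -> R^o).
  move=> a u v; rewrite /L scaler_sumr -big_split /=; apply: eq_bigr => k _.
  by rewrite !mxE mulrDl -mulrA.
pose LL : {linear 'rV[R]_n -> R^o} := HB.pack L (GRing.isLinear.Build _ _ _ _ _ linL).
have cL : continuous LL.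
  move=> h; apply: continuous_at_sum => k.
  have ck := @coord_continuous R 1 n 0 k h.
  by apply: (continuousM ck); exact: cst_continuous.
suff H : (f : 'rV[R]_n -> R^o) \o shift x = cst (f x : R^o) + LL +o_ (0 : 'rV[R]_n) id.
  by apply/diff_locallyP; rewrite (diff_unique cL H); split.
apply/eqaddoP => e e0.
(* There are [n] coordinate increments; dividing by [n + 1] keeps their sum below [e] and also
   covers [n = 0]. *)
have en0 : 0 < e / n.+1%:R by rewrite divr_gt0.
have [d /= d0 dP] : exists2 d : R, 0 < d & forall y, `|y - x| < d ->
    U y /\ forall k, `|partial k f y - partial k f x| <= e / n.+1%:R.
  have h1 : nbhs x U by exact: open_nbhs_nbhs.
  have h2 : \forall y \near x, forall k, `|partial k f y - partial k f x| <= e / n.+1%:R.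
    apply: (@filter_forall _ _ (fun k y => `|partial k f y - partial k f x| <= e / n.+1%:R) _ (nbhs_filter x)) => k.
    have [_ [/(_ _ Ux)]] := df k.
    by move=> /cvgrPdist_le /(_ _ en0) + _; apply: filterS => y; rewrite distrC.
  have : nbhs x (U `&` [set y | forall k, `|partial k f y - partial k f x| <= e / n.+1%:R]).
    exact: (@filterI _ _ (nbhs_filter x)).
  move=> /nbhs_ballP[d /= d0 H]; exists d => // y yd; apply: H.
  by rewrite -ball_normE /= distrC.
near=> h.
have hd : `|h| < d.
  near: h; apply/nbhs_ballP; exists d => //= y.
  by rewrite -ball_normE /= sub0r normrN.
(* [H k] keeps the first [k] coordinates of [h]: the path from 0 to [h] along the axes, over which
   the increment telescopes. *)
pose H k : 'rV[R]_n := \row_j (if (j < k)%N then h 0 j else 0).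
have Hs (k : 'I_n) : H k.+1 = h 0 k *: delta_mx 0 k + H k.
  apply/rowP => j; rewrite !mxE eqxx /= ltnS leq_eqVlt.
  have [->|jk] := eqVneq j k; first by rewrite eqxx ltnn mulr1 addr0.
  by rewrite (negbTE (_ : j != k :> nat)) //= mulr0 add0r.
have Hn (k : nat) : `|H k| <= `|h|.
  apply: norm_rV_le => // j; rewrite mxE.
  by case: ifP => _; rewrite ?normr0 // coord_le_norm.
rewrite [X in `|X| <= _](_ : _ = \sum_(k < n)
    (f (h 0 k *: delta_mx 0 k + (H k + x)) - f (H k + x) - h 0 k * partial k f x)); last first.
  rewrite sumrB -[LHS]/(f (h + x) - (f x + \sum_k h 0 k * partial k f x)).
  rewrite opprD addrA; congr (_ - _).
  under eq_bigr do rewrite addrA -Hs.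
  rewrite -(big_mkord xpredT (fun k => f (H k.+1 + x) - f (H k + x))) telescope_sumr //.
  congr (f (_ + x) - f _).
    by apply/rowP => j; rewrite mxE ltn_ord.
  by rewrite -[LHS]add0r; congr (_ + x); apply/rowP => j; rewrite !mxE.
apply: (le_trans (ler_norm_sum _ _ _)).
apply: (@le_trans _ _ (\sum_(k < n) (e / n.+1%:R * `|h|))); last first.
  rewrite sumr_const card_ord -[leLHS]mulr_natr mulrAC ler_wpM2r //.
  rewrite -mulrA ger_pMr // mulrC ler_pdivrMr // mul1r ler_nat //.
apply: ler_sum => k _.
apply: (@le_trans _ _ (e / n.+1%:R * `|h 0 k|)); last first.
  by rewrite ler_wpM2l ?(ltW en0) // coord_le_norm.
have inb s : `|s| <= `|h 0 k| -> `|(s *: delta_mx 0 k + (H k + x)) - x| < d.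
  move=> sh; rewrite addrA addrK (le_lt_trans _ hd) //.
  apply: norm_rV_le => // j; rewrite !mxE eqxx /=.
  have [->|jk] := eqVneq j k.
    by rewrite ltnn mulr1 addr0 (le_trans sh) // coord_le_norm.
  by rewrite mulr0 add0r; case: ifP => _; rewrite ?normr0 // coord_le_norm.
apply: partial_increment => s /inb /dP[Uy dy]; last exact: dy.
by have [/(_ _ Uy)] := df k.
Unshelve. all: by end_near.
Qed.

Lemma differential_partial f y (w : 'rV[R]_n) : differentiable f y ->
  'd f y w = \sum_k w 0 k * partial k f y.
Proof.
move=> df; rewrite {1}[w]row_sum_delta linear_sum; apply: eq_bigr => k _.
by rewrite linearZ /= /partial deriveE.
Qed.

(** [tau] is known to be derivable only in direction [v]. Restricting it to the line through [x]
    gives a curve [gam] in one variable, for which derivable and differentiable agree, and the chain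
    rule for differentials applies to [f \o gam] at 0. *)
Lemma is_derive_curve m (tau : 'rV[R]_m -> 'rV[R]_n) f (x v : 'rV[R]_m) :
  differentiable f (tau x) ->
  (forall k, derivable (fun z => tau z 0 k) x v) ->
  is_derive x v (f \o tau) (\sum_k 'D_v (fun z => tau z 0 k) x * partial k f (tau x)).
Proof.
move=> df dtau.
pose gam (s : R^o) := tau (s *: v + x).
have g0 : gam 0 = tau x by rewrite /gam scale0r add0r.
have dgk k : is_derive (0 : R^o) 1 (fun s => gam s 0 k) ('D_v (fun z => tau z 0 k) x).
  apply: (@is_derive_affine _ R^o _ _ (fun s : R^o => s *: v + x) (fun z => tau z 0 k) _ v).
    by move=> h; rewrite scalerDl [h%:A]mulr1 addrA.
  by rewrite scale0r add0r; exact: derivableP.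
have dg : derivable gam 0 1.
  by apply/derivable_mxP => i k; rewrite ord1; case: (dgk k).
have dfg : differentiable gam 0 by apply/derivable1_diffP.
have dfg0 : differentiable f (gam 0) by rewrite g0.
have Dg : 'D_1 gam 0 = \row_k 'D_v (fun z => tau z 0 k) x.
  rewrite derive_mx //; apply/rowP => k; rewrite !mxE.
  by case: (dgk k).
have dcomp : differentiable (f \o gam) 0 by exact: differentiable_comp.
have E : (fun h : R => h^-1 *: (((f \o tau) \o shift x) (h *: v) - (f \o tau) x)) =
         (fun h : R => h^-1 *: (((f \o gam) \o shift (0 : R^o)) (h *: (1 : R^o)) - (f \o gam) 0)).
  by apply/funext => h; rewrite /= /shift /= g0 /gam addr0 [h%:A]mulr1.
have der : derivable (f \o gam) 0 1 by exact: diff_derivable.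
split; first by rewrite /derivable E.
rewrite /derive E -/(derive (f \o gam) 0 1) deriveE // diff_comp //=.
rewrite -[X in 'd f _ X](_ : 'D_1 gam 0 = _); last by rewrite deriveE.
by rewrite Dg g0 differential_partial //; apply: eq_bigr => k _; rewrite mxE.
Qed.

End Differentiability.

Section NearOpen.
Context {R : realType} (T : topologicalType) (U : set T).

Lemma near_open (P : T -> Prop) x : open U -> U x ->
  (forall y, U y -> P y) -> \forall y \near x, P y.
Proof. by move=> oU Ux UP; apply: filterS (open_nbhs_nbhs (conj oU Ux)). Qed.

Lemma continuous_eq_on (f g : T -> R) x : open U -> (forall y, U y -> f y = g y) -> U x ->
  {for x, continuous f} -> {for x, continuous g}.
Proof.
move=> oU fg Ux; rewrite /prop_for /continuous_at -(fg x Ux) => cf.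
by apply: cvg_trans cf; apply: near_eq_cvg; exact: near_open fg.
Qed.

End NearOpen.

Section Ck.
Context {R : realType} {n : nat}.
Implicit Types (f g : 'rV[R]_n -> R) (x y : 'rV[R]_n) (U V : set 'rV[R]_n).

Lemma partial_eq_on U f g i x : open U -> (forall y, U y -> f y = g y) -> U x ->
  partial i f x = partial i g x.
Proof. by move=> oU fg Ux; apply: near_eq_derive; exact: near_open fg. Qed.

Lemma derivable_eq_on U f g v x : open U -> (forall y, U y -> f y = g y) -> U x ->
  derivable f x v -> derivable g x v.
Proof. by move=> oU fg Ux; apply: near_eq_derivable; exact: near_open fg. Qed.

Lemma Ck_on_continuous k U f x : Ck_on k U f -> U x -> {for x, continuous f}.
Proof. by case: k => [|k] [cf _]; exact: cf. Qed.

Lemma Ck_on_partial k U f i : Ck_on k.+1 U f -> Ck_on k U (partial i f).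
Proof. by move=> [_ /(_ i)[]]. Qed.

Lemma Ck_on_derivable k U f i x : Ck_on k.+1 U f -> U x ->
  derivable f x (delta_mx 0 i).
Proof. by move=> [_ /(_ i)[+ _]]; exact. Qed.

Lemma Ck_on_le k l U f : (k <= l)%N -> Ck_on l U f -> Ck_on k U f.
Proof.
elim: l k f => [|l IH] [|k] f //=; first by move=> _ [].
move=> kl [cf df]; split=> // i; have [dfi Cf] := df i; split=> //.
exact: IH Cf.
Qed.

Lemma Ck_on_eq k U f g : open U -> (forall y, U y -> f y = g y) ->
  Ck_on k U f -> Ck_on k U g.
Proof.
move=> oU; elim: k f g => [|k IH] f g fg [cf df]; split=> //.
- by move=> x Ux; apply: (continuous_eq_on oU fg Ux); exact: cf.
- by move=> x Ux; apply: (continuous_eq_on oU fg Ux); exact: cf.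
- move=> i; have [dfi Cf] := df i; split.
    by move=> x Ux; apply: (derivable_eq_on oU fg Ux); exact: dfi.
  by apply: IH Cf => y Uy; exact: (partial_eq_on i oU fg Uy).
Qed.

Lemma Ck_on_sub k U V f : V `<=` U -> Ck_on k U f -> Ck_on k V f.
Proof.
move=> VU; elim: k f => [|k IH] f [cf df]; split=> //.
- by move=> x Vx; apply: cf; exact: VU.
- by move=> x Vx; apply: cf; exact: VU.
- by move=> i; have [dfi Cf] := df i; split=> [x Vx|]; [apply/dfi/VU|exact: IH].
Qed.

Lemma partialD f g i x : derivable f x (delta_mx 0 i) -> derivable g x (delta_mx 0 i) ->
  partial i (fun y => f y + g y) x = partial i f x + partial i g x.
Proof. exact: deriveD. Qed.

Lemma partialB f g i x : derivable f x (delta_mx 0 i) -> derivable g x (delta_mx 0 i) ->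
  partial i (fun y => f y - g y) x = partial i f x - partial i g x.
Proof. exact: deriveB. Qed.

Lemma partialM f g i x : derivable f x (delta_mx 0 i) -> derivable g x (delta_mx 0 i) ->
  partial i (fun y => f y * g y) x = f x * partial i g x + partial i f x * g x.
Proof. by move=> df dg; rewrite /partial [LHS]deriveM //; congr (_ + _); rewrite -[_ *: _]mulrC. Qed.

Lemma partial_cst (c : R) i x : partial i (fun=> c) x = 0.
Proof. exact: derive_cst. Qed.

Lemma derivable_sumf I (r : seq I) (P : pred I) (F : I -> 'rV[R]_n -> R) x v :
  (forall j, derivable (F j) x v) ->
  derivable (fun y => \sum_(j <- r | P j) F j y) x v.
Proof.
move=> dF; elim: r => [|j r IH].
  by rewrite (_ : (fun _ => _) = cst 0) //; apply/funext => y; rewrite big_nil.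
rewrite (_ : (fun _ => _) = (fun y => (if P j then F j y else 0) + \sum_(j <- r | P j) F j y)).
  by apply: derivableD => //; case: (P j).
by apply/funext => y; rewrite big_cons; case: ifP; rewrite ?add0r.
Qed.

Lemma partial_sum I (r : seq I) (P : pred I) (F : I -> 'rV[R]_n -> R) i x :
  (forall j, derivable (F j) x (delta_mx 0 i)) ->
  partial i (fun y => \sum_(j <- r | P j) F j y) x = \sum_(j <- r | P j) partial i (F j) x.
Proof.
move=> dF; elim: r => [|j r IH].
  rewrite big_nil -[RHS](partial_cst 0 i x); congr (partial i _ x).
  by apply/funext => y; rewrite big_nil.
rewrite big_cons -IH.
have -> : (fun y => \sum_(j <- j :: r | P j) F j y) =
  (fun y => (if P j then F j y else 0) + \sum_(j <- r | P j) F j y).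
  by apply/funext => y; rewrite big_cons; case: ifP; rewrite ?add0r.
have dj : derivable (fun y => if P j then F j y else 0) x (delta_mx 0 i).
  by case: (P j) => //; exact: derivable_cst.
rewrite partialD //; last exact: derivable_sumf.
by case: (P j) => //; rewrite partial_cst add0r.
Qed.

Section OpenSet.
Variable U : set 'rV[R]_n.
Hypothesis oU : open U.

Lemma Ck_on_cst k (c : R) : Ck_on k U (fun=> c).
Proof.
elim: k c => [|k IH] c; split=> //; try by move=> x _; exact: cst_continuous.
move=> i; split=> [x _|]; first exact: derivable_cst.
by apply: (Ck_on_eq oU) (IH 0) => y _; rewrite partial_cst.
Qed.

Lemma Ck_onD k f g : Ck_on k U f -> Ck_on k U g -> Ck_on k U (fun y => f y + g y).
Proof.
elim: k f g => [|k IH] f g Cf Cg; (split=> [x Ux|]; first by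
    apply: (continuousD (Ck_on_continuous Cf Ux) (Ck_on_continuous Cg Ux))) => //.
move=> i; have df x (Ux : U x) : derivable f x (delta_mx 0 i) := Ck_on_derivable Cf Ux.
have dg x (Ux : U x) : derivable g x (delta_mx 0 i) := Ck_on_derivable Cg Ux.
split=> [x Ux|]; first by apply: derivableD; [exact: df|exact: dg].
apply: (Ck_on_eq oU) (IH _ _ (Ck_on_partial i Cf) (Ck_on_partial i Cg)) => y Uy.
by rewrite partialD //; [exact: df|exact: dg].
Qed.

Lemma Ck_onM k f g : Ck_on k U f -> Ck_on k U g -> Ck_on k U (fun y => f y * g y).
Proof.
elim: k f g => [|k IH] f g Cf Cg; (split=> [x Ux|]; first by
    apply: (continuousM (Ck_on_continuous Cf Ux) (Ck_on_continuous Cg Ux))) => //.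
move=> i; have df x (Ux : U x) : derivable f x (delta_mx 0 i) := Ck_on_derivable Cf Ux.
have dg x (Ux : U x) : derivable g x (delta_mx 0 i) := Ck_on_derivable Cg Ux.
split=> [x Ux|]; first by apply: derivableM; [exact: df|exact: dg].
have Cf' := Ck_on_le (leqnSn k) Cf; have Cg' := Ck_on_le (leqnSn k) Cg.
have := Ck_onD (IH _ _ Cf' (Ck_on_partial i Cg)) (IH _ _ (Ck_on_partial i Cf) Cg').
by apply: (Ck_on_eq oU) => y Uy; rewrite partialM //; [exact: df|exact: dg].
Qed.

Lemma Ck_onN k f : Ck_on k U f -> Ck_on k U (fun y => - f y).
Proof.
move=> Cf; have := Ck_onM (Ck_on_cst k (-1)) Cf.
by apply: (Ck_on_eq oU) => y _; rewrite mulN1r.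
Qed.

Lemma Ck_onB k f g : Ck_on k U f -> Ck_on k U g -> Ck_on k U (fun y => f y - g y).
Proof. by move=> Cf /Ck_onN; exact: Ck_onD. Qed.

Lemma Ck_on_sum k I (r : seq I) (P : pred I) (F : I -> 'rV[R]_n -> R) :
  (forall j, P j -> Ck_on k U (F j)) -> Ck_on k U (fun y => \sum_(j <- r | P j) F j y).
Proof.
move=> CF; elim: r => [|j r IH].
  by apply: (Ck_on_eq oU) (Ck_on_cst k 0) => y _; rewrite big_nil.
case Pj : (P j).
  by apply: (Ck_on_eq oU) (Ck_onD (CF j Pj) IH) => y _; rewrite big_cons Pj.
by apply: (Ck_on_eq oU) IH => y _; rewrite big_cons Pj.
Qed.

Lemma Ck_on_prod k I (r : seq I) (P : pred I) (F : I -> 'rV[R]_n -> R) :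
  (forall j, P j -> Ck_on k U (F j)) -> Ck_on k U (fun y => \prod_(j <- r | P j) F j y).
Proof.
move=> CF; elim: r => [|j r IH].
  by apply: (Ck_on_eq oU) (Ck_on_cst k 1) => y _; rewrite big_nil.
case Pj : (P j).
  by apply: (Ck_on_eq oU) (Ck_onM (CF j Pj) IH) => y _; rewrite big_cons Pj.
by apply: (Ck_on_eq oU) IH => y _; rewrite big_cons Pj.
Qed.

(** The same reduction to a curve in one variable, now with the scalar function outside. *)
Lemma is_derive_comp1 (h : R -> R) (dh : R) f x (v : 'rV[R]_n) :
  is_derive (f x) 1 h dh -> derivable f x v ->
  is_derive x v (h \o f) (dh * 'D_v f x).
Proof.
move=> hd df.
pose gam (s : R^o) := f (s *: v + x) : R^o.
have g0 : gam 0 = f x by rewrite /gam scale0r add0r.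
have dg : is_derive (0 : R^o) 1 gam ('D_v f x).
  apply: (@is_derive_affine _ R^o _ _ (fun s : R^o => s *: v + x) f _ v).
    by move=> h'; rewrite scalerDl [h'%:A]mulr1 addrA.
  by rewrite scale0r add0r; exact: derivableP.
have E : (fun s : R => s^-1 *: (((h \o f) \o shift x) (s *: v) - (h \o f) x)) =
         (fun s : R => s^-1 *: (((h \o gam) \o shift (0 : R^o)) (s *: (1 : R^o)) - (h \o gam) 0)).
  by apply/funext => s; rewrite /= /shift /= g0 /gam addr0 [s%:A]mulr1.
have hd0 : is_derive (gam 0) 1 h dh by rewrite g0.
have [D1 D2] := is_derive1_comp hd0 dg.
by split; rewrite /derivable /derive E //; rewrite -[LHS]/('D_1 (h \o gam) 0) D2 mulrC.
Qed.

Lemma partial_powR (a : R) f i x : 0 < f x -> derivable f x (delta_mx 0 i) ->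
  partial i (fun y => f y `^ a) x = a * f x `^ (a - 1) * partial i f x.
Proof.
move=> fx0 df.
by have [_ <-] := is_derive_comp1 (is_derive1_powR a fx0) df.
Qed.

(** A partial derivative is again a power of [f] times a function of lower class, with exponent
    [a - 1]; hence the induction on [k] runs over all exponents at once. *)
Lemma Ck_on_powR k (a : R) f : (forall x, U x -> 0 < f x) ->
  Ck_on k U f -> Ck_on k U (fun y => f y `^ a).
Proof.
move=> f0.
have cf l (a' : R) x : Ck_on l U f -> U x -> {for x, continuous (fun y => f y `^ a')}.
  move=> Cf Ux; have cp : {for f x, continuous (fun s : R => s `^ a')}.
    apply: differentiable_continuous; apply/derivable1_diffP.
    by case: (is_derive1_powR a' (f0 x Ux)).
  exact: (@continuous_comp _ _ _ f (fun s => s `^ a') x (Ck_on_continuous Cf Ux) cp).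
elim: k a => [|k IH] a Cf; (split=> [x Ux|]; first exact: cf Cf Ux) => //.
move=> i; have df x (Ux : U x) : derivable f x (delta_mx 0 i) := Ck_on_derivable Cf Ux.
split=> [x Ux|].
  by case: (is_derive_comp1 (is_derive1_powR a (f0 x Ux)) (df x Ux)).
have := Ck_onM (Ck_onM (Ck_on_cst k a) (IH (a - 1) (Ck_on_le (leqnSn k) Cf)))
  (Ck_on_partial i Cf).
by apply: (Ck_on_eq oU) => y Uy; rewrite partial_powR //; [exact: f0|exact: df].
Qed.

Lemma Ck_onV k f : (forall x, U x -> 0 < f x) ->
  Ck_on k U f -> Ck_on k U (fun y => (f y)^-1).
Proof.
move=> f0 /(Ck_on_powR (-1) f0); apply: (Ck_on_eq oU) => y Uy.
by rewrite powR_inv1 // ltW // f0.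
Qed.

Lemma Ck_on_det k m (A : 'rV[R]_n -> 'M[R]_m) :
  (forall i j, Ck_on k U (fun x => A x i j)) -> Ck_on k U (fun x => \det (A x)).
Proof.
move=> CA; apply: Ck_on_sum => s _; apply: Ck_onM; first exact: Ck_on_cst.
by apply: Ck_on_prod => i _; exact: CA.
Qed.

Lemma Ck_on_adj k m (A : 'rV[R]_n -> 'M[R]_m) i j :
  (forall i j, Ck_on k U (fun x => A x i j)) -> Ck_on k U (fun x => (\adj (A x)) i j).
Proof.
move=> CA.
have C : Ck_on k U (fun x => (-1) ^+ (j + i) * \det (row' j (col' i (A x)))).
  apply: Ck_onM; first exact: Ck_on_cst.
  apply: Ck_on_det => a b.
  by apply: (Ck_on_eq oU) (CA (lift j a) (lift i b)) => y _; rewrite !mxE.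
by apply: (Ck_on_eq oU) C => y _; rewrite mxE.
Qed.

(** Cramer's rule. The determinant is asked to be positive, as for a metric, so that its inverse
    falls under [Ck_onV], which is the power -1. *)
Lemma Ck_on_invmx k m (A : 'rV[R]_n -> 'M[R]_m) i j :
  (forall x, U x -> 0 < \det (A x)) ->
  (forall i j, Ck_on k U (fun x => A x i j)) -> Ck_on k U (fun x => invmx (A x) i j).
Proof.
move=> d0 CA.
apply: (Ck_on_eq oU) (Ck_onM (Ck_onV d0 (Ck_on_det CA)) (Ck_on_adj i j CA)) => y Uy.
by rewrite /invmx unitmxE unitfE (gt_eqF (d0 y Uy)) !mxE.
Qed.

End OpenSet.

End Ck.

Section Composition.
Context {R : realType} {n : nat}.
Implicit Types (f g : 'rV[R]_n -> R) (U : set 'rV[R]_n).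

Lemma continuous_rV (T : topologicalType) m (tau : T -> 'rV[R]_m) (p : T) :
  (forall k, {for p, continuous (fun q => tau q 0 k)}) -> {for p, continuous tau}.
Proof.
move=> ct A /nbhs_ballP[e /= e0 eA].
have : \forall q \near p, forall k, ball (tau p 0 k) e (tau q 0 k).
  apply: (@filter_forall _ _ (fun k q => ball (tau p 0 k) e (tau q 0 k)) _ (nbhs_filter p)) => k.
  by apply: (ct k); exact: nbhsx_ballx.
by apply: filterS => q H; apply: eA; split=> // i j; rewrite ord1; exact: H.
Qed.

Lemma partial_comp m (tau : 'rV[R]_m -> 'rV[R]_n) f (x : 'rV[R]_m) (i : 'I_m) :
  differentiable f (tau x) ->
  (forall k, derivable (fun z => tau z 0 k) x (delta_mx 0 i)) ->
  partial i (f \o tau) x =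
    \sum_k partial i (fun z => tau z 0 k) x * partial k f (tau x).
Proof. by move=> df dt; have [_] := is_derive_curve df dt. Qed.

(** Used for changes of charts, where order 1 suffices: bump functions and partitions of unity are
    C^1 only. *)
Lemma Ck1_comp m (tau : 'rV[R]_m -> 'rV[R]_n) f (V : set 'rV[R]_m) U :
  open U -> open V -> (forall z, V z -> U (tau z)) ->
  (forall k, Ck_on 1 V (fun z => tau z 0 k)) -> Ck_on 1 U f -> Ck_on 1 V (f \o tau).
Proof.
move=> oU oV VU Ct Cf.
have ct z : V z -> {for z, continuous tau}.
  by move=> Vz; apply: continuous_rV => k; exact: (Ck_on_continuous (Ct k) Vz).
have df z : V z -> differentiable f (tau z).
  by move=> Vz; apply: (Ck1_differentiable oU Cf); exact: VU.
have dt i k z : V z -> derivable (fun z => tau z 0 k) z (delta_mx 0 i).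
  by move=> Vz; apply: (Ck_on_derivable (Ct k) Vz).
have cfp k z : V z -> {for z, continuous (partial k f \o tau)}.
  move=> Vz; apply: continuous_comp; first exact: ct.
  by apply: (Ck_on_continuous (Ck_on_partial k Cf)); exact: VU.
split=> [z Vz|i]; first by apply: continuous_comp; [exact: ct|exact: (Ck_on_continuous Cf (VU _ Vz))].
split=> [z Vz|]; first by case: (is_derive_curve (df z Vz) (fun k => dt i k z Vz)).
split=> // z Vz.
apply: (@continuous_eq_on R _ V
  (fun z => \sum_k partial i (fun z => tau z 0 k) z * partial k f (tau z))) => //.
  by move=> y Vy; rewrite partial_comp //; [exact: df|move=> k; exact: dt].
apply: continuous_at_sum => k.
by apply: continuousM (cfp k z Vz); exact: (Ck_on_continuous (Ck_on_partial i (Ct k)) Vz).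
Qed.

Lemma Ck_on_coord k U (j : 'I_n) : open U -> Ck_on k U (fun x => x 0 j).
Proof.
move=> oU; case: k => [|k]; split=> //; try by move=> x _; exact: coord_continuous.
have dj i x : is_derive x (delta_mx 0 i : 'rV[R]_n) (fun y : 'rV[R]_n => y 0 j) ((i == j)%:R : R).
  apply: (@is_derive_affine _ _ R^o _ (fun y : 'rV[R]_n => y 0 j) id _ (i == j)%:R).
  by move=> h; rewrite !mxE eqxx (eq_sym j).
move=> i; split=> [x _|]; first by case: (dj i x).
apply: (Ck_on_eq oU) (Ck_on_cst oU k (i == j)%:R) => y _.
by case: (dj i y).
Qed.

End Composition.

(** * Conformal change in coordinates *)

Section ContractionAlgebra.
Context {R : numFieldType} {n : nat}.
Implicit Types (T : 'I_n -> 'I_n -> R) (eta xi : 'I_n -> R)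
  (Gam dg : 'I_n -> 'I_n -> 'I_n -> R).
Variables g h : 'M[R]_n.
Hypotheses (g_sym : forall i j, g i j = g j i) (h_sym : forall i j, h i j = h j i).
Hypothesis hg : h *m g = 1%:M.

(** The trace of a bilinear form with respect to the metric. *)
Definition ctr T : R := \sum_j \sum_k h j k * T j k.

Definition raise eta : 'I_n -> R := fun l => \sum_m h l m * eta m.

Lemma sum_deltal (F : 'I_n -> R) (j : 'I_n) : \sum_k (j == k)%:R * F k = F j.
Proof.
rewrite (bigD1 j) //= eqxx mul1r big1 ?addr0 // => k kj.
by rewrite eq_sym (negbTE kj) mul0r.
Qed.

Lemma sum_deltar (F : 'I_n -> R) (j : 'I_n) : \sum_k F k * (k == j)%:R = F j.
Proof.
by rewrite -[RHS](sum_deltal F j); apply: eq_bigr => k _; rewrite mulrC eq_sym.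
Qed.

Lemma sum_delta1 : \sum_(k < n) ((k == k)%:R : R) = n%:R.
Proof. by under eq_bigr do rewrite eqxx; rewrite sumr_const card_ord. Qed.

Lemma hg_delta i k : \sum_j h i j * g j k = (i == k)%:R.
Proof. by have := congr1 (fun A : 'M[R]_n => A i k) hg; rewrite !mxE => ->. Qed.

Lemma eq_ctr T1 T2 : (forall j k, T1 j k = T2 j k) -> ctr T1 = ctr T2.
Proof. by move=> E; apply: eq_bigr => j _; apply: eq_bigr => k _; rewrite E. Qed.

Lemma ctrD T1 T2 : ctr (fun j k => T1 j k + T2 j k) = ctr T1 + ctr T2.
Proof.
rewrite /ctr -big_split; apply: eq_bigr => j _; rewrite -big_split.
by apply: eq_bigr => k _; rewrite mulrDr.
Qed.

Lemma ctrZ c T : ctr (fun j k => c * T j k) = c * ctr T.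
Proof.
rewrite /ctr mulr_sumr; apply: eq_bigr => j _; rewrite mulr_sumr.
by apply: eq_bigr => k _; rewrite mulrCA.
Qed.

Lemma ctrN T : ctr (fun j k => - T j k) = - ctr T.
Proof. by rewrite -[RHS]mulN1r -ctrZ; apply: eq_ctr => j k; rewrite mulN1r. Qed.

Lemma ctrB T1 T2 : ctr (fun j k => T1 j k - T2 j k) = ctr T1 - ctr T2.
Proof. by rewrite ctrD ctrN. Qed.

Lemma ctr_sum (F : 'I_n -> 'I_n -> 'I_n -> R) :
  ctr (fun j k => \sum_i F i j k) = \sum_i ctr (F i).
Proof.
rewrite /ctr [RHS]exchange_big; apply: eq_bigr => j _.
by rewrite [RHS]exchange_big; apply: eq_bigr => k _; rewrite mulr_sumr.
Qed.

Lemma ctr_swap T : ctr (fun j k => T k j) = ctr T.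
Proof.
rewrite /ctr exchange_big; apply: eq_bigr => j _.
by apply: eq_bigr => k _; rewrite h_sym.
Qed.

Lemma ctr_metric : ctr (fun j k => g j k) = n%:R.
Proof.
rewrite /ctr -sum_delta1; apply: eq_bigr => j _.
by rewrite -hg_delta; apply: eq_bigr => k _; rewrite g_sym.
Qed.

Lemma ctr_outer eta xi : ctr (fun j k => xi j * eta k) = \sum_j xi j * raise eta j.
Proof.
apply: eq_bigr => j _; rewrite mulr_sumr; apply: eq_bigr => k _.
by rewrite mulrCA.
Qed.

Lemma lower_raise eta k : \sum_i g i k * raise eta i = eta k.
Proof.
transitivity (\sum_i \sum_m (h m i * g i k) * eta m).
  apply: eq_bigr => i _; rewrite mulr_sumr; apply: eq_bigr => m _.
  by rewrite mulrA (mulrC (g i k)) (h_sym i).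
rewrite exchange_big /= -[RHS](sum_deltar eta); apply: eq_bigr => m _.
by rewrite -mulr_suml hg_delta mulrC.
Qed.

Lemma ctr_metricl (i : 'I_n) (F : 'I_n -> R) : ctr (fun j k => g i k * F j) = F i.
Proof.
rewrite -[RHS](sum_deltar F); apply: eq_bigr => j _.
rewrite -hg_delta mulr_sumr; apply: eq_bigr => k _.
by rewrite mulrA mulrC (g_sym i).
Qed.

(* The difference of the Levi-Civita connections of [e^(2 f) g] and [g] when
   [eta] is the differential of [f]. *)
Definition conf_diff eta (k i j : 'I_n) : R :=
  eta i * (k == j)%:R + eta j * (k == i)%:R - g i j * raise eta k.

Lemma conf_diff_sym eta k i j : conf_diff eta k i j = conf_diff eta k j i.
Proof. by rewrite /conf_diff g_sym; ring. Qed.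

Lemma conf_diff_trace eta m : \sum_i conf_diff eta i i m = n%:R * eta m.
Proof.
rewrite /conf_diff sumrB big_split /= sum_deltar lower_raise -mulr_sumr sum_delta1.
by ring.
Qed.

Lemma conf_diff_ctr eta m : ctr (conf_diff eta m) = (2 - n%:R) * raise eta m.
Proof.
rewrite (eq_ctr (T2 := fun j k => (eta j * (m == k)%:R + (m == j)%:R * eta k)
   - raise eta m * g j k)); last by move=> j k; rewrite /conf_diff; ring.
rewrite ctrB ctrD ctrZ ctr_metric -(ctr_swap (fun j k => eta j * (m == k)%:R)).
rewrite (eq_ctr (T1 := fun j k => eta k * (m == j)%:R) (T2 := fun j k => (m == j)%:R * eta k)); last first.
  by move=> j k; rewrite mulrC.
by rewrite ctr_outer sum_deltal; ring.
Qed.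

Definition ctr_christoffel Gam (m : 'I_n) : R := ctr (Gam m).
Definition tr_christoffel Gam (m : 'I_n) : R := \sum_i Gam i i m.

(** Of the three terms of [conf_diff], the second and the third both contract to the trace of [Gam]
    paired with the raised [eta], with opposite signs. Only symmetry in the lower indices is asked
    of [Gam], so that [conf_diff] itself can take its place. *)
Lemma ctr_mul_conf_diff Gam eta : (forall k i j, Gam k i j = Gam k j i) ->
  ctr (fun j k => \sum_i \sum_m Gam i j m * conf_diff eta m i k) =
  \sum_i eta i * ctr_christoffel Gam i.
Proof.
move=> Gs.
have E j k : \sum_i \sum_m Gam i j m * conf_diff eta m i k =
   \sum_i eta i * Gam i j k + (\sum_i Gam i i j) * eta k
   - \sum_i g i k * (\sum_m Gam i j m * raise eta m).
  rewrite mulr_suml -big_split -sumrB; apply: eq_bigr => i _ /=.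
  under eq_bigr do rewrite /conf_diff mulrBr mulrDr !mulrA.
  rewrite sumrB big_split /=; congr (_ + _ - _).
  - rewrite (sum_deltar (fun m => Gam i j m * eta i)) //; ring.
  - rewrite (sum_deltar (fun m => Gam i j m * eta k)) //; rewrite Gs; ring.
  - rewrite mulr_sumr; apply: eq_bigr => m _; ring.
rewrite (eq_ctr E) ctrB ctrD ctr_outer !ctr_sum.
under [X in X + _ - _]eq_bigr do rewrite ctrZ.
rewrite -addrA -[RHS]addr0; congr (_ + _); apply/eqP; rewrite subr_eq0; apply/eqP.
under [RHS]eq_bigr do rewrite ctr_metricl.
rewrite [RHS]exchange_big /=; apply: eq_bigr => j _.
by rewrite mulr_suml.
Qed.

Lemma ctr_conf_diff_mul Gam eta : (forall k i j, Gam k i j = Gam k j i) ->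
  ctr (fun j k => \sum_i \sum_m conf_diff eta i j m * Gam m i k) =
  \sum_i eta i * ctr_christoffel Gam i.
Proof.
move=> Gs; rewrite -ctr_mul_conf_diff // -[RHS]ctr_swap; apply: eq_ctr => j k.
rewrite exchange_big; apply: eq_bigr => m _; apply: eq_bigr => i _.
by rewrite mulrC (Gs m i) (conf_diff_sym eta i).
Qed.

(** The classical formula for the change of scalar curvature under [e^(2f) g], with [eta = df]. Here
    [deta i j] stands for the derivative along [i] of [eta j], [E i j] for that of the raised [eta]
    at [j], and [dg i j k] for that of [g j k]. On the left are the divergence of [conf_diff], the
    derivative of its trace [n eta], and the change of the quadratic part of the Ricci tensor. On
    the right the first two brackets both become the Laplacian of [f], and the last sum is the
    square of the length of [df]. *)
Lemma conformal_ricci_trace Gam dg eta (deta E : 'I_n -> 'I_n -> R) :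
  (forall k i j, Gam k i j = Gam k j i) ->
  (forall i, ctr (dg i) = 2 * tr_christoffel Gam i) ->
  ctr (fun j k => \sum_i (deta i j * (i == k)%:R + deta i k * (i == j)%:R
                         - (dg i j k * raise eta i + g j k * E i i))
     - n%:R * deta j k
     + \sum_i \sum_m
        ((Gam i i m + conf_diff eta i i m) * (Gam m j k + conf_diff eta m j k)
         - (Gam i j m + conf_diff eta i j m) * (Gam m i k + conf_diff eta m i k)
         - (Gam i i m * Gam m j k - Gam i j m * Gam m i k)))
  = (2 - n%:R) * (ctr deta - \sum_m eta m * ctr_christoffel Gam m)
    - n%:R * (\sum_i E i i + \sum_i tr_christoffel Gam i * raise eta i)
    - (n%:R - 1) * (n%:R - 2) * \sum_i eta i * raise eta i.
Proof.
move=> Gs Hdg.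
have E1 j k : \sum_i (deta i j * (i == k)%:R + deta i k * (i == j)%:R
                         - (dg i j k * raise eta i + g j k * E i i)) =
   deta k j + deta j k - (\sum_i raise eta i * dg i j k + (\sum_i E i i) * g j k).
  rewrite sumrB !big_split /= !sum_deltar -mulr_sumr; congr (_ - (_ + _)); last by ring.
  by apply: eq_bigr => i _; ring.
(* The terms quadratic in [Gam] cancel; what remains is mixed in [Gam] and [conf_diff], or quadratic
   in [conf_diff]. *)
have E2 j k : \sum_i \sum_m
        ((Gam i i m + conf_diff eta i i m) * (Gam m j k + conf_diff eta m j k)
         - (Gam i j m + conf_diff eta i j m) * (Gam m i k + conf_diff eta m i k)
         - (Gam i i m * Gam m j k - Gam i j m * Gam m i k)) =
   (\sum_m tr_christoffel Gam m * conf_diff eta m j k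
    + n%:R * \sum_m eta m * Gam m j k + n%:R * \sum_m eta m * conf_diff eta m j k)
   - ((\sum_i \sum_m Gam i j m * conf_diff eta m i k
    + \sum_i \sum_m conf_diff eta i j m * Gam m i k)
    + \sum_i \sum_m conf_diff eta i j m * conf_diff eta m i k).
  transitivity (\sum_m ((\sum_i Gam i i m) * conf_diff eta m j k
      + (\sum_i conf_diff eta i i m) * Gam m j k
      + (\sum_i conf_diff eta i i m) * conf_diff eta m j k)
      - \sum_i \sum_m (Gam i j m * conf_diff eta m i k + conf_diff eta i j m * Gam m i k
        + conf_diff eta i j m * conf_diff eta m i k)).
    transitivity (\sum_i \sum_m (Gam i i m * conf_diff eta m j k
      + conf_diff eta i i m * Gam m j k + conf_diff eta i i m * conf_diff eta m j k)
      - \sum_i \sum_m (Gam i j m * conf_diff eta m i k + conf_diff eta i j m * Gam m i k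
        + conf_diff eta i j m * conf_diff eta m i k)).
      rewrite -sumrB; apply: eq_bigr => i _; rewrite -sumrB; apply: eq_bigr => m _.
      by ring.
    congr (_ - _); rewrite exchange_big; apply: eq_bigr => m _ /=.
    by rewrite !mulr_suml -!big_split.
  congr (_ - _).
    rewrite !mulr_sumr -!big_split; apply: eq_bigr => m _ /=.
    by rewrite !conf_diff_trace !mulrA.
  by rewrite -!big_split; apply: eq_bigr => i _; rewrite -!big_split.
rewrite (eq_ctr (fun j k => congr2 +%R (congr2 +%R (E1 j k) (erefl (- (n%:R * deta j k)))) (E2 j k))).
rewrite !(ctrB, ctrD) (ctr_swap deta) ctr_mul_conf_diff // ctr_conf_diff_mul //.
rewrite ctr_mul_conf_diff; last by move=> *; exact: conf_diff_sym.
rewrite !ctrZ ctr_metric !ctr_sum.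
under eq_bigr do rewrite ctrZ Hdg.
under [X in _ + (X + _ + _ - _)]eq_bigr do rewrite ctrZ conf_diff_ctr.
under [X in _ + (_ + n%:R * X + _ - _)]eq_bigr do rewrite ctrZ.
under [X in _ + (_ + _ + n%:R * X - _)]eq_bigr do rewrite ctrZ conf_diff_ctr.
under [X in _ - (_ + _ + X)]eq_bigr do rewrite /ctr_christoffel conf_diff_ctr.
rewrite /ctr_christoffel.
set a := \sum_i tr_christoffel Gam i * raise eta i.
set b := \sum_i eta i * raise eta i.
have -> : \sum_i raise eta i * (2 * tr_christoffel Gam i) = 2 * a.
  by rewrite mulr_sumr; apply: eq_bigr => i _; ring.
have -> : \sum_i tr_christoffel Gam i * ((2 - n%:R) * raise eta i) = (2 - n%:R) * a.
  by rewrite mulr_sumr; apply: eq_bigr => i _; ring.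
have -> : \sum_i eta i * ((2 - n%:R) * raise eta i) = (2 - n%:R) * b.
  by rewrite mulr_sumr; apply: eq_bigr => i _; ring.
by ring.
Qed.

End ContractionAlgebra.

(** * Identities for the Levi-Civita connection at a point *)

Section LeviCivitaAlgebra.
Context {R : numFieldType} {n : nat}.
Variable h : 'M[R]_n.
Hypothesis h_sym : forall i j, h i j = h j i.
Variable dg : 'I_n -> 'I_n -> 'I_n -> R.
Hypothesis dg_sym : forall k i j, dg k i j = dg k j i.

(** The Christoffel symbols with [dg k i j] in place of the derivative along [k] of the metric entry
    [i j]; with actual derivatives it is convertible to [christoffel]. *)
Definition levi_civita (k i j : 'I_n) : R :=
  2^-1 * \sum_l h k l * (dg i j l + dg j i l - dg l i j).

Lemma levi_civita_sym k i j : levi_civita k i j = levi_civita k j i.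
Proof.
by congr (_ * _); apply: eq_bigr => l _; rewrite (dg_sym l i); ring.
Qed.

Lemma tr_levi_civita m : ctr h (dg m) = 2 * tr_christoffel levi_civita m.
Proof.
rewrite /tr_christoffel /levi_civita -mulr_sumr mulrA mulfV ?pnatr_eq0 // mul1r.
transitivity (ctr h (fun i l => (dg i l m + dg m i l) - dg l i m)); last first.
  by apply: eq_bigr => i _; apply: eq_bigr => l _; rewrite (dg_sym i l).
by rewrite ctrB ctrD -(ctr_swap h_sym (fun i l => dg l i m)); ring.
Qed.

(** The first sum is the divergence of row [j] of the inverse metric, since the derivative of the
    inverse is [- h dg h]. The trace of [dg i] being twice the trace of the connection, half of it
    cancels against the second sum. *)
Lemma divergence_inverse j :
  \sum_i - (\sum_a \sum_b h i a * dg i a b * h b j) +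
  \sum_i tr_christoffel levi_civita i * h i j = - ctr_christoffel h levi_civita j.
Proof.
have -> : ctr_christoffel h levi_civita j =
    \sum_l h j l * (ctr h (fun i k => dg i k l) - 2^-1 * ctr h (dg l)).
  rewrite /ctr_christoffel /levi_civita ctrZ.
  rewrite ctr_sum mulr_sumr; apply: eq_bigr => l _.
  rewrite ctrZ ctrB ctrD (ctr_swap h_sym (fun i k => dg i k l)).
  by field.
have -> : \sum_i - (\sum_a \sum_b h i a * dg i a b * h b j) =
    - \sum_l h j l * ctr h (fun i k => dg i k l).
  rewrite sumrN; congr (- _); rewrite /ctr.
  transitivity (\sum_b \sum_i \sum_a h i a * dg i a b * h b j).
    rewrite [RHS]exchange_big; apply: eq_bigr => i _.
    by rewrite exchange_big.
  apply: eq_bigr => b _; rewrite mulr_sumr; apply: eq_bigr => i _.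
  by rewrite mulr_sumr; apply: eq_bigr => a _; rewrite (h_sym j); ring.
rewrite -sumrN -sumrN -big_split; apply: eq_bigr => l _ /=.
by rewrite tr_levi_civita (h_sym l); field.
Qed.

(** The two usual expressions of the divergence of the raised [eta]: the coordinate divergence
    corrected by the logarithmic derivative of the volume density, and the trace of the covariant
    derivative of [eta]. *)
Lemma divergence_raise (eta : 'I_n -> R) (deta : 'I_n -> 'I_n -> R) :
  \sum_i \sum_m (h i m * deta i m - (\sum_a \sum_b h i a * dg i a b * h b m) * eta m)
  + \sum_i tr_christoffel levi_civita i * raise h eta i =
  ctr h deta - \sum_m eta m * ctr_christoffel h levi_civita m.
Proof.
under eq_bigr do rewrite sumrB.
rewrite sumrB -addrA; congr (_ + _); rewrite -sumrN.
transitivity (\sum_m eta m * (\sum_i - (\sum_a \sum_b h i a * dg i a b * h b m) +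
  \sum_i tr_christoffel levi_civita i * h i m)).
  under [RHS]eq_bigr do rewrite mulrDr !mulr_sumr.
  rewrite [RHS]big_split /= ; congr (_ + _); rewrite [RHS]exchange_big; apply: eq_bigr => i _.
    by rewrite -sumrN; apply: eq_bigr => m _; ring.
  by rewrite mulr_sumr; apply: eq_bigr => m _; ring.
by rewrite -sumrN; apply: eq_bigr => m _; rewrite divergence_inverse mulrN.
Qed.

End LeviCivitaAlgebra.

(** * Derivative and positivity of determinants *)

Section DeterminantDerivative.
Context {R : realType} {n : nat}.

Lemma is_derive_prod m (r : seq 'I_m) (F : 'I_m -> 'rV[R]_n -> R) (dF : 'I_m -> R) x v :
  uniq r -> (forall i, is_derive x v (F i) (dF i)) ->
  is_derive x v (fun y => \prod_(i <- r) F i y)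
    (\sum_(i <- r) dF i * \prod_(j <- r | j != i) F j x).
Proof.
move=> + dFx; elim: r => [_|i r IH /= /andP[ir ur]].
  rewrite big_nil (_ : (fun _ => _) = cst 1); first exact: is_derive_cst.
  by apply/funext => y; rewrite big_nil.
rewrite (_ : (fun _ => _) = F i * (fun y => \prod_(i <- r) F i y)); last first.
  by apply/funext => y; rewrite big_cons.
apply: is_derive_eq (is_deriveM (dFx i) (IH ur)) _.
rewrite !big_cons eqxx /= addrC; congr (_ + _).
  rewrite -[LHS]/((\prod_(j <- r) F j x) * dF i) mulrC; congr (_ * _).
  by rewrite big_seq [RHS]big_seq_cond; apply: eq_bigl => j; case: eqVneq => [->|]; rewrite ?(negbTE ir) ?andbT ?andbF.
rewrite -[LHS]/(F i x * _) mulr_sumr big_seq [RHS]big_seq; apply: eq_bigr => j jr.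
rewrite big_cons; case: eqVneq => [ij|_]; last by rewrite mulrCA.
by move: ir; rewrite ij jr.
Qed.

(** Jacobi's formula, from the product rule in the Leibniz expansion. *)
Lemma is_derive_det m (A : 'rV[R]_n -> 'M[R]_m) (dA : 'M[R]_m) x v :
  (forall i j, is_derive x v (fun y => A y i j) (dA i j)) ->
  is_derive x v (fun y => \det (A y)) (\sum_i \sum_j dA i j * (\adj (A x)) j i).
Proof.
move=> dAx.
have H (s : {perm 'I_m}) : is_derive x v (fun y => (-1) ^+ s * \prod_i A y i (s i))
   ((-1) ^+ s * \sum_i dA i (s i) * \prod_(j | j != i) A x j (s j)).
  apply: is_derive_eq (is_deriveM (is_derive_cst _ _ _)
     (is_derive_prod (index_enum_uniq _) (fun i => dAx i (s i)))) _.
  by rewrite scaler0 addr0.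
have -> : \sum_i \sum_j dA i j * (\adj (A x)) j i =
   \sum_(s : {perm 'I_m}) (-1) ^+ s * \sum_i dA i (s i) * \prod_(j | j != i) A x j (s j).
  under [RHS]eq_bigr do rewrite mulr_sumr.
  rewrite [RHS]exchange_big; apply: eq_bigr => i _ /=.
  (* [A x] with row [i] replaced by its derivative; expanding its determinant along that row yields
     the adjugate entries. *)
  pose B : 'M[R]_m := \matrix_(a, b) if a == i then dA i b else A x a b.
  transitivity (\det B).
    rewrite (expand_det_row B i); apply: eq_bigr => j _.
    rewrite !mxE eqxx; congr (_ * (_ * \det _)).
    by apply/matrixP => a b; rewrite !mxE eq_sym (negbTE (neq_lift _ _)).
  apply: eq_bigr => s _; congr (_ * _); rewrite (bigD1 i) //= mxE eqxx; congr (_ * _).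
  by apply: eq_bigr => j ji; rewrite mxE (negbTE ji).
have dS (r : seq {perm 'I_m}) :
   is_derive x v (fun y => \sum_(s <- r) (-1) ^+ s * \prod_i A y i (s i))
   (\sum_(s <- r) (-1) ^+ s * \sum_i dA i (s i) * \prod_(j | j != i) A x j (s j)).
  elim: r => [|s r IH].
    rewrite big_nil (_ : (fun _ => _) = cst 0); first exact: is_derive_cst.
    by apply/funext => y; rewrite big_nil.
  rewrite big_cons (_ : (fun _ => _) = (fun y => (-1) ^+ s * \prod_i A y i (s i))
     + (fun y => \sum_(s <- r) (-1) ^+ s * \prod_i A y i (s i))); last first.
    by apply/funext => y; rewrite big_cons.
  exact: is_deriveD (H s) IH.
exact: dS.
Qed.

Lemma posdef_unitmx (A : 'M[R]_n) :
  (forall v : 'rV[R]_n, v != 0 -> 0 < quad A v) -> \det A != 0.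
Proof.
move=> Apos; apply/det0P => -[v v0 vA].
by have := Apos v v0; rewrite /quad vA mul0mx mxE ltxx.
Qed.

Lemma quad1 (v : 'rV[R]_n) : v != 0 -> 0 < quad 1%:M v.
Proof.
move=> v0; rewrite /quad mulmx1 mxE lt0r sumr_ge0 ?andbT; last first.
  by move=> i _; rewrite mxE -expr2 sqr_ge0.
rewrite psumr_eq0; last by move=> i _; rewrite mxE -expr2 sqr_ge0.
apply: contra v0 => /allP H; apply/eqP/rowP => i.
have := H i (mem_index_enum i); rewrite !mxE /= -expr2 sqrf_eq0.
by move/eqP.
Qed.

(** The segment from the identity to [A] consists of positive definite, hence invertible, matrices.
    The determinant is 1 at the identity and cannot change sign along the segment, by the
    intermediate value theorem. *)
Lemma posdef_det_gt0 (A : 'M[R]_n) :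
  (forall v : 'rV[R]_n, v != 0 -> 0 < quad A v) -> 0 < \det A.
Proof.
move=> Apos; rewrite ltNge; apply/negP => dA.
pose f (t : R) : R := \det (t *: A + (1 - t) *: 1%:M).
have cf : continuous f.
  move=> t; apply: continuous_at_sum => s; apply: continuousM; first exact: cst_continuous.
  apply: continuous_at_prod => i.
  rewrite (_ : (fun y => _) = (fun y : R => y * A i (s i) + (1 - y) * (1%:M : 'M[R]_n) i (s i))); last first.
    by apply/funext => y; rewrite !mxE.
  apply: continuousD; apply: continuousM; try exact: cst_continuous.
    exact: cvg_id.
  by apply: continuousB; [exact: cst_continuous|exact: cvg_id].
have [||t tI ft] := @IVT R f 0 1 0 ler01.
- exact: continuous_subspaceT.
- rewrite /f scale0r add0r subr0 !scale1r subrr scale0r addr0 det1.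
  by rewrite ge_min dA orbT /= le_max ler01.
have /andP[t0 t1] : 0 <= t <= 1 by move: tI; rewrite in_itv.
suff : f t != 0 by rewrite ft eqxx.
apply: posdef_unitmx => v v0.
have -> : quad (t *: A + (1 - t) *: 1%:M) v = t * quad A v + (1 - t) * quad 1%:M v.
  by rewrite /quad mulmxDr mulmxDl -!scalemxAr -!scalemxAl !mxE.
have [->|t0'] := eqVneq t 0; first by rewrite mul0r add0r subr0 mul1r quad1.
apply: ltr_pwDl; last by rewrite mulr_ge0 ?subr_ge0 // ltW // quad1.
by rewrite mulr_gt0 ?Apos // lt0r t0'.
Qed.

End DeterminantDerivative.

(** * Laplacian, gradient pairing and divergence in coordinates *)

Section LocalGeometry.
Context {R : realType} {n : nat}.

(** The Laplacian as the trace of the covariant Hessian; this form shows up in the curvature, and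
    [divergence_flux] turns it into the divergence form. *)
Definition lapl (G : 'rV[R]_n -> 'M[R]_n) (f : 'rV[R]_n -> R) (x : 'rV[R]_n) : R :=
  ctr (invmx (G x)) (fun j k => partial j (partial k f) x
    - \sum_m christoffel G m j k x * partial m f x).

Definition gradp (G : 'rV[R]_n -> 'M[R]_n) (f h : 'rV[R]_n -> R) (x : 'rV[R]_n) : R :=
  \sum_i partial i f x * raise (invmx (G x)) (fun m => partial m h x) i.

Variables (U : set 'rV[R]_n) (G : 'rV[R]_n -> 'M[R]_n).
Hypotheses (oU : open U) (GC : forall i j, Ck_on 2 U (fun x => G x i j))
  (Gsym : forall x, U x -> (G x)^T = G x)
  (Gpos : forall x, U x -> forall v : 'rV[R]_n, v != 0 -> 0 < quad (G x) v).

Local Notation H x := (invmx (G x)).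
Local Notation dg x := (fun k i j : 'I_n => partial k (fun y => G y i j) x).

Lemma metric_det_gt0 x : U x -> 0 < \det (G x).
Proof. by move=> Ux; apply: posdef_det_gt0; exact: Gpos. Qed.

Lemma metric_unit x : U x -> G x \in unitmx.
Proof. by move=> Ux; rewrite unitmxE unitfE gt_eqF // metric_det_gt0. Qed.

Lemma metric_symE x i j : U x -> G x i j = G x j i.
Proof. by move=> Ux; rewrite -{1}(Gsym Ux) mxE. Qed.

Lemma inverse_symE x i j : U x -> H x i j = H x j i.
Proof. by move=> Ux; rewrite -{1}(Gsym Ux) -trmx_inv mxE. Qed.

Lemma inverse_mul x : U x -> H x *m G x = 1%:M.
Proof. by move=> Ux; rewrite mulVmx // metric_unit. Qed.

Lemma Ck_inverse i j : Ck_on 2 U (fun x => H x i j).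
Proof. by apply: Ck_on_invmx => // x; exact: metric_det_gt0. Qed.

Lemma partial_metric_sym x k i j : U x -> dg x k i j = dg x k j i.
Proof. by move=> Ux /=; apply: (partial_eq_on _ oU) => // y; exact: metric_symE. Qed.

Lemma christoffelE k i j x : christoffel G k i j x = levi_civita (H x) (dg x) k i j.
Proof. by []. Qed.

Lemma christoffel_sym k i j x : U x -> christoffel G k i j x = christoffel G k j i x.
Proof.
by move=> Ux; rewrite !christoffelE levi_civita_sym // => *; exact: partial_metric_sym.
Qed.

Lemma Ck_christoffel k i j : Ck_on 1 U (christoffel G k i j).
Proof.
apply: Ck_onM => //; first exact: Ck_on_cst.
apply: Ck_on_sum => // l _; apply: Ck_onM => //.
  exact: (Ck_on_le _ (Ck_inverse k l)).
by apply: Ck_onB => //; [apply: Ck_onD => //|]; apply: Ck_on_partial; exact: GC.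
Qed.

(** Differentiate [G *m invmx G = 1%:M], valid on all of [U], and multiply by the inverse from the
    left. *)
Lemma partial_inverse k i j x : U x ->
  partial k (fun y => H y i j) x = - \sum_a \sum_b H x i a * dg x k a b * H x b j.
Proof.
move=> Ux.
have dG a b : derivable (fun y => G y a b) x (delta_mx 0 k) := Ck_on_derivable (GC a b) Ux.
have dH a b : derivable (fun y => H y a b) x (delta_mx 0 k) := Ck_on_derivable (Ck_inverse a b) Ux.
have E a : \sum_b (G x a b * partial k (fun y => H y b j) x + dg x k a b * H x b j) = 0.
  transitivity (partial k (fun y => \sum_b G y a b * H y b j) x).
    rewrite partial_sum; last by move=> b; exact: derivableM.
    by apply: eq_bigr => b _; rewrite partialM.
  rewrite (@partial_eq_on _ _ U _ (fun=> (1%:M : 'M[R]_n) a j)) ?partial_cst // => y Uy.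
  have := congr1 (fun A : 'M[R]_n => A a j) (mulmxV (metric_unit Uy)).
  by rewrite mxE.
apply/eqP; rewrite -subr_eq0 opprK; apply/eqP.
transitivity (\sum_a H x i a * (\sum_b (G x a b * partial k (fun y => H y b j) x + dg x k a b * H x b j))); last first.
  by rewrite big1 // => a _; rewrite E mulr0.
under [RHS]eq_bigr do rewrite big_split mulrDr !mulr_sumr /=.
rewrite big_split /=; congr (_ + _); last first.
  by apply: eq_bigr => a _; apply: eq_bigr => b _; rewrite mulrA.
rewrite exchange_big /= -[LHS](sum_deltal (fun b => partial k (fun y => H y b j) x) i).
apply: eq_bigr => b _; rewrite -(hg_delta (inverse_mul Ux)) mulr_suml.
by apply: eq_bigr => a _; rewrite mulrA.
Qed.

(** Jacobi's formula gives the determinant times the trace of the derivative of the metric, which is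
    twice the trace of the Christoffel symbols; the square root removes the factor 2. *)
Lemma is_derive_sqrt_det k x : U x ->
  is_derive x (delta_mx 0 k) (fun y => Num.sqrt (\det (G y)))
    (Num.sqrt (\det (G x)) * tr_christoffel (fun k i j => christoffel G k i j x) k).
Proof.
move=> Ux; have d0 := metric_det_gt0 Ux.
have dG i j : is_derive x (delta_mx 0 k) (fun y => G y i j) ((\matrix_(i, j) dg x k i j) i j).
  by rewrite mxE; apply: derivableP; exact: (Ck_on_derivable (GC i j) Ux).
have [dd dE] := is_derive_det dG.
have DE : 'D_(delta_mx 0 k) (fun y => \det (G y)) x = \det (G x) * ctr (H x) (dg x k).
  rewrite dE mulr_sumr; apply: eq_bigr => i _; rewrite mulr_sumr; apply: eq_bigr => j _.
  rewrite mxE (inverse_symE _ _ Ux) /invmx (metric_unit Ux) !mxE.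
  by field; rewrite gt_eqF.
have sE y : Num.sqrt (\det (G y)) = ((fun s : R => Num.sqrt s) \o (fun y => \det (G y))) y by [].
have [d1 d2] := is_derive_comp1 (is_derive1_sqrt d0) dd.
apply: (@DeriveDef _ _ _ _ _ _ _ d1).
have T : ctr (H x) (dg x k) = 2 * tr_christoffel (fun k i j => christoffel G k i j x) k.
  apply: (@tr_levi_civita _ _ (H x) _ (dg x)).
    by move=> *; exact: inverse_symE.
  by move=> *; exact: partial_metric_sym.
rewrite d2 DE T.
rewrite -{2}(sqr_sqrtr (ltW d0)).
have s0 : Num.sqrt (\det (G x)) != 0 by rewrite gt_eqF // sqrtr_gt0.
by field.
Qed.

Lemma partial_raise (eta : 'I_n -> 'rV[R]_n -> R) i l x : U x ->
  (forall m, derivable (eta m) x (delta_mx 0 i)) ->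
  partial i (fun y => raise (H y) (fun m => eta m y) l) x =
  \sum_m (H x l m * partial i (eta m) x
    - (\sum_a \sum_b H x l a * dg x i a b * H x b m) * eta m x).
Proof.
move=> Ux de.
have dH a b : derivable (fun y => H y a b) x (delta_mx 0 i) := Ck_on_derivable (Ck_inverse a b) Ux.
rewrite /raise partial_sum; last by move=> m; exact: derivableM.
by apply: eq_bigr => m _; rewrite partialM // partial_inverse // mulNr.
Qed.

(** Stated for any covector field, as it is applied both to the differential of a function and to
    the logarithmic differential of a conformal factor. *)
Lemma divergence_gradient (eta : 'I_n -> 'rV[R]_n -> R) x : U x ->
  (forall m i, derivable (eta m) x (delta_mx 0 i)) ->
  \sum_i partial i (fun y => raise (H y) (fun m => eta m y) i) x
  + \sum_i tr_christoffel (fun k i j => christoffel G k i j x) i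
           * raise (H x) (fun m => eta m x) i =
  ctr (H x) (fun j k => partial j (eta k) x)
  - \sum_m eta m x * ctr_christoffel (H x) (fun k i j => christoffel G k i j x) m.
Proof.
move=> Ux de.
under eq_bigr do rewrite partial_raise //.
apply: (@divergence_raise _ _ _ _ (dg x) _ (fun m => eta m x) (fun j k => partial j (eta k) x)).
- by move=> *; exact: inverse_symE.
- by move=> *; exact: partial_metric_sym.
Qed.

Lemma laplE f x : lapl G f x = ctr (H x) (fun j k => partial j (partial k f) x)
  - \sum_m partial m f x * ctr_christoffel (H x) (fun k i j => christoffel G k i j x) m.
Proof.
rewrite /lapl ctrB ctr_sum; congr (_ - _); apply: eq_bigr => m _.
by rewrite -ctrZ; apply: eq_ctr => j k; rewrite mulrC.
Qed.

(** The field [phi] times the gradient of [f], multiplied by the volume density so that its plain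
    coordinate divergence is the Riemannian one times the density. *)
Definition flux (phi f : 'rV[R]_n -> R) (i : 'I_n) (y : 'rV[R]_n) : R :=
  phi y * (Num.sqrt (\det (G y)) * raise (H y) (fun m => partial m f y) i).

Lemma Ck_sqrt_det : Ck_on 2 U (fun x => Num.sqrt (\det (G x))).
Proof.
apply: (Ck_on_eq oU) (Ck_on_powR oU (2^-1) metric_det_gt0 (Ck_on_det oU GC)) => y Uy.
by rewrite powR12_sqrt // ltW // metric_det_gt0.
Qed.

Lemma Ck_raise f i : Ck_on 2 U f -> Ck_on 1 U (fun y => raise (H y) (fun m => partial m f y) i).
Proof.
move=> Cf; apply: Ck_on_sum => // m _; apply: Ck_onM => //.
  exact: (Ck_on_le _ (Ck_inverse i m)).
exact: Ck_on_partial.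
Qed.

Lemma Ck_flux phi f i : Ck_on 1 U phi -> Ck_on 2 U f -> Ck_on 1 U (flux phi f i).
Proof.
move=> Cp Cf; apply: Ck_onM => //; apply: Ck_onM => //; last exact: Ck_raise.
exact: (Ck_on_le _ Ck_sqrt_det).
Qed.

Lemma divergence_flux phi f x : U x -> Ck_on 1 U phi -> Ck_on 2 U f ->
  \sum_i partial i (flux phi f i) x =
  Num.sqrt (\det (G x)) * (phi x * lapl G f x + gradp G phi f x).
Proof.
move=> Ux Cp Cf.
have dp i : derivable phi x (delta_mx 0 i) := Ck_on_derivable Cp Ux.
have ds i := is_derive_sqrt_det i Ux.
have dr i j : derivable (fun y => raise (H y) (fun m => partial m f y) j) x (delta_mx 0 i) :=
  Ck_on_derivable (Ck_raise j Cf) Ux.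
have E i : partial i (flux phi f i) x =
   Num.sqrt (\det (G x)) * (phi x * (partial i (fun y => raise (H y) (fun m => partial m f y) i) x
     + tr_christoffel (fun k i j => christoffel G k i j x) i * raise (H x) (fun m => partial m f x) i)
     + partial i phi x * raise (H x) (fun m => partial m f x) i).
  rewrite /flux partialM //; last by apply: derivableM => //; case: (ds i).
  rewrite partialM //.
  have -> : partial i (fun y => Num.sqrt (\det (G y))) x = _ := @derive_val _ _ _ _ _ _ _ (ds i).
  by ring.
under eq_bigr do rewrite E.
rewrite -mulr_sumr big_split -mulr_sumr big_split /= divergence_gradient //.
  by rewrite -laplE.
by move=> m i; exact: (Ck_on_derivable (Ck_on_partial m Cf) Ux).
Qed.

Lemma continuous_lapl f x : Ck_on 2 U f -> U x -> {for x, continuous (lapl G f)}.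
Proof.
move=> Cf Ux; suff /(@Ck_on_continuous _ _ 0) : Ck_on 0 U (lapl G f) by exact.
apply: Ck_on_sum => // j _; apply: Ck_on_sum => // k _; apply: Ck_onM => //.
  exact: (Ck_on_le _ (Ck_inverse j k)).
apply: Ck_onB => //; first exact: (Ck_on_partial j (Ck_on_partial k Cf)).
apply: Ck_on_sum => // m _; apply: Ck_onM => //.
  exact: (Ck_on_le _ (Ck_christoffel m j k)).
by apply: (Ck_on_le _ (Ck_on_partial m Cf)).
Qed.

End LocalGeometry.

(** * The Ricci tensor under a change of connection *)

Section RicciSum.
Context {R : realType} {n : nat}.
Implicit Types (C A : 'I_n -> 'I_n -> 'I_n -> 'rV[R]_n -> R) (x : 'rV[R]_n).

(** [ricci] as a function of the connection coefficients alone; [ricci G] is the case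
    [C = christoffel G]. *)
Definition ricci_of C (j k : 'I_n) x : R :=
  \sum_i (partial i (C i j k) x - partial j (C i i k) x
    + \sum_m (C i i m x * C m j k x - C i j m x * C m i k x)).

Lemma ricci_ofD (U : set 'rV[R]_n) C C' A j k x : open U -> U x ->
  (forall a c d, Ck_on 1 U (C a c d)) -> (forall a c d, Ck_on 1 U (A a c d)) ->
  (forall a c d y, U y -> C' a c d y = C a c d y + A a c d y) ->
  ricci_of C' j k x = ricci_of C j k x
   + (\sum_i partial i (A i j k) x - partial j (fun y => \sum_i A i i k y) x
     + \sum_i \sum_m
        ((C i i m x + A i i m x) * (C m j k x + A m j k x)
         - (C i j m x + A i j m x) * (C m i k x + A m i k x)
         - (C i i m x * C m j k x - C i j m x * C m i k x))).
Proof.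
move=> oU Ux CC CA CE.
have dC a c d i : derivable (C a c d) x (delta_mx 0 i) := Ck_on_derivable (CC a c d) Ux.
have dA a c d i : derivable (A a c d) x (delta_mx 0 i) := Ck_on_derivable (CA a c d) Ux.
have P i a c d : partial i (C' a c d) x = partial i (C a c d) x + partial i (A a c d) x.
  by rewrite -partialD //; apply: (partial_eq_on _ oU) => // y Uy; exact: CE.
rewrite partial_sum // /ricci_of -sumrB -!big_split; apply: eq_bigr => i _ /=.
rewrite !P; under eq_bigr do rewrite !CE //.
by rewrite !sumrB; ring.
Qed.

Lemma partial_conf_diff_shape (e1 e2 g r : 'rV[R]_n -> R) (c1 c2 : R) i x :
  derivable e1 x (delta_mx 0 i) -> derivable e2 x (delta_mx 0 i) ->
  derivable g x (delta_mx 0 i) -> derivable r x (delta_mx 0 i) ->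
  partial i (fun y => e1 y * c1 + e2 y * c2 - g y * r y) x =
  partial i e1 x * c1 + partial i e2 x * c2 - (partial i g x * r x + g x * partial i r x).
Proof.
move=> d1 d2 dg dr.
have E (e : 'rV[R]_n -> R) c : derivable e x (delta_mx 0 i) ->
    partial i (fun y => e y * c) x = partial i e x * c.
  by move=> de; rewrite (partialM de (derivable_cst c x _)) partial_cst mulr0 add0r.
have D (e : 'rV[R]_n -> R) c : derivable e x (delta_mx 0 i) ->
    derivable (fun y => e y * c) x (delta_mx 0 i).
  by move=> de; exact: (derivableM de (derivable_cst c x _)).
rewrite (partialB (derivableD (D _ c1 d1) (D _ c2 d2)) (derivableM dg dr)).
rewrite (partialD (D _ c1 d1) (D _ c2 d2)).
by rewrite !E // (partialM dg dr) [g x * _ + _]addrC.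
Qed.

Lemma partial_powRM (a : R) (v g : 'rV[R]_n -> R) i x : 0 < v x ->
  derivable v x (delta_mx 0 i) -> derivable g x (delta_mx 0 i) ->
  partial i (fun y => v y `^ a * g y) x =
  v x `^ a * (partial i g x + a * (partial i v x / v x) * g x).
Proof.
move=> v0 dv dg.
have dp : derivable (fun y => v y `^ a) x (delta_mx 0 i).
  by case: (is_derive_comp1 (is_derive1_powR a v0) dv).
rewrite partialM // partial_powR //.
rewrite powRD ?(gt_eqF v0) ?implybT // powRN powRr1 ?ltW //.
have v0' : v x != 0 by rewrite gt_eqF.
by move: (v x) (v x `^ a) (partial i v x) (partial i g x) (g x) v0' => *; field.
Qed.

End RicciSum.

(** * Conformal change of a metric in coordinates *)

Section ConformalLocal.
Context {R : realType} {n : nat}.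
Variables (U : set 'rV[R]_n) (G : 'rV[R]_n -> 'M[R]_n).
Hypotheses (oU : open U) (GC : forall i j, Ck_on 2 U (fun x => G x i j))
  (Gsym : forall x, U x -> (G x)^T = G x)
  (Gpos : forall x, U x -> forall v : 'rV[R]_n, v != 0 -> 0 < quad (G x) v).
Variables (v : 'rV[R]_n -> R) (b : R).
Hypotheses (vC : Ck_on 2 U v) (v0 : forall x, U x -> 0 < v x).

Local Notation H x := (invmx (G x)).
Local Notation dg x := (fun k i j : 'I_n => partial k (fun y => G y i j) x).
Local Notation G' := (fun y => v y `^ (2 * b) *: G y).

(** The differential of [f = b log v], for which [v^(2b) G] is [e^(2f) G]. *)
Definition log_diff (i : 'I_n) (y : 'rV[R]_n) : R := b * partial i v y / v y.
Local Notation eta := log_diff.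

Lemma Ck_log_diff i : Ck_on 1 U (eta i).
Proof.
apply: Ck_onM => //; last by apply: Ck_onV => //; exact: (Ck_on_le _ vC).
by apply: Ck_onM => //; [exact: Ck_on_cst|exact: (Ck_on_partial i vC)].
Qed.

Lemma conformal_invmx x : U x -> invmx (v x `^ (2 * b) *: G x) = (v x `^ (2 * b))^-1 *: H x.
Proof.
move=> Ux; rewrite invmxZ // unitmxZ ?(metric_unit Gpos Ux) //;
  by rewrite unitfE gt_eqF // powR_gt0 // v0.
Qed.

Lemma partial_conformal x k i j : U x ->
  partial k (fun y => (v y `^ (2 * b) *: G y) i j) x =
  v x `^ (2 * b) * (dg x k i j + 2 * eta k x * G x i j).
Proof.
move=> Ux.
have dv : derivable v x (delta_mx 0 k) := Ck_on_derivable vC Ux.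
have dG : derivable (fun y => G y i j) x (delta_mx 0 k) := Ck_on_derivable (GC i j) Ux.
rewrite (@partial_eq_on _ _ U _ (fun y => v y `^ (2 * b) * G y i j) _ _ oU) //; last first.
  by move=> y _; rewrite mxE.
rewrite (partial_powRM _ (v0 Ux) dv dG); congr (_ * (_ + _ * _)).
by rewrite /eta !mulrA.
Qed.

(** The derivative of the new metric is [v^(2b)] times the old derivative plus [2 eta G], and the
    inverse metric carries the inverse factor. The factors cancel, and the terms [2 eta G], halved,
    form [conf_diff]. *)
Lemma conformal_christoffel k i j x : U x ->
  christoffel G' k i j x = christoffel G k i j x + conf_diff (G x) (H x) (fun m => eta m x) k i j.
Proof.
move=> Ux; rewrite /christoffel conformal_invmx //.
under eq_bigr do rewrite !partial_conformal //.
have s0 : v x `^ (2 * b) != 0 by rewrite gt_eqF // powR_gt0 // v0.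
have hg := inverse_mul Gpos Ux.
have -> : conf_diff (G x) (H x) (fun m => eta m x) k i j =
  \sum_l H x k l * (eta i x * G x j l + eta j x * G x i l - eta l x * G x i j).
  transitivity (\sum_l (eta i x * (H x k l * G x l j) + eta j x * (H x k l * G x l i)
       - G x i j * (H x k l * eta l x))).
    by rewrite sumrB big_split /= -!mulr_sumr !(hg_delta hg).
  apply: eq_bigr => l _; rewrite (metric_symE Gsym j l) // (metric_symE Gsym i l) //.
  move: (eta i x) (eta j x) (eta l x) (H x k l) (G x l j) (G x l i) (G x i j) => *.
  by ring.
rewrite !mulr_sumr -big_split; apply: eq_bigr => l _ /=; rewrite mxE.
move: (partial i _ _) (partial j _ _) (partial l _ _) => *.
move: s0; move: (v x `^ (2 * b)) (eta i x) (eta j x) (eta l x) (H x k l)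
  (G x j l) (G x i l) (G x i j) => *.
by field.
Qed.

Lemma Ck_raise_log_diff i : Ck_on 1 U (fun y => raise (H y) (fun m => eta m y) i).
Proof.
apply: Ck_on_sum => // m _; apply: Ck_onM => //; last exact: Ck_log_diff.
exact: (Ck_on_le _ (Ck_inverse oU GC Gpos i m)).
Qed.

Lemma partial_conf_diff i j k x : U x ->
  partial i (fun y => conf_diff (G y) (H y) (fun m => eta m y) i j k) x =
  partial i (eta j) x * (i == k)%:R + partial i (eta k) x * (i == j)%:R
   - (dg x i j k * raise (H x) (fun m => eta m x) i
      + G x j k * partial i (fun y => raise (H y) (fun m => eta m y) i) x).
Proof.
move=> Ux; apply: (@partial_conf_diff_shape _ _ (eta j) (eta k) (fun y => G y j k)
  (fun y => raise (H y) (fun m => eta m y) i)).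
- exact: (Ck_on_derivable (Ck_log_diff j) Ux).
- exact: (Ck_on_derivable (Ck_log_diff k) Ux).
- exact: (Ck_on_derivable (GC j k) Ux).
- exact: (Ck_on_derivable (Ck_raise_log_diff i) Ux).
Qed.

Lemma conf_diff_Ck k i j : Ck_on 1 U (fun y => conf_diff (G y) (H y) (fun m => eta m y) k i j).
Proof.
have CG := Ck_on_le (isT : (1 <= 2)%N) (GC i j).
have Cc (c : R) : Ck_on 1 U (fun=> c) by exact: Ck_on_cst.
exact: (Ck_onB oU (Ck_onD oU (Ck_onM oU (Ck_log_diff i) (Cc _)) (Ck_onM oU (Ck_log_diff j) (Cc _)))
  (Ck_onM oU CG (Ck_raise_log_diff k))).
Qed.

Lemma conformal_ricci j k x : U x ->
  ricci G' j k x = ricci G j k x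
   + (\sum_i (partial i (eta j) x * (i == k)%:R + partial i (eta k) x * (i == j)%:R
       - (dg x i j k * raise (H x) (fun m => eta m x) i
          + G x j k * partial i (fun y => raise (H y) (fun m => eta m y) i) x))
     - n%:R * partial j (eta k) x
     + let Gam := fun k i j => christoffel G k i j x in
       let A := conf_diff (G x) (H x) (fun m => eta m x) in
       \sum_i \sum_m
        ((Gam i i m + A i i m) * (Gam m j k + A m j k)
         - (Gam i j m + A i j m) * (Gam m i k + A m i k)
         - (Gam i i m * Gam m j k - Gam i j m * Gam m i k))).
Proof.
move=> Ux.
rewrite [LHS](@ricci_ofD _ _ U (christoffel G) (christoffel G')
  (fun a c d y => conf_diff (G y) (H y) (fun m => eta m y) a c d) j k x oU Ux
  (Ck_christoffel oU GC Gpos) conf_diff_Ck conformal_christoffel).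
congr (_ + (_ - _ + _)); first by apply: eq_bigr => i _; exact: partial_conf_diff.
transitivity (partial j (fun y => n%:R * eta k y) x); last first.
  rewrite (@partialM _ _ (fun=> n%:R) (eta k)); first by rewrite partial_cst mul0r addr0.
    exact: derivable_cst.
  exact: (Ck_on_derivable (Ck_log_diff k) Ux).
apply: (partial_eq_on _ oU) => // y Uy.
apply: (@conf_diff_trace _ _ (G y) (H y) _ (inverse_mul Gpos Uy)).
by move=> *; exact: (inverse_symE Gsym).
Qed.

(** The condition on [b] singles out the exponent [2b = 4/(n-2)] for which no square of the gradient
    of [v] survives. *)
Lemma conformal_scalar x : U x -> b * (n%:R - 2) = 2 ->
  local_scalar G' x = (v x `^ (2 * b))^-1 *
    (local_scalar G x - 2 * b * (n%:R - 1) * lapl G v x / v x).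
Proof.
move=> Ux bn.
have Hs i j : H x i j = H x j i by exact: (inverse_symE Gsym).
have Gs i j : G x i j = G x j i by exact: (metric_symE Gsym).
rewrite /local_scalar conformal_invmx //.
transitivity ((v x `^ (2 * b))^-1 * ctr (H x) (fun j k => ricci G' j k x)).
  rewrite mulr_sumr; apply: eq_bigr => j _; rewrite mulr_sumr; apply: eq_bigr => k _.
  by rewrite mxE mulrA.
congr (_ * _).
rewrite (eq_ctr _ (fun j k => conformal_ricci j k Ux)) ctrD /=.
rewrite -/(ctr (H x) (fun j k => ricci G j k x)); congr (_ + _).
rewrite (@conformal_ricci_trace _ _ (G x) (H x) Gs Hs (inverse_mul Gpos Ux)
  (fun k i j => christoffel G k i j x) (dg x) (fun m => eta m x)
  (fun i j => partial i (eta j) x)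
  (fun i j => partial i (fun y => raise (H y) (fun m => eta m y) j) x)); first last.
- by move=> i; apply: (tr_levi_civita Hs) => *; exact: (partial_metric_sym oU Gsym).
- by move=> *; exact: (christoffel_sym oU Gsym).
(* Divergence and Hessian trace of [b log v] become the same expression, so that their coefficients
   [-n] and [2 - n] add up to [-2(n-1)]. *)
rewrite (divergence_gradient oU GC Gsym Gpos Ux); last first.
  by move=> m i; exact: (Ck_on_derivable (Ck_log_diff m) Ux).
have vx0 : v x != 0 by rewrite gt_eqF // v0.
pose N := \sum_i partial i v x * raise (H x) (fun m => partial m v x) i.
have rE i : raise (H x) (fun m => eta m x) i = b / v x * raise (H x) (fun m => partial m v x) i.
  rewrite /raise mulr_sumr; apply: eq_bigr => m _; rewrite /eta.
  by move: (partial m v x) (H x i m) => *; field.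
have -> : \sum_i eta i x * raise (H x) (fun m => eta m x) i = (b / v x) ^+ 2 * N.
  rewrite mulr_sumr; apply: eq_bigr => i _; rewrite rE /eta.
  by move: (partial i v x) (raise _ _ _) => *; field.
have -> : ctr (H x) (fun i j => partial i (eta j) x)
   - \sum_m eta m x * ctr_christoffel (H x) (fun k i j => christoffel G k i j x) m
   = b * (lapl G v x / v x - N / v x ^+ 2).
  have E i j : partial i (eta j) x = b / v x * partial i (partial j v) x
      - b / v x ^+ 2 * (partial i v x * partial j v x).
    have dv : derivable v x (delta_mx 0 i) := Ck_on_derivable vC Ux.
    have ddv : derivable (partial j v) x (delta_mx 0 i) := Ck_on_derivable (Ck_on_partial j vC) Ux.
    have dvV : is_derive x (delta_mx 0 i) (fun y => (v y)^-1) (- (v x) ^- 2 * partial i v x).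
      have dV : is_derive (v x) (1 : R) (fun s : R => s^-1) (- (v x) ^- 2).
        have dI := @is_deriveV R (id : R -> R) (v x) (1 : R) (1 : R) vx0 (is_derive_id _ _).
        by apply: is_derive_eq dI _; rewrite -[_ *: _]/(_ * _) mulr1.
      exact: (is_derive_comp1 dV dv).
    have dbv : derivable (fun y => b * partial j v y) x (delta_mx 0 i).
      exact: (derivableM (derivable_cst b x _) ddv).
    rewrite (partialM dbv (@ex_derive _ _ _ _ _ _ _ dvV)).
    have -> : partial i (fun y => (v y)^-1) x = _ := @derive_val _ _ _ _ _ _ _ dvV.
    rewrite (partialM (derivable_cst b x _) ddv).
    rewrite partial_cst /cst; move: (partial i v x) (partial j v x) (partial i (partial j v) x) => *.
    by field.
  rewrite (eq_ctr _ E) ctrB !ctrZ ctr_outer laplE -/N.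
  have -> : \sum_m eta m x * ctr_christoffel (H x) (fun k i j => christoffel G k i j x) m =
    b / v x * \sum_m partial m v x * ctr_christoffel (H x) (fun k i j => christoffel G k i j x) m.
    rewrite mulr_sumr; apply: eq_bigr => m _; rewrite /eta.
    by move: (partial m v x) (ctr_christoffel _ _ _) => *; field.
  by move: (ctr _ _) (\sum_m _) N => *; field.
(* The total coefficient of [N] is proportional to [2 - b(n-2)]; substituting the value of [b] makes
   it vanish. *)
have n2 : n%:R - 2 != 0 :> R by apply/eqP => n2; move: bn; rewrite n2 mulr0 => /esym/eqP; rewrite pnatr_eq0.
have -> : b = 2 / (n%:R - 2) by apply: (mulIf n2); rewrite bn divfK.
by move: (lapl G v x) N vx0 n2; move: (v x) => ? ? ? vx0 n2; field; rewrite vx0 n2.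
Qed.

End ConformalLocal.

(** * Integration in charts *)

Section Density.
Local Open Scope ereal_scope.
Context d d' (X : measurableType d) (Y : measurableType d') (R : realType).
Variables (mu : {measure set X -> \bar R}) (lam : {measure set Y -> \bar R}).
Variables (phi : Y -> X) (rho : Y -> R).
Hypotheses (mphi : measurable_fun setT phi) (mrho : measurable_fun setT rho)
  (rho0 : forall y, (0 <= rho y)%R).
Hypothesis muE : forall A, measurable A ->
  mu A = \int[lam]_y ((\1_A (phi y))%:E * (rho y)%:E).

Import HBNNSimple.

(** [muE] is the claim for indicators; it extends to simple functions by linearity and to [f] by
    monotone convergence along an increasing approximation. *)
Lemma ge0_integral_density (f : X -> \bar R) :
  measurable_fun setT f -> (forall x, 0 <= f x) ->
  \int[mu]_x f x = \int[lam]_y (f (phi y) * (rho y)%:E).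
Proof.
move=> mf f0.
pose f_ := nnsfun_approx measurableT mf.
have mf_ n : measurable_fun setT (fun y => (f_ n (phi y))%:E).
  by apply/measurable_EFinP; apply: measurableT_comp.
transitivity (limn (fun n => \int[mu]_x (f_ n x)%:E)).
  rewrite -monotone_convergence //.
  - by apply: eq_integral => x _; apply/esym/cvg_lim => //; exact: cvg_nnsfun_approx.
  - by move=> n; exact/measurable_EFinP/measurable_funP.
  - by move=> n x _; rewrite lee_fin.
  - by move=> x _ m n mn; rewrite lee_fin; exact/lefP/nd_nnsfun_approx.
transitivity (limn (fun n => \int[lam]_y ((f_ n (phi y))%:E * (rho y)%:E))); last first.
  rewrite -monotone_convergence //.
  - apply: eq_integral => y _; apply/cvg_lim => //.
    by apply: cvgeZr => //; exact: cvg_nnsfun_approx.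
  - by move=> n; apply: emeasurable_funM => //; exact/measurable_EFinP.
  - by move=> n y _; rewrite mule_ge0 // lee_fin.
  - by move=> y _ m n mn; apply: lee_wpmul2r; rewrite lee_fin //; exact/lefP/nd_nnsfun_approx.
congr (limn _); apply/funext => n.
have mA r : measurable_fun setT (fun y => \1_(f_ n @^-1` [set r]) (phi y) : R).
  by apply: (measurableT_comp _ mphi).
rewrite integralT_nnsfun sintegralE.
under [RHS]eq_integral => y _.
  rewrite fimfunE -fsumEFin // ge0_mule_fsuml; last first.
    by move=> r; rewrite EFinM; exact: nnfun_muleindic_ge0.
  over.
rewrite ge0_integral_fsum //; last 2 first.
- move=> r; apply: emeasurable_funM => //; apply/measurable_EFinP => //.
  by apply: measurable_funM.
- move=> r y _; apply: mule_ge0; last by rewrite lee_fin.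
  by rewrite ?EFinM; exact: nnfun_muleindic_ge0.
apply: eq_fsbigr => r _; rewrite muE //.
have [r0|r0] := leP 0%R r; last first.
  rewrite preimage_nnfun0 //; under eq_integral do rewrite indicE in_set0 mul0e.
  by under [RHS]eq_integral do rewrite indicE in_set0 mulr0 mul0e; rewrite integral0 mule0.
rewrite -ge0_integralZl //.
- by apply: eq_integral => y _; rewrite EFinM muleA.
- by apply: emeasurable_funM; exact/measurable_EFinP.
- by move=> y _; rewrite mule_ge0 // lee_fin.
Qed.

End Density.

Section DensityMeasure.
Context d (X : measurableType d) (R : realType) (mu : {measure set X -> \bar R}).

Lemma density_measure (rho : X -> R) : measurable_fun setT rho ->
  (forall x, 0 <= rho x) ->
  exists nu : {measure set X -> \bar R}, forall A, measurable A ->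
    nu A = (\int[mu]_x ((\1_A x)%:E * (rho x)%:E))%E.
Proof.
move=> mrho rho0.
pose nu (A : set X) := (\int[mu]_(x in A) (rho x)%:E)%E.
have nu0 : nu set0 = 0%E by rewrite /nu integral_set0.
have nu_ge0 A : (0 <= nu A)%E by apply: integral_ge0 => x _; rewrite lee_fin.
have nu_sigma : semi_sigma_additive nu.
  move=> F mF tF mUF; rewrite /nu ge0_integral_bigcup //; last first.
  - by move=> x _; rewrite lee_fin.
  - by apply/measurable_EFinP; exact: measurable_funTS.
  by apply: is_cvg_ereal_nneg_natsum => k _; exact: nu_ge0.
pose mnu := isMeasure.Build _ _ _ nu nu0 nu_ge0 nu_sigma.
exists (HB.pack nu mnu : {measure set X -> \bar R}) => A mA /=.
rewrite /nu integral_mkcond; apply: eq_integral => x _.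
by rewrite patchE indicE; case: ifP => _; rewrite ?mul1e ?mul0e.
Qed.

End DensityMeasure.

Lemma open_preimage_on (T T' : topologicalType) (D : set T) (f : T -> T') (V : set T') :
  open D -> open V -> (forall x, D x -> {for x, continuous f}) -> open (D `&` f @^-1` V).
Proof.
move=> oD oV cf; rewrite openE => x [Dx Vx]; apply: filterI.
  exact: (open_nbhs_nbhs (conj oD Dx)).
by apply: (cf x Dx); exact: (open_nbhs_nbhs (conj oV Vx)).
Qed.

(** * Integrals on the manifold expressed in charts *)

Section Charts.
Context {R : realType} {n : nat} (M : closed_manifold R n).
Local Notation ch := (@chart_of R n M).
Local Notation dom a := (chart_dom (ch a)).
Local Notation cod a := (codom_chart (ch a)).
Local Notation map a := (chart_map (ch a)).
Local Notation inv a := (chart_inv (ch a)).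
Implicit Types (a b : atlas M) (p q : M).

Lemma dom_open a : open (dom a). Proof. exact: chart_dom_open. Qed.

Lemma cod_open a : open (cod a). Proof. exact: codom_chart_open. Qed.

Lemma map_cod a p : dom a p -> cod a (map a p).
Proof. by move=> dp; exists p. Qed.

Lemma inv_dom a x : cod a x -> dom a (inv a x).
Proof. by move=> [p dp <-]; rewrite chart_mapK. Qed.

Lemma chart_invK a x : cod a x -> map a (inv a x) = x.
Proof. by move=> [p dp <-]; rewrite chart_mapK. Qed.

Lemma continuous_map a p : dom a p -> {for p, continuous (map a)}.
Proof.
move=> dp; have := @chart_map_continuous _ _ _ (ch a).
by rewrite continuous_open_subspace; [apply; rewrite inE|exact: dom_open].
Qed.

Lemma continuous_inv a x : cod a x -> {for x, continuous (inv a)}.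
Proof.
move=> dx; have := @chart_inv_continuous _ _ _ (ch a).
by rewrite continuous_open_subspace; [apply; rewrite inE|exact: cod_open].
Qed.

Lemma open_image_map a (O : set M) : open O -> open (map a @` (O `&` dom a)).
Proof.
move=> oO; rewrite (_ : map a @` _ = cod a `&` inv a @^-1` O); last first.
  apply/seteqP; split=> [_ [p [Op dp] <-]|x [cx Ox]].
    by split; [exact: map_cod|rewrite /= chart_mapK].
  by exists (inv a x); [split=> //; exact: inv_dom|rewrite chart_invK].
apply: open_preimage_on => //; [exact: cod_open|exact: continuous_inv].
Qed.

(** [chart_inv] is arbitrary outside the image of the chart; sending that region to a fixed point
    makes the map Borel on the whole space. *)
Definition cinv a : @brV R n -> borel M :=
  fun x => if `[< cod a x >] then inv a x else point.

Lemma cinvE a x : cod a x -> cinv a x = inv a x.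
Proof. by move=> cx; rewrite /cinv asboolT. Qed.

Lemma open_borel (O : set M) : open O -> measurable (O : set (borel M)).
Proof. by move=> oO; exact: sub_sigma_algebra. Qed.

Lemma measurable_cod a : measurable (cod a : set (@brV R n)).
Proof. by apply: sub_sigma_algebra; exact: cod_open. Qed.

Lemma measurable_cinv a : measurable_fun setT (cinv a).
Proof.
apply: borel_measurable_fun => V oV; rewrite setTI.
have -> : cinv a @^-1` V = (map a @` (V `&` dom a)) `|`
    (~` cod a `&` (fun=> point) @^-1` V).
  apply/seteqP; split=> [x|x []].
  - rewrite /= /cinv; case: asboolP => cx Vx; [left|by right].
    by exists (inv a x); [split=> //; exact: inv_dom|rewrite chart_invK].
  - by move=> [p [Vp dp] <-]; rewrite /= cinvE ?chart_mapK //; exact: map_cod.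
  - by move=> [cx Vp]; rewrite /= /cinv asboolF.
apply: measurableU.
  by apply: sub_sigma_algebra; exact: open_image_map.
apply: measurableI; first by apply: measurableC; exact: measurable_cod.
by rewrite preimage_cst; case: ifP.
Qed.

(** The indicator cuts the density off outside the image of the chart, so that integrals run over
    the whole space. *)
Definition vol_density (g : tensor2 M) a (x : 'rV[R]_n) : R :=
  Num.sqrt (\det (coord_tensor g a x)) * \1_(cod a) x.

Lemma vol_density_ge0 g a x : 0 <= vol_density g a x.
Proof. by rewrite mulr_ge0 // sqrtr_ge0. Qed.

Section Volume.
Variables (g : tensor2 M) (mu : {measure set (borel M) -> \bar R}).
Hypothesis (gC : forall a i j, Ck_on 0 (cod a) (fun x => coord_tensor g a x i j)).
Hypothesis muV : is_volume g mu.

Lemma measurable_vol_density a : measurable_fun (setT : set (@brV R n)) (vol_density g a).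
Proof.
have -> : vol_density g a = (fun x => Num.sqrt (\det (coord_tensor g a x))) \_ (cod a).
  apply/funext => x; rewrite patchE /vol_density indicE.
  by case: ifP => _; rewrite ?mulr1 ?mulr0.
apply/(measurable_restrictT _ (measurable_cod a)).
apply: open_continuous_borel; first exact: cod_open.
move=> x cx; apply: continuous_comp; last exact: sqrt_continuous.
have [+ _] := Ck_on_det (@cod_open a) (@gC a); exact.
Qed.

Lemma ge0_integral_chart a (f : borel M -> \bar R) :
  measurable_fun setT f -> (forall p, 0 <= f p)%E ->
  (\int[mu]_(p in dom a) f p =
   \int[lebV n]_x (f (cinv a x) * (vol_density g a x)%:E))%E.
Proof.
move=> mf f0.
have mD : measurable (dom a : set (borel M)) by apply: open_borel; exact: dom_open.
have m1 : measurable_fun setT (\1_(dom a) : borel M -> R) by [].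
(* The restriction of [mu] to the chart domain is described by a density in two ways: the indicator
   of the domain with respect to [mu], and [vol_density] with respect to [lebV] transported by
   [cinv]. *)
transitivity (\int[mrestr mu mD]_p f p)%E.
  rewrite (@ge0_integral_density _ _ _ _ _ (mrestr mu mD) mu id (\1_(dom a))) //.
    rewrite integral_mkcond; apply: eq_integral => p _.
    by rewrite patchE indicE; case: ifP => _; rewrite ?mule1 ?mule0.
  move=> A mA; have mAD : measurable (A `&` dom a : set (borel M)) by exact: measurableI.
  transitivity (mu ((A `&` dom a) `&` setT)); first by rewrite setIT.
  rewrite -(integral_indic mu measurableT mAD).
  by apply: eq_integral => p _; rewrite indicI -EFinM.
apply: (ge0_integral_density (measurable_cinv a) (measurable_vol_density a) (vol_density_ge0 g a)) => //.
move=> A mA; have mAD : measurable (A `&` dom a : set (borel M)) by exact: measurableI.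
transitivity (mu (A `&` dom a)) => //; rewrite (muV (a := a) mAD) //.
have E x : (Num.sqrt (\det (coord_tensor g a x)) * \1_(map a @` (A `&` dom a)) x)%:E =
   ((\1_A (cinv a x))%:E * (vol_density g a x)%:E)%E.
  rewrite -EFinM /vol_density mulrCA; congr (_ * _)%:E; rewrite !indicE -natrM mulnb.
  congr (_%:R); congr nat_of_bool; apply/idP/idP; rewrite !inE.
    move=> [p [Ap dp] <-]; have cp := map_cod dp.
    by apply/andP; split; rewrite inE // cinvE // chart_mapK.
  move=> /andP[]; rewrite !inE => Ax cx; rewrite cinvE // in Ax.
  by exists (inv a x); [split=> //; exact: inv_dom|rewrite chart_invK].
rewrite integral_rV_lebV.
- by apply: eq_integral => x _; exact: E.
- rewrite (_ : (fun x => _) = (fun x => ((\1_A (cinv a x))%:E * (vol_density g a x)%:E)%E)).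
    apply: emeasurable_funM; apply/measurable_EFinP; last exact: measurable_vol_density.
    by apply: measurableT_comp (measurable_cinv a).
  by apply/funext => x; exact: E.
- by move=> x; rewrite E mule_ge0 // lee_fin vol_density_ge0.
Qed.

(** The density is nonnegative, hence factors out of positive and negative parts, and the
    nonnegative case applies to each of them. *)
Lemma integral_chart a (f : borel M -> R) :
  measurable_fun setT f -> (forall p, ~ dom a p -> f p = 0) ->
  (\int[mu]_p (f p)%:E =
   \int[lebV n]_x (f (cinv a x) * vol_density g a x)%:E)%E.
Proof.
move=> mf f0.
have -> : (\int[mu]_p (f p)%:E = \int[mu]_(p in dom a) (f p)%:E)%E.
  rewrite [RHS]integral_mkcond; apply: eq_integral => p _.
  rewrite patchE; case: ifPn => // /negP dp; rewrite f0 // => H; apply: dp.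
  by rewrite inE.
have mfe : measurable_fun setT (EFin \o f) by exact/measurable_EFinP.
rewrite integralE [RHS]integralE; congr (_ - _)%E.
  rewrite ge0_integral_chart //; last exact: measurable_funepos.
  apply: eq_integral => x _; rewrite !funeposE /= EFinM.
  by rewrite -!EFin_max -!EFinM maxr_pMl ?vol_density_ge0 // mul0r.
rewrite ge0_integral_chart //; last exact: measurable_funeneg.
apply: eq_integral => x _; rewrite !funenegE /= -?EFinN -!EFin_max -EFinM -?mulNr.
by rewrite maxr_pMl ?vol_density_ge0 // mul0r.
Qed.

End Volume.

End Charts.

(** * Bump functions *)

Section Gluing.
Context {R : realType} {n : nat}.
Implicit Types (f : 'rV[R]_n -> R) (U V K : set 'rV[R]_n).

Lemma Ck_on_glue k U f :
  (forall x, U x -> exists V, [/\ open V, V x & Ck_on k V f]) -> Ck_on k U f.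
Proof.
have cf l g : (forall x, U x -> exists V, [/\ open V, V x & Ck_on l V g]) ->
    forall x, U x -> {for x, continuous g}.
  by move=> H x /H[V [_ Vx CV]]; exact: (Ck_on_continuous CV Vx).
elim: k f => [|k IH] f H; split=> //; try exact: cf H.
move=> i; split=> [x /H[V [_ Vx CV]]|]; first exact: (Ck_on_derivable CV Vx).
by apply: IH => x /H[V [oV Vx CV]]; exists V; split=> //; exact: Ck_on_partial.
Qed.

(** The open sets [V] and the complement of [K] cover the space, and being of class C^k is local. *)
Lemma Ck_on_extend0 k V K f : open V -> closed K -> K `<=` V ->
  Ck_on k V f -> (forall x, ~ K x -> f x = 0) -> Ck_on k setT f.
Proof.
move=> oV cK KV CV f0; apply: Ck_on_glue => x _; have [Kx|nKx] := pselect (K x).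
  by exists V; split=> //; exact: KV.
have oK : open (~` K) by exact: closed_openC.
exists (~` K); split=> //; apply: (Ck_on_eq oK) (Ck_on_cst oK k 0) => y nKy.
by rewrite f0.
Qed.

(** The elementary C^1 cutoff. At 0, the only delicate point, the difference quotient is at most
    [|h|] in absolute value. *)
Lemma is_derive_pos_sq (s : R) :
  is_derive s 1 (fun t : R => Num.max 0 t ^+ 2) (2 * Num.max 0 s).
Proof.
have sq (u : R) : is_derive u 1 (fun t : R => t ^+ 2) (2 * u).
  split; first exact: exprn_derivable.
  by rewrite exp_derive expr1 -[_ *: 1]/(_ * 1) mulr1.
have [s0|s0|s0] := ltgtP 0 s.
- apply: near_eq_is_derive (sq s).
  near=> t; rewrite max_r //; apply: ltW; near: t; exact: lt_nbhsr.
- rewrite mulr0; apply: near_eq_is_derive (is_derive_cst 0 s 1).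
  near=> t; rewrite max_l ?expr0n //; apply: ltW; near: t; exact: lt_nbhsl.
rewrite -s0 ?maxxx mulr0.
have L : (fun h : R => h^-1 *: (((fun t : R => Num.max 0 t ^+ 2) \o shift (0 : R)) (h *: (1 : R))
    - Num.max 0 (0 : R) ^+ 2)) @ 0^' --> (0 : R).
  apply/cvgrPdist_lt => e e0; near=> h.
  have h0 : h != 0 by near: h; exact: nbhs_dnbhs_neq.
  rewrite /= /shift /= addr0 maxxx expr0n /= subr0 sub0r normrN [h *: 1]mulr1.
  rewrite -[_ *: _]/(_ * _) normrM normrX normfV.
  apply: (@le_lt_trans _ _ `|h|).
    rewrite ler_pdivrMl ?normr_gt0 // -expr2 ler_pXn2r ?nnegrE //.
    rewrite ger0_norm ?le_max ?lexx //.
    by rewrite ge_max normr_ge0 ler_norm.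
  near: h; apply: nbhs_dnbhs; apply/nbhs_ballP; exists e => //= h.
  by rewrite /ball /= sub0r normrN.
split; first by apply/cvg_ex; exists 0.
by apply: cvg_lim.
Unshelve. all: by end_near. Qed.

Lemma Ck1_pos_sq U f : open U -> Ck_on 1 U f -> Ck_on 1 U (fun y => Num.max 0 (f y) ^+ 2).
Proof.
move=> oU Cf.
have cmax y : U y -> {for y, continuous (fun z => Num.max 0 (f z))}.
  move=> Uy; have cf := Ck_on_continuous Cf Uy.
  by apply: (@continuous_max _ _ (fun=> 0) f) => //; exact: cst_continuous.
have D i y (Uy : U y) := is_derive_comp1 (is_derive_pos_sq (f y)) (Ck_on_derivable (i:=i) Cf Uy).
split=> [y Uy|i].
  rewrite (_ : (fun _ => _) = (fun z => Num.max 0 (f z) * Num.max 0 (f z))).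
    exact: (continuousM (cmax y Uy) (cmax y Uy)).
  by apply/funext => z; rewrite expr2.
split=> [y Uy|]; first by case: (D i y Uy).
split=> // y Uy.
apply: (@continuous_eq_on R _ U (fun z => 2 * Num.max 0 (f z) * partial i f z)) => //.
  by move=> z Uz; have [_ <-] := D i z Uz.
apply: continuousM; last exact: (Ck_on_continuous (Ck_on_partial i Cf) Uy).
by apply: continuousM; [exact: cst_continuous|exact: cmax].
Qed.

(** The squared Euclidean distance: a polynomial, unlike the maximum norm that defines [ball]. *)
Definition dist2 (c x : 'rV[R]_n) : R := \sum_i (x 0 i - c 0 i) ^+ 2.

Lemma Ck_dist2 k c : Ck_on k setT (dist2 c).
Proof.
apply: Ck_on_sum => [|i _]; first exact: openT.
have C : Ck_on k setT (fun x : 'rV[R]_n => x 0 i - c 0 i).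
  by apply: (Ck_onB openT); [exact: (Ck_on_coord k i openT)|exact: Ck_on_cst openT _ _].
by apply: (Ck_on_eq openT) (Ck_onM openT C C) => x _; rewrite expr2.
Qed.

Lemma compact_dist2_ball c r : compact [set x | dist2 c x <= r ^+ 2].
Proof.
apply: bounded_closed_compact.
  exists (`|r| + `|c|); split=> [|y yb x /= xr]; first exact: num_real.
  apply: (le_trans _ (ltW yb)); apply: norm_rV_le; first by rewrite addr_ge0.
  move=> i; rewrite -(subrK (c 0 i) (x 0 i)) (le_trans (ler_normD _ _)) //.
  rewrite lerD ?coord_le_norm // -ler_sqr ?nnegrE // !real_normK ?num_real //.
  apply: le_trans xr; rewrite /dist2 (bigD1 i) //= lerDl sumr_ge0 // => j _.
  exact: sqr_ge0.
have -> : [set x | dist2 c x <= r ^+ 2] = dist2 c @^-1` [set y | y <= r ^+ 2] by [].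
apply: closed_comp => [x _|]; last exact: closed_le.
exact: (Ck_on_continuous (Ck_dist2 0 c)).
Qed.

Lemma dist2_ball c r e : 0 < r < e -> [set x | dist2 c x <= r ^+ 2] `<=` ball c e.
Proof.
move=> /andP[r0 re] x /= xr; apply/ball_rVE; first exact: lt_trans re.
move=> i; rewrite distrC; apply: le_lt_trans re.
rewrite -[leRHS](ger0_norm (ltW r0)) -ler_sqr ?nnegrE // !real_normK ?num_real //.
apply: le_trans xr; rewrite /dist2 (bigD1 i) //= lerDl sumr_ge0 // => j _.
exact: sqr_ge0.
Qed.

End Gluing.

(** * Bump functions and compactness on the manifold *)

Section Manifold.
Context {R : realType} {n : nat} (M : closed_manifold R n).
Local Notation ch := (@chart_of R n M).
Local Notation dom a := (chart_dom (ch a)).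
Local Notation cod a := (codom_chart (ch a)).
Local Notation map a := (chart_map (ch a)).
Local Notation inv a := (chart_inv (ch a)).
Implicit Types (a b : atlas M) (p q : M) (f : M -> R).

Lemma continuous_Ck_fun k f : Ck_fun k f -> continuous f.
Proof.
move=> Cf p; have [a dp] := atlas_cover p.
apply: (@continuous_eq_on R M (dom a) ((f \o inv a) \o map a)) => //; first exact: dom_open.
  by move=> q dq; rewrite /= chart_mapK.
apply: continuous_comp; first exact: continuous_map.
exact: (Ck_on_continuous (Cf a) (map_cod dp)).
Qed.

(** One chart around each point is enough, because the smooth transition maps carry class C^1 to
    every other chart by [Ck1_comp]. *)
Lemma Ck1_fun_local f :
  (forall p, exists a (W : set M),
     [/\ open W, W p, W `<=` dom a & Ck_on 1 (map a @` W) (f \o inv a)]) ->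
  Ck_fun 1 f.
Proof.
move=> H b; apply: Ck_on_glue => x cx.
have [a [W [oW Wp Wd CW]]] := H (inv b x).
have oV : open (map b @` (W `&` dom b)) by exact: open_image_map.
have oWa : open (map a @` W).
  rewrite (_ : W = W `&` dom a); first exact: open_image_map.
  by apply/seteqP; split=> [q Wq|q []//]; split=> //; exact: Wd.
exists (map b @` (W `&` dom b)); split=> //.
  by exists (inv b x); [split=> //; exact: inv_dom|rewrite chart_invK].
have C : Ck_on 1 (map b @` (W `&` dom b)) ((f \o inv a) \o (fun y => map a (inv b y))).
  apply: (Ck1_comp oWa oV) => // [_ [q [Wq dq] <-]|k].
    by exists q => //; rewrite chart_mapK.
  apply: (Ck_on_sub _ (atlas_smooth b a k 1)) => _ [q [Wq dq] <-].
  by exists q => //; split=> //; exact: Wd.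
apply: (Ck_on_eq oV) C => _ [q [Wq dq] <-].
by rewrite /= !chart_mapK //; exact: Wd.
Qed.

Lemma compact_chart_image a (K : set 'rV[R]_n) : compact K -> K `<=` cod a ->
  compact (inv a @` K).
Proof.
move=> cK Kc; apply: continuous_compact => //.
by apply: continuous_in_subspaceT => x; rewrite inE => /Kc; exact: continuous_inv.
Qed.

Lemma compact_closedM (K : set M) : compact K -> closed K.
Proof. by apply: compact_closed; exact: carrier_hausdorff. Qed.

(** In the chart the bump is [max(0, r^2 - |x - x_p|^2)^2], extended by 0. Its support lies in the
    preimage of a closed Euclidean ball, which is compact and therefore closed as the manifold is
    Hausdorff; on the open complement the extension is constant. *)
Lemma bump_exists a p (W : set M) : open W -> W p -> W `<=` dom a ->
  exists (psi : M -> R) (K : set M), [/\ compact K, K `<=` W, forall q, 0 <= psi q, 0 < psi p &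
    (forall q, ~ K q -> psi q = 0) /\ Ck_fun 1 psi].
Proof.
move=> oW Wp Wd; have dp := Wd _ Wp.
have oV : open (map a @` W).
  rewrite (_ : W = W `&` dom a); first exact: open_image_map.
  by apply/seteqP; split=> [q Wq|q []//]; split=> //; exact: Wd.
have /nbhs_ballP[e /= e0 eV] : nbhs (map a p) (map a @` W).
  by apply: open_nbhs_nbhs; split=> //; exists p.
(* Half the radius, so that the closed Euclidean ball fits into the open ball of radius [e]. *)
pose r := e / 2; have r0 : 0 < r by rewrite divr_gt0.
have re : 0 < r < e by rewrite r0 /r ltr_pdivrMr // ltr_pMr // ltr1n.
pose K0 := [set x | dist2 (map a p) x <= r ^+ 2].
have K0V : K0 `<=` map a @` W by move=> x /(dist2_ball re)/eV.
have Vc : map a @` W `<=` cod a by move=> _ [q Wq <-]; exact: map_cod (Wd _ Wq).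
have K0c : K0 `<=` cod a by move=> x /K0V/Vc.
have cK : compact (inv a @` K0).
  by apply: compact_chart_image => //; exact: compact_dist2_ball.
pose B x : R := Num.max 0 (r ^+ 2 - dist2 (map a p) x) ^+ 2.
pose psi q := if `[< dom a q >] then B (map a q) else 0.
have psiE q : dom a q -> psi q = B (map a q) by move=> dq; rewrite /psi asboolT.
have psi0 q : ~ (inv a @` K0) q -> psi q = 0.
  move=> nK; rewrite /psi; case: asboolP => // dq; rewrite /B max_l ?expr0n //.
  rewrite subr_le0 leNgt; apply/negP => H; apply: nK; exists (map a q).
    exact: ltW.
  by rewrite chart_mapK.
exists psi, (inv a @` K0); split => //.
- by move=> _ [x /K0V[q Wq <-] <-]; rewrite chart_mapK //; exact: Wd.
- by move=> q; rewrite /psi; case: ifP => // _; rewrite sqr_ge0.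
- rewrite psiE // exprn_gt0 // lt_max; apply/orP; right.
  rewrite subr_gt0 /dist2 big1 ?exprn_gt0 // => i _.
  by rewrite subrr expr0n.
split=> //; apply: Ck1_fun_local => q.
have [dq|ndq] := pselect (dom a q).
  exists a, (dom a); split=> //; first exact: dom_open.
  have oc : open (map a @` dom a) by exact: cod_open.
  have CB : Ck_on 1 (map a @` dom a) B.
    apply: Ck1_pos_sq => //; apply: Ck_onB => //; first exact: Ck_on_cst.
    exact: (Ck_on_sub (@subsetT _ _) (Ck_dist2 1 _)).
  by apply: (Ck_on_eq oc) CB => _ [q' dq' <-]; rewrite /= chart_mapK // psiE.
have [b dbq] := atlas_cover q.
have oK : open (~` (inv a @` K0)) by apply: closed_openC; exact: compact_closedM.
exists b, (~` (inv a @` K0) `&` dom b); split.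
- by apply: openI => //; exact: dom_open.
- by split=> // -[x /K0c cx E]; apply: ndq; rewrite -E; exact: inv_dom.
- by move=> ? [].
have oI := @open_image_map _ _ M b _ oK.
apply: (Ck_on_eq oI) (Ck_on_cst oI 1 0) => _ [q' [nK dq'] <-].
by rewrite /= chart_mapK // psi0.
Qed.

Lemma compact_finite_cover (W : M -> set M) :
  (forall p, open (W p)) -> (forall p, W p p) ->
  exists s : seq M, forall q, exists2 p, p \in s & W p q.
Proof.
move=> oW Wp; have := @carrier_compact _ _ M; rewrite compact_cover.
move=> /(_ _ setT W (fun p _ => oW p)) [|D _ DW].
  by move=> q _; exists q.
exists (finmap.enum_fset D) => q; have [p pD Wpq] := DW q I; exists p => //.
Qed.

Lemma continuous_bounded f : continuous f -> exists2 C, 0 <= C & forall p, `|f p| <= C.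
Proof.
move=> cf.
have cN : {within [set: M], continuous (fun p => `|f p|)}.
  apply: continuous_subspaceT => p.
  by apply: (continuous_comp (cf p)); exact: norm_continuous.
have [|c _ cmax] := compact_EVT_max _ (@carrier_compact _ _ M) cN.
  by exists point.
by exists `|f c| => // p; apply: cmax; rewrite inE.
Qed.

Lemma continuous_extend0M (D K : set M) f : open D -> closed K -> K `<=` D ->
  (forall p, D p -> {for p, continuous f}) -> (forall p, ~ K p -> f p = 0) -> continuous f.
Proof.
move=> oD cK KD cf f0 p; have [Kp|nKp] := pselect (K p); first exact/cf/KD.
apply: (@continuous_eq_on R M (~` K) (fun=> 0)) => //; first exact: closed_openC.
  by move=> q nKq; rewrite f0.
exact: cst_continuous.
Qed.

End Manifold.

(** * Finiteness of volume and integrability of continuous functions *)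

Section RiemannianIntegration.
Context {R : realType} {n : nat} (M : closed_manifold R n).
Local Notation ch := (@chart_of R n M).
Local Notation dom a := (chart_dom (ch a)).
Local Notation cod a := (codom_chart (ch a)).
Local Notation map a := (chart_map (ch a)).
Local Notation inv a := (chart_inv (ch a)).
Implicit Types (a b : atlas M) (p q : M) (f h : M -> R).

Definition lapl_chart (g : tensor2 M) a f p : R :=
  lapl (coord_tensor g a) (f \o inv a) (map a p).

Definition gradp_chart (g : tensor2 M) a f h p : R :=
  gradp (coord_tensor g a) (f \o inv a) (h \o inv a) (map a p).

Lemma continuous_borelM f : continuous f -> measurable_fun (setT : set (borel M)) f.
Proof. exact: continuous_borel. Qed.

Variables (g : tensor2 M).
Hypothesis gM : riemannian_metric 2 g.

Lemma coord_C2 a i j : Ck_on 2 (cod a) (fun x => coord_tensor g a x i j).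
Proof. exact: (metric_Ck gM). Qed.

Lemma coord_sym a x : cod a x -> (coord_tensor g a x)^T = coord_tensor g a x.
Proof. by move=> cx; exact: (Defs.metric_sym gM (inv_dom cx)). Qed.

Lemma coord_pos a x : cod a x ->
  forall v : 'rV[R]_n, v != 0 -> 0 < quad (coord_tensor g a x) v.
Proof. by move=> cx; exact: (metric_posdef gM (inv_dom cx)). Qed.

Let sqrt_det_gt0 a x : cod a x -> 0 < Num.sqrt (\det (coord_tensor g a x)).
Proof. by move=> cx; rewrite sqrtr_gt0; apply: posdef_det_gt0; exact: coord_pos. Qed.

Let C0 a i j : Ck_on 0 (cod a) (fun x => coord_tensor g a x i j) :=
  Ck_on_le (isT : (0 <= 2)%N) (coord_C2 a i j).

Lemma compact_map_image a (K : set M) : compact K -> K `<=` dom a ->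
  compact (map a @` K) /\ map a @` K `<=` cod a.
Proof.
move=> cK Kd; split; last by move=> _ [p Kp <-]; exact/map_cod/Kd.
apply: continuous_compact => //.
by apply: continuous_in_subspaceT => x; rewrite inE => /Kd; exact: continuous_map.
Qed.

Lemma compact_norm_bound (K : set 'rV[R]_n) : compact K ->
  exists B : R, forall x, B <= `|x| -> ~ K x.
Proof.
move=> /compact_bounded[B [_ KB]]; exists (B + 2) => x Bx Kx.
have := KB (B + 1); rewrite ltrDl ltr01 => /(_ isT x Kx) /= xB.
by have := le_trans Bx xB; lra.
Qed.

Lemma chart_support_continuous a (K : set M) f : compact K -> K `<=` dom a ->
  continuous f -> (forall p, ~ K p -> f p = 0) ->
  continuous (fun x => f (cinv a x) * vol_density g a x) /\
  exists B : R, forall x, B <= `|x| -> f (cinv a x) * vol_density g a x = 0.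
Proof.
move=> cK Kd cf f0; have [cK0 K0c] := compact_map_image cK Kd.
have z x : ~ (map a @` K) x -> f (cinv a x) * vol_density g a x = 0.
  move=> nx; rewrite /vol_density indicE; case: (pselect (cod a x)) => cx; last first.
    by rewrite memNset ?mulr0.
  rewrite f0 ?mul0r // cinvE // => Kx; apply: nx; exists (inv a x) => //.
  exact: chart_invK.
have clK0 : closed (map a @` K) by apply: compact_closed => //; exact: norm_hausdorff.
split; last first.
  by have [B HB] := compact_norm_bound cK0; exists B => x /HB; exact: z.
have C : Ck_on 0 (cod a) (fun x => f (cinv a x) * vol_density g a x).
  split=> // x cx.
  apply: (@continuous_eq_on R _ (cod a)
    (fun x => f (inv a x) * Num.sqrt (\det (coord_tensor g a x)))) => //.
  - exact: cod_open.
  - by move=> y cy; rewrite cinvE // /vol_density indicE mem_set // mulr1.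
  apply: continuousM; first by apply: continuous_comp; [exact: continuous_inv|exact: cf].
  apply: continuous_comp; last exact: sqrt_continuous.
  by have [+ _] := Ck_on_det (@cod_open _ _ M a) (@C0 a); exact.
have [+ _] := Ck_on_extend0 (@cod_open _ _ M a) clK0 K0c C z.
by move=> H x; exact: H.
Qed.

Section Volume.
Variable mu : {measure set (borel M) -> \bar R}.
Hypothesis muV : is_volume g mu.

Lemma integral_compact_support_fin a (K : set M) f : compact K -> K `<=` dom a ->
  continuous f -> (forall p, ~ K p -> f p = 0) ->
  (\int[mu]_p (f p)%:E)%E \is a fin_num.
Proof.
move=> cK Kd cf f0; have [c [B cB]] := chart_support_continuous cK Kd cf f0.
rewrite (integral_chart C0 muV (a := a)) //; last first.
- by move=> p nd; apply: f0 => /Kd.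
- exact: continuous_borelM.
exact: (integrable_fin_num _ (integrable_compact_support c cB)).
Qed.

(** In the chart the integrand is nonnegative and stays above half its value at [p] on a ball, which
    has positive Lebesgue measure. *)
Lemma integral_bump_gt0 a (K : set M) f p : compact K -> K `<=` dom a ->
  continuous f -> (forall p, ~ K p -> f p = 0) -> (forall q, 0 <= f q) -> 0 < f p ->
  (0 < \int[mu]_p (f p)%:E)%E.
Proof.
move=> cK Kd cf f0 fge fp; have [c _] := chart_support_continuous cK Kd cf f0.
rewrite (integral_chart C0 muV (a := a)) //; last first.
- by move=> q nd; apply: f0 => /Kd.
- exact: continuous_borelM.
pose hh x := f (cinv a x) * vol_density g a x.
have dp : dom a p by apply: contrapT => nd; move: fp; rewrite f0 ?ltxx // => /Kd.
have cp := map_cod dp.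
have hp : 0 < hh (map a p).
  by rewrite /hh cinvE // chart_mapK // mulr_gt0 // /vol_density indicE mem_set // mulr1 sqrt_det_gt0.
have hge x : 0 <= hh x by rewrite mulr_ge0 // vol_density_ge0.
have hp2 : 0 < hh (map a p) / 2 by rewrite divr_gt0.
have /nbhs_ballP[e /= e0 eH] : \forall y \near map a p, hh (map a p) / 2 <= hh y.
  have := c (map a p); move=> /cvgrPdist_le /(_ _ hp2).
  apply: filterS => y; rewrite -/(hh _) -/(hh _) => /ler_normlP[_].
  by rewrite lerBlDr -lerBlDl; apply: le_trans; rewrite [X in _ <= X - _]splitr addrK.
have /andP[l0 loo] := lebV_ball (map a p) e0.
have mb : measurable (ball (map a p) e : set (@brV R n)) by exact: ball_measurable.
apply: (@lt_le_trans _ _ ((hh (map a p) / 2)%:E * lebV n (ball (map a p) e))%E).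
  by rewrite mule_gt0.
rewrite -[X in (_ * lebV n X)%E]setIT -(integral_indic (lebV n) measurableT mb).
rewrite -ge0_integralZl //; last 2 first.
- by apply/measurable_EFinP.
- by rewrite lee_fin ltW.
apply: ge0_le_integral => //.
- by move=> y _; rewrite -EFinM lee_fin mulr_ge0 // ltW.
- by apply: emeasurable_funM => //; exact/measurable_EFinP.
- by apply/measurable_EFinP; exact: (continuous_borel c).
- move=> y _; rewrite -EFinM lee_fin indicE.
  by case: (asboolP (ball (map a p) e y)) => yb; rewrite /in_mem /= /in_set; [rewrite asboolT // mulr1; exact: eH|rewrite asboolF // mulr0; exact: hge].
Qed.

(** Around each point, Markov's inequality for a bump function of finite integral bounds the measure
    of the set where it exceeds half its value at the point. Finitely many such sets cover the
    compact manifold. *)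
Lemma finite_volume : (mu setT < +oo)%E.
Proof.
have [aa aaP] := choice (@atlas_cover _ _ M).
have bump p := cid (bump_exists (@dom_open _ _ M (aa p)) (aaP p) (@subset_refl _ _)).
pose psi p := projT1 (bump p).
have psiP p : exists K, [/\ compact K, K `<=` dom (aa p), forall q, 0 <= psi p q,
   0 < psi p p & (forall q, ~ K q -> psi p q = 0) /\ Ck_fun 1 (psi p)] by exact: projT2 (bump p).
have cpsi p : continuous (psi p) by have [K [_ _ _ _ [_]]] := psiP p; exact: continuous_Ck_fun.
pose W p := [set q | psi p p / 2 < psi p q].
have W0 p : 0 < psi p p / 2 by have [K [_ _ _ psi0 _]] := psiP p; rewrite divr_gt0.
have oW p : open (W p).
  have -> : W p = psi p @^-1` [set y | psi p p / 2 < y] by [].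
  by apply: open_comp => [q _|]; [exact: cpsi|exact: open_gt].
have Woo p : (mu (W p) < +oo)%E.
  have [K [cK Kd psige psi0 [psiK _]]] := psiP p.
  have mW : measurable (W p : set (borel M)) by exact: open_borel.
  have : ((psi p p / 2)%:E * mu (W p) < +oo)%E.
    rewrite -[X in (_ * mu X)%E]setIT -(integral_indic mu measurableT mW).
    rewrite -ge0_integralZl //; last 2 first.
    - by apply/measurable_EFinP.
    - by rewrite lee_fin ltW.
    apply: (@le_lt_trans _ _ (\int[mu]_q (psi p q)%:E)%E).
      apply: ge0_le_integral => //.
      - by move=> y _; rewrite -EFinM lee_fin mulr_ge0 // ltW.
      - by apply: emeasurable_funM => //; exact/measurable_EFinP.
      - by apply/measurable_EFinP; exact: continuous_borelM.
      - move=> y _; rewrite -EFinM lee_fin indicE.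
        by case: (asboolP (W p y)) => yb; rewrite /in_mem /= /in_set; [rewrite asboolT // mulr1 ltW|rewrite asboolF // mulr0].
    by rewrite ltey_eq (integral_compact_support_fin cK Kd (cpsi p) psiK).
  by rewrite !ltey; apply: contra => /eqP ->; rewrite gt0_muley // lte_fin.
have Wpp p : W p p.
  by rewrite /W /= ltr_pdivrMr // ltr_pMr ?ltr1n //; have [K [_ _ _ ? _]] := psiP p.
have [s sP] := compact_finite_cover oW Wpp.
have : (mu (\big[setU/set0]_(p <- s) W p) < +oo)%E.
  elim: s {sP} => [|p s IH]; first by rewrite big_nil measure0.
  rewrite big_cons; apply: (le_lt_trans (measureU2 _ _ _)).
  - exact: open_borel.
  - by apply: bigsetU_measurable => q _; exact: open_borel.
  - exact: (lte_add_pinfty (Woo p) IH).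
suff -> : \big[setU/set0]_(p <- s) W p = setT by [].
apply/seteqP; split=> // q _; have [p ps Wpq] := sP q.
by rewrite -bigcup_seq; exists p.
Qed.

Lemma integrable_continuous f : continuous f -> mu.-integrable setT (EFin \o f).
Proof.
move=> cf; apply: (@measurable_bounded_integrable _ (borel M) _ mu f _ measurableT).
- exact: finite_volume.
- exact: continuous_borelM.
have [C _ fC] := continuous_bounded cf.
exists C; split=> [|y Cy p _]; first exact: num_real.
by apply: (le_trans (fC p)); exact: ltW.
Qed.

End Volume.
End RiemannianIntegration.

(** * Green's formula and the Laplacian *)

Section Laplacian.
Context {R : realType} {n : nat} (M : closed_manifold R n).
Local Notation ch := (@chart_of R n M).
Local Notation dom a := (chart_dom (ch a)).
Local Notation cod a := (codom_chart (ch a)).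
Local Notation map a := (chart_map (ch a)).
Local Notation inv a := (chart_inv (ch a)).
Implicit Types (a b : atlas M) (p q : M) (f h phi : M -> R).

Lemma gradpE (G : 'rV[R]_n -> 'M[R]_n) (f h : 'rV[R]_n -> R) x :
  gradp G f h x = ((\row_i partial i f x) *m invmx (G x) *m (\row_i partial i h x)^T) 0 0.
Proof.
rewrite /gradp mxE; under [RHS]eq_bigr do rewrite !mxE mulr_suml.
rewrite [RHS]exchange_big; apply: eq_bigr => i _; rewrite mulr_sumr.
by apply: eq_bigr => m _; rewrite !mxE mulrA.
Qed.

Lemma partial_chart_change f a b p i : Ck_fun 1 f -> dom a p -> dom b p ->
  partial i (f \o inv a) (map a p) =
  \sum_k tjac a b p i k * partial k (f \o inv b) (map b p).
Proof.
move=> Cf da db.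
have oV : open (map a @` (dom b `&` dom a)) by apply: open_image_map; exact: dom_open.
have Vx : (map a @` (dom b `&` dom a)) (map a p) by exists p.
have tE : map b (inv a (map a p)) = map b p by rewrite chart_mapK.
rewrite (@partial_eq_on _ _ _ _ ((f \o inv b) \o (fun y => map b (inv a y))) _ _ oV) //; last first.
  by move=> _ [q [dbq daq] <-]; rewrite /= !chart_mapK.
rewrite partial_comp.
- by rewrite tE; apply: eq_bigr => k _; rewrite mxE.
- rewrite tE; apply: (Ck1_differentiable (@cod_open _ _ M b) (Cf b)); exact: map_cod.
- move=> k; apply: (Ck_on_derivable (atlas_smooth a b k 1)).
  by exists p.
Qed.

Variables (g : tensor2 M).
Hypothesis gM : riemannian_metric 2 g.

(** Differentials transform by the Jacobian [J] through the chain rule, and [g a = J g b J^T] forces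
    [J^T (g a)^-1 J = (g b)^-1]. *)
Lemma gradp_chart_change f h a b p : Ck_fun 1 f -> Ck_fun 1 h -> dom a p -> dom b p ->
  gradp_chart g a f h p = gradp_chart g b f h p.
Proof.
move=> Cf Ch da db; rewrite /gradp_chart !gradpE.
have rowE (u : M -> R) : Ck_fun 1 u ->
    \row_i partial i (u \o inv a) (map a p) =
    (\row_i partial i (u \o inv b) (map b p)) *m (tjac a b p)^T.
  move=> Cu; apply/rowP => i; rewrite !mxE (partial_chart_change i Cu da db).
  by apply: eq_bigr => k _; rewrite !mxE mulrC.
rewrite !rowE //.
have unit c q : dom c q -> g c q \in unitmx.
  move=> dq; rewrite unitmxE unitfE gt_eqF //; apply: posdef_det_gt0.
  exact: (metric_posdef gM dq).
have GE c : dom c p -> coord_tensor g c (map c p) = g c p.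
  by move=> dc; rewrite /coord_tensor chart_mapK.
rewrite !GE //.
set J := tjac a b p.
have T : g a p = J *m g b p *m J^T := metric_tensorial gM da db.
have Ju : J^T \in unitmx.
  have := unit a p da; rewrite unitmx_tr T !unitmx_mul.
  by move=> /andP[/andP[]].
have X : J^T *m invmx (g a p) *m J = invmx (g b p).
  have H : J^T *m invmx (g a p) *m J *m g b p = 1%:M.
    apply: (can_inj (mulmxK Ju)); rewrite mul1mx -!mulmxA.
    rewrite (mulmxA J) -T mulVmx ?mulmx1 //; exact: unit.
  by rewrite -[LHS](mulmxK (unit b p db)) H mul1mx.
by rewrite trmx_mul trmxK -X !mulmxA.
Qed.

Lemma lapl_chart_continuous a f : Ck_fun 2 f -> forall p, dom a p ->
  {for p, continuous (lapl_chart g a f)}.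
Proof.
move=> Cf p dp; apply: continuous_comp; first exact: continuous_map.
apply: (continuous_lapl (@cod_open _ _ M a) (coord_C2 gM a) (@coord_pos _ _ _ _ gM a) (Cf a)).
exact: map_cod.
Qed.

Lemma gradp_chart_continuous a f h : Ck_fun 1 f -> Ck_fun 1 h -> forall p, dom a p ->
  {for p, continuous (gradp_chart g a f h)}.
Proof.
move=> Cf Ch p dp; apply: continuous_comp; first exact: continuous_map.
have oc := @cod_open _ _ M a.
suff C : Ck_on 0 (cod a) (gradp (coord_tensor g a) (f \o inv a) (h \o inv a)).
  exact: (Ck_on_continuous C (map_cod dp)).
apply: Ck_on_sum => // i _; apply: Ck_onM => //; first exact: (Ck_on_partial i (Cf a)).
apply: Ck_on_sum => // m _; apply: Ck_onM => //; last exact: (Ck_on_partial m (Ch a)).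
exact: (Ck_on_le _ (Ck_inverse oc (coord_C2 gM a) (@coord_pos _ _ _ _ gM a) i m)).
Qed.

Lemma gradp_chart0 a (K : set M) phi f p : closed K -> (forall q, ~ K q -> phi q = 0) ->
  dom a p -> ~ K p -> gradp_chart g a phi f p = 0.
Proof.
move=> cK phi0 dp nK; rewrite /gradp_chart /gradp big1 // => i _.
have oV : open (map a @` (~` K `&` dom a)).
  by apply: open_image_map; exact: closed_openC.
rewrite (@partial_eq_on _ _ _ _ (fun=> 0) _ _ oV); first by rewrite partial_cst mul0r.
  by move=> _ [q [nKq dq] <-]; rewrite /= chart_mapK // phi0.
by exists p.
Qed.

Variable mu : {measure set (borel M) -> \bar R}.
Hypothesis muV : is_volume g mu.

(** The divergence of [phi] times the gradient of [f] in the chart [a], extended by 0; for [phi]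
    supported in the chart the extension is continuous. *)
Definition green_fun a phi f p : R :=
  if `[< dom a p >] then phi p * lapl_chart g a f p + gradp_chart g a phi f p else 0.

Section GreenChart.
Variables (a : atlas M) (K : set M) (phi f : M -> R).
Hypotheses (cK : compact K) (Kd : K `<=` dom a) (Cphi : Ck_fun 1 phi)
  (phi0 : forall p, ~ K p -> phi p = 0) (Cf : Ck_fun 2 f).

Lemma Ck_fun_le k l u : (k <= l)%N -> Ck_fun l u -> Ck_fun k (u : M -> R).
Proof. by move=> kl Cu c; exact: (Ck_on_le kl (Cu c)). Qed.

Lemma green_fun0 p : ~ K p -> green_fun a phi f p = 0.
Proof.
move=> nK; rewrite /green_fun; case: asboolP => // dp.
by rewrite phi0 // (gradp_chart0 f (compact_closedM cK) phi0 dp nK) mul0r addr0.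
Qed.

Lemma green_fun_continuous : continuous (green_fun a phi f).
Proof.
have od := @dom_open _ _ M a.
apply: (continuous_extend0M od (compact_closedM cK) Kd); last exact: green_fun0.
move=> p dp.
apply: (@continuous_eq_on R M (dom a)
  (fun q => phi q * lapl_chart g a f q + gradp_chart g a phi f q)) => //.
  by move=> q dq; rewrite /green_fun asboolT.
apply: continuousD; last first.
  by apply: gradp_chart_continuous => //; exact: (Ck_fun_le _ Cf).
apply: continuousM; last exact: lapl_chart_continuous.
exact: (continuous_Ck_fun Cphi).
Qed.

(** Read in the chart, the integrand times the volume density is the coordinate divergence of
    [flux], a C^1 field with compact support, and each partial derivative integrates to 0. *)
Lemma green_chart : (\int[mu]_p (green_fun a phi f p)%:E = 0)%E.
Proof.
have oc := @cod_open _ _ M a.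
have C0 c i j := Ck_on_le (isT : (0 <= 2)%N) (coord_C2 gM c i j).
rewrite (integral_chart C0 muV (a := a)); last 2 first.
- by apply: continuous_borelM; exact: green_fun_continuous.
- by move=> p nd; rewrite /green_fun asboolF.
have [cK0 K0c] := compact_map_image cK Kd.
have clK0 : closed (map a @` K) by apply: compact_closed => //; exact: norm_hausdorff.
pose W i := flux (coord_tensor g a) (phi \o inv a) (f \o inv a) i.
(* [W] has unspecified values outside the image of the chart; its extension by 0 is C^1 on the whole
   space. *)
pose F i x := if `[< cod a x >] then W i x else 0.
have FW i x : cod a x -> F i x = W i x by move=> cx; rewrite /F asboolT.
have F0 i x : ~ (map a @` K) x -> F i x = 0.
  move=> nx; rewrite /F; case: asboolP => // cx; rewrite /W /flux /= phi0 ?mul0r //.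
  by move=> Kx; apply: nx; exists (inv a x) => //; exact: chart_invK.
have CW i : Ck_on 1 (cod a) (W i).
  exact: (Ck_flux oc (coord_C2 gM a) (@coord_pos _ _ _ _ gM a) i (Cphi a) (Cf a)).
have CF i : Ck_on 1 setT (F i).
  apply: (Ck_on_extend0 oc clK0 K0c) (F0 i).
  by apply: (Ck_on_eq oc) (CW i) => x cx; rewrite FW.
have onK : open (~` (map a @` K)) by exact: closed_openC.
have pF0 i j x : ~ (map a @` K) x -> partial j (F i) x = 0.
  move=> nx; rewrite (@partial_eq_on _ _ _ _ (fun=> 0) _ _ onK) ?partial_cst //.
  by move=> y ny; rewrite F0.
have cpF i : continuous (partial i (F i)).
  by move=> x; exact: (Ck_on_continuous (Ck_on_partial i (CF i)) (I : setT x)).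
have [B HB] := compact_norm_bound cK0.
have E x : green_fun a phi f (cinv a x) * vol_density g a x = \sum_i partial i (F i) x.
  have [cx|ncx] := pselect (cod a x); last first.
    rewrite /vol_density indicE memNset // !mulr0 big1 // => i _.
    by apply: pF0 => /K0c.
  rewrite /vol_density indicE mem_set // mulr1 cinvE // /green_fun asboolT; last exact: inv_dom.
  rewrite /lapl_chart /gradp_chart chart_invK //.
  under eq_bigr do rewrite (@partial_eq_on _ _ _ _ (W _) _ _ oc (FW _) cx).
  rewrite (divergence_flux oc (coord_C2 gM a) (@coord_sym _ _ _ _ gM a) (@coord_pos _ _ _ _ gM a) cx (Cphi a) (Cf a)).
  by rewrite mulrC.
under eq_integral do rewrite E -sumEFin.
rewrite integral_sum //=; last first.
  move=> i; apply: (integrable_compact_support (cpF i)) => x /HB; exact: pF0.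
rewrite big1 // => i _; apply: (@integral_partial0 _ _ i B (F i)) => //.
- by move=> x; apply: derivableP; exact: (Ck_on_derivable (CF i) (I : setT x)).
- by move=> x /HB; exact: F0.
- by move=> x /HB; exact: pF0.
Qed.

End GreenChart.

(* If the inequality failed at [p], it would fail on an open set; testing
   Green's formula in both charts against a bump function supported there gives
   a contradiction. *)
Lemma lapl_chart_le f a b p : Ck_fun 2 f -> dom a p -> dom b p ->
  lapl_chart g a f p <= lapl_chart g b f p.
Proof.
move=> Cf da db; rewrite leNgt; apply/negP => ltp.
have Cf1 := Ck_fun_le (isT : (1 <= 2)%N) Cf.
pose D q := lapl_chart g a f q - lapl_chart g b f q.
pose W := (dom a `&` dom b) `&` D @^-1` [set y | 0 < y].
have oD : open (dom a `&` dom b) by apply: openI; exact: dom_open.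
have oW : open W.
  apply: (open_preimage_on oD (@open_gt _ 0)) => q [qa qb].
  by apply: continuousB; exact: lapl_chart_continuous.
have Wp : W p by split; [|rewrite /= /D subr_gt0].
have Wa : W `<=` dom a by move=> q [[]].
have Wb : W `<=` dom b by move=> q [[]].
have [psi [K [cK KW psige psip [psi0 Cpsi]]]] := bump_exists oW Wp Wa.
have Ka := subset_trans KW Wa; have Kb := subset_trans KW Wb.
have ca := green_fun_continuous cK Ka Cpsi psi0 Cf.
have cb := green_fun_continuous cK Kb Cpsi psi0 Cf.
pose F q := green_fun a psi f q - green_fun b psi f q.
have F0 q : ~ K q -> F q = 0.
  move=> nK; have Z c : green_fun c psi f q = 0 by exact: (green_fun0 c f cK psi0 nK).
  by rewrite /F !Z subrr.
have FE q : K q -> F q = psi q * D q.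
  move=> /KW[[qa qb] _]; rewrite /F /green_fun !asboolT //.
  by rewrite (gradp_chart_change Cpsi Cf1 qa qb) /D; ring.
have cF : continuous F by move=> q; apply: continuousB; [exact: ca|exact: cb].
have Fge q : 0 <= F q.
  have [Kq|nK] := pselect (K q); last by rewrite F0.
  by rewrite FE // mulr_ge0 //; have [_ /ltW] := KW _ Kq.
have Kp : K p by apply: contrapT => nK; move: psip; rewrite psi0 // ltxx.
have Fp : 0 < F p by rewrite FE // mulr_gt0 //; case: Wp.
have := integral_bump_gt0 gM muV cK Ka cF F0 Fge Fp.
have ia := integrable_continuous gM muV ca.
have ib := integrable_continuous gM muV cb.
have -> : (\int[mu]_p (F p)%:E =
   \int[mu]_p ((green_fun a psi f p)%:E - (green_fun b psi f p)%:E))%E.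
  by apply: eq_integral => q _; rewrite /F EFinB.
rewrite integralB //.
by rewrite (green_chart cK Ka Cpsi psi0 Cf) (green_chart cK Kb Cpsi psi0 Cf) subee // ltxx.
Qed.

Lemma lapl_chart_change f a b p : Ck_fun 2 f -> dom a p -> dom b p ->
  lapl_chart g a f p = lapl_chart g b f p.
Proof. by move=> Cf da db; apply/eqP; rewrite eq_le !lapl_chart_le. Qed.

End Laplacian.

(** * The global Laplacian and the sign of its quadratic form *)

Section GlobalLaplacian.
Context {R : realType} {n : nat} (M : closed_manifold R n).
Local Notation ch := (@chart_of R n M).
Local Notation dom a := (chart_dom (ch a)).
Local Notation cod a := (codom_chart (ch a)).
Local Notation map a := (chart_map (ch a)).
Local Notation inv a := (chart_inv (ch a)).
Implicit Types (a b : atlas M) (p q : M) (f h phi : M -> R).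

Definition chart_at p : atlas M := projT1 (cid (atlas_cover p)).

Lemma chart_atP p : dom (chart_at p) p.
Proof. exact: (projT2 (cid (atlas_cover p))). Qed.

Definition laplacian (g : tensor2 M) f p : R := lapl_chart g (chart_at p) f p.

(** Finitely many bumps whose positivity sets cover the manifold, divided by their sum. The sum is
    positive everywhere, so the quotients remain C^1. *)
Lemma partition_of_unity : exists (m : nat) (chi : 'I_m -> M -> R)
    (a : 'I_m -> atlas M) (K : 'I_m -> set M),
  (forall k, [/\ compact (K k), K k `<=` dom (a k), Ck_fun 1 (chi k) &
                 forall p, ~ K k p -> chi k p = 0]) /\
  forall p, \sum_k chi k p = 1.
Proof.
have bump p := cid (bump_exists (@dom_open _ _ M (chart_at p)) (chart_atP p) (@subset_refl _ _)).
pose psi p := projT1 (bump p).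
have bump2 p := cid (projT2 (bump p)).
pose K p := projT1 (bump2 p).
have psiP p : [/\ compact (K p), K p `<=` dom (chart_at p), forall q, 0 <= psi p q,
   0 < psi p p & (forall q, ~ K p q -> psi p q = 0) /\ Ck_fun 1 (psi p)] by exact: projT2 (bump2 p).
have Cpsi p : Ck_fun 1 (psi p) by have [_ _ _ _ []] := psiP p.
have psige p q : 0 <= psi p q by have [_ _ + _ _] := psiP p; exact.
pose W p := [set q | 0 < psi p q].
have oW p : open (W p).
  have -> : W p = psi p @^-1` [set y | 0 < y] by [].
  by apply: open_comp => [q _|]; [exact: (continuous_Ck_fun (Cpsi p))|exact: open_gt].
have Wpp p : W p p by rewrite /W /=; have [_ _ _ ? _] := psiP p.
have [s sP] := compact_finite_cover oW Wpp.
pose c (k : 'I_(size s)) := nth point s k.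
pose Psi q := \sum_k psi (c k) q.
have Psi0 q : 0 < Psi q.
  have [p ps Wpq] := sP q.
  have ip : (index p s < size s)%N by rewrite index_mem.
  rewrite /Psi (bigD1 (Ordinal ip)) //= ltr_pwDl ?sumr_ge0 //.
  by rewrite /c /= nth_index.
have CPsi : Ck_fun 1 Psi.
  by move=> b; apply: (Ck_on_sum (@cod_open _ _ M b)) => k _; exact: Cpsi.
exists (size s), (fun k q => psi (c k) q / Psi q), (fun k => chart_at (c k)), (fun k => K (c k)).
split=> [k|q]; last by rewrite -mulr_suml -/(Psi q) mulfV // gt_eqF // Psi0.
have [? ? _ _ [psi0 _]] := psiP (c k); split=> //.
  move=> b; have ob := @cod_open _ _ M b; apply: (Ck_onM ob (Cpsi (c k) b)).
  by apply: (Ck_onV ob _ (CPsi b)) => x _; exact: Psi0.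
by move=> q nK; rewrite psi0 // mul0r.
Qed.

Variables (g : tensor2 M).
Hypothesis gM : riemannian_metric 2 g.
Variable mu : {measure set (borel M) -> \bar R}.
Hypothesis muV : is_volume g mu.

Lemma laplacianE f a p : Ck_fun 2 f -> dom a p -> laplacian g f p = lapl_chart g a f p.
Proof. by move=> Cf dp; apply: (lapl_chart_change gM muV Cf) => //; exact: chart_atP. Qed.

Lemma laplacian_continuous f : Ck_fun 2 f -> continuous (laplacian g f).
Proof.
move=> Cf p; have dp := chart_atP p.
apply: (@continuous_eq_on R M (dom (chart_at p)) (lapl_chart g (chart_at p) f)) => //.
- exact: dom_open.
- by move=> q dq; rewrite (laplacianE Cf dq).
- exact: lapl_chart_continuous.
Qed.

(** The inverse metric evaluated on a covector is the metric evaluated on the raised vector. *)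
Lemma gradp_ge0 a f p : dom a p -> 0 <= gradp_chart g a f f p.
Proof.
move=> dp; rewrite /gradp_chart gradpE; have cp := map_cod dp.
set d := \row_i _; set G := coord_tensor g a (map a p).
have Gu : G \in unitmx := metric_unit (@coord_pos _ _ _ _ gM a) cp.
have Gs : G^T = G := coord_sym gM cp.
have -> : (d *m invmx G *m d^T) = (d *m invmx G) *m G *m (d *m invmx G)^T.
  by rewrite trmx_mul trmx_inv Gs mulmxA mulmxKV.
have [->|w0] := eqVneq (d *m invmx G) 0; first by rewrite mul0mx mul0mx mxE.
exact: ltW (coord_pos gM cp w0).
Qed.

(** Green's formula with test function [v]: cutting [v] into the pieces [chi k * v] puts each test
    function into one chart, and summing the chart formulas leaves the integrand plus the
    nonnegative square of the gradient, with total integral 0. *)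
Lemma integral_mul_laplacian_le0 v : Ck_fun 2 v ->
  (\int[mu]_p (v p * laplacian g v p)%:E <= 0)%E.
Proof.
move=> Cv; have Cv1 := Ck_fun_le (isT : (1 <= 2)%N) Cv.
have [m [chi [a [K [H sumchi]]]]] := partition_of_unity.
pose phi k q := chi k q * v q.
have Cphi k : Ck_fun 1 (phi k).
  have [_ _ Cc _] := H k.
  by move=> b; exact: (Ck_onM (@cod_open _ _ M b) (Cc b) (Cv1 b)).
have phi0 k q : ~ K k q -> phi k q = 0.
  by have [_ _ _ c0] := H k; move=> nK; rewrite /phi c0 // mul0r.
have cG k : continuous (green_fun g (a k) (phi k) v).
  by have [cK Kd _ _] := H k; exact: (green_fun_continuous gM cK Kd (Cphi k) (phi0 k) Cv).
have G0 k : (\int[mu]_p (green_fun g (a k) (phi k) v p)%:E = 0)%E.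
  by have [cK Kd _ _] := H k; exact: (green_chart gM muV cK Kd (Cphi k) (phi0 k) Cv).
(* Each piece is rewritten in the chart [chart_at p], which is independent of [k], so that the
   gradient terms can be added up. Off the domain of [a k] both sides vanish. *)
have GE k p : green_fun g (a k) (phi k) v p =
   phi k p * laplacian g v p + gradp_chart g (chart_at p) (phi k) v p.
  have [cK Kd _ _] := H k.
  have [dp|ndp] := pselect (dom (a k) p).
    rewrite /green_fun asboolT // (laplacianE Cv dp).
    by rewrite (gradp_chart_change gM (Cphi k) Cv1 dp (chart_atP p)).
  have nK : ~ K k p by move=> /Kd.
  rewrite /green_fun asboolF // phi0 // mul0r add0r.
  by rewrite (gradp_chart0 g v (compact_closedM cK) (phi0 k) (chart_atP p) nK).
have sumphi q : \sum_k phi k q = v q by rewrite -mulr_suml sumchi mul1r.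
have sumG p : \sum_k green_fun g (a k) (phi k) v p =
   v p * laplacian g v p + gradp_chart g (chart_at p) v v p.
  under eq_bigr do rewrite GE.
  rewrite big_split /= -mulr_suml sumphi; congr (_ + _).
  rewrite /gradp_chart /gradp exchange_big; apply: eq_bigr => i _ /=.
  rewrite -mulr_suml; congr (_ * _); have cp := map_cod (chart_atP p).
  rewrite -partial_sum; last by move=> k; exact: (Ck_on_derivable (Cphi k _) cp).
  congr (partial i _ _); apply/funext => x /=; exact: sumphi.
have iG k := integrable_continuous gM muV (cG k).
apply: (@le_trans _ _ (\int[mu]_p (\sum_k green_fun g (a k) (phi k) v p)%:E)%E).
  apply: le_integral => //.
  - apply: (integrable_continuous gM muV) => p.
    apply: continuousM; [exact: (continuous_Ck_fun Cv)|exact: laplacian_continuous].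
  - apply: (integrable_continuous gM muV) => p.
    by apply: continuous_at_sum => k; exact: cG.
  - move=> p _; rewrite lee_fin sumG lerDl; exact: (gradp_ge0 v (chart_atP p)).
under eq_integral do rewrite -sumEFin.
by rewrite integral_sum // big1.
Qed.

End GlobalLaplacian.

(** * Conformal change on the manifold *)

Section ConformalChange.
Context {R : realType} {n : nat} (M : closed_manifold R n).
Hypothesis n_ge3 : (3 <= n)%N.
Local Notation ch := (@chart_of R n M).
Local Notation dom a := (chart_dom (ch a)).
Local Notation cod a := (codom_chart (ch a)).
Local Notation map a := (chart_map (ch a)).
Local Notation inv a := (chart_inv (ch a)).
Implicit Types (a b : atlas M) (p q : M) (f h v : M -> R) (g : tensor2 M).

Let n2_gt0 : 0 < n%:R - 2 :> R.
Proof. by rewrite subr_gt0 ltr_nat. Qed.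

Let n2_neq0 : n%:R - 2 != 0 :> R.
Proof. by rewrite gt_eqF. Qed.

Lemma Ck_fun_mul k f h : Ck_fun k f -> Ck_fun k h -> Ck_fun k (fun p => f p * h p).
Proof. by move=> Cf Ch a; exact: (Ck_onM (@cod_open _ _ M a) (Cf a) (Ch a)). Qed.

Lemma Ck_fun_powR k (r : R) f : (forall p, 0 < f p) -> Ck_fun k f ->
  Ck_fun k (fun p => f p `^ r).
Proof.
by move=> f0 Cf a; apply: (Ck_on_powR (@cod_open _ _ M a) r _ (Cf a)) => x _; exact: f0.
Qed.

Lemma Ck_fun_inv k f : (forall p, 0 < f p) -> Ck_fun k f -> Ck_fun k (fun p => (f p)^-1).
Proof.
by move=> f0 Cf a; apply: (Ck_onV (@cod_open _ _ M a) _ (Cf a)) => x _; exact: f0.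
Qed.

Lemma conformal_comp u v g : (forall p, 0 < u p) -> (forall p, 0 < v p) ->
  conformal u (conformal v g) = conformal (fun p => u p * v p) g.
Proof.
move=> u0 v0; apply/funext => a; apply/funext => p.
by rewrite /conformal scalerA powRM ?ltW.
Qed.

Lemma conformal1 g : conformal (fun=> 1) g = g.
Proof.
apply/funext => a; apply/funext => p.
by rewrite /conformal powR1 scale1r.
Qed.

(** Being conformal is a symmetric relation; this is how volumes and scalar curvatures are carried
    back to the original metric. *)
Lemma conformalK v g : (forall p, 0 < v p) ->
  conformal (fun p => (v p)^-1) (conformal v g) = g.
Proof.
move=> v0; rewrite conformal_comp // => [|p]; last by rewrite invr_gt0.
rewrite -[RHS]conformal1; congr conformal; apply/funext => p.
by rewrite mulVf // gt_eqF.
Qed.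

Lemma conformal_metric v g : Ck_fun 2 v -> (forall p, 0 < v p) ->
  riemannian_metric 2 g -> riemannian_metric 2 (conformal v g).
Proof.
move=> Cv v0 gM; split.
- move=> a i j; have oc := @cod_open _ _ M a.
  have C := Ck_onM oc (Ck_fun_powR (4 / (n%:R - 2)) v0 Cv a) (metric_Ck gM a i j).
  by apply: (Ck_on_eq oc) C => x _; rewrite /coord_tensor /conformal mxE.
- by move=> a p dp; rewrite /conformal linearZ /= (Defs.metric_sym gM dp).
- move=> a p dp w w0; rewrite /conformal /quad -scalemxAr -scalemxAl mxE.
  by rewrite mulr_gt0 ?powR_gt0 //; exact: (metric_posdef gM dp).
- move=> a b p da db; rewrite /conformal (metric_tensorial gM da db).
  by rewrite -scalemxAr -scalemxAl.
Qed.

Lemma scalar_curvatureE g S : is_scalar_curvature g S -> scalar_curvature g = S.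
Proof.
move=> gS; apply: xget_unique => // S' gS'; apply/funext => p.
have [a dp] := atlas_cover p.
by rewrite (gS a p dp) (gS' a p dp).
Qed.

Lemma scalar_curvature_junk g : (forall S, ~ is_scalar_curvature g S) ->
  scalar_curvature g = fun=> 0.
Proof. by move=> nS; exact: xgetPN. Qed.

Lemma is_scalar_curvature_continuous g S : riemannian_metric 2 g ->
  is_scalar_curvature g S -> continuous S.
Proof.
move=> gM gS p; have [a dp] := atlas_cover p.
have oc := @cod_open _ _ M a.
have C2 := coord_C2 gM a; have pos := @coord_pos _ _ _ _ gM a.
apply: (@continuous_eq_on R M (dom a) (local_scalar (coord_tensor g a) \o map a)).
- exact: dom_open.
- by move=> q dq; rewrite (gS a q dq).
- exact: dp.
apply: continuous_comp; first exact: continuous_map.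
suff C : Ck_on 0 (cod a) (local_scalar (coord_tensor g a)).
  exact: (Ck_on_continuous C (map_cod dp)).
have Cc k i j := Ck_christoffel oc C2 pos k i j.
have Cc0 k i j := Ck_on_le (isT : (0 <= 1)%N) (Cc k i j).
apply: Ck_on_sum => // j _; apply: Ck_on_sum => // k _; apply: Ck_onM => //.
  exact: (Ck_on_le _ (Ck_inverse oc C2 pos j k)).
apply: Ck_on_sum => // i _; apply: Ck_onD => //.
  by apply: Ck_onB => //; exact: Ck_on_partial.
by apply: Ck_on_sum => // m _; apply: Ck_onB => //; exact: Ck_onM.
Qed.

Section Volume.
Variables (g : tensor2 M) (mu : {measure set (borel M) -> \bar R}).
Hypotheses (gM : riemannian_metric 2 g) (muV : is_volume g mu).

(** [conformal_scalar] in every chart, with [b = 2/(n-2)]. The local formulas fit together into one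
    function because [S] does and the Laplacian agrees in all charts. *)
Lemma conformal_is_scalar_curvature v S : Ck_fun 2 v -> (forall p, 0 < v p) ->
  is_scalar_curvature g S ->
  is_scalar_curvature (conformal v g) (fun p => (v p `^ (4 / (n%:R - 2)))^-1 *
    (S p - 4 * (n%:R - 1) / (n%:R - 2) * laplacian g v p / v p)).
Proof.
move=> Cv v0 gS a p dp.
have oc := @cod_open _ _ M a.
have := @conformal_scalar _ _ (cod a) (coord_tensor g a) oc (coord_C2 gM a)
  (@coord_sym _ _ _ _ gM a) (@coord_pos _ _ _ _ gM a) (v \o inv a) (2 / (n%:R - 2)) (Cv a)
  (fun x _ => v0 _) (map a p) (map_cod dp).
have -> : 2 * (2 / (n%:R - 2)) = 4 / (n%:R - 2) :> R by field.
move=> /(_ (divfK n2_neq0 2)) E.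
rewrite -[RHS]/(local_scalar (fun y => (v \o inv a) y `^ (4 / (n%:R - 2)) *: coord_tensor g a y) (map a p)).
rewrite E /= chart_mapK // (gS a p dp) (laplacianE gM muV Cv dp) /lapl_chart.
congr (_ * (_ - _)); congr (_ * _ / _); field.
by rewrite n2_neq0.
Qed.

Lemma sqrt_det_conformal v a x : 0 < v (inv a x) ->
  Num.sqrt (\det (coord_tensor (conformal v g) a x)) =
  v (inv a x) `^ (2 * n%:R / (n%:R - 2)) * Num.sqrt (\det (coord_tensor g a x)).
Proof.
move=> v0; rewrite /coord_tensor /conformal detZ sqrtrM; last first.
  by rewrite exprn_ge0 // powR_ge0.
(* Scaling the matrix multiplies the determinant by the [n]-th power, and the root halves it:
   [(4/(n-2)) n / 2 = 2n/(n-2)]. *)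
congr (_ * _); rewrite -powR_mulrn ?powR_ge0 // -powR12_sqrt ?powR_ge0 // -!powRrM.
by congr (_ `^ _); field.
Qed.

Lemma vol_density_conformal v a x : (forall p, 0 < v p) ->
  vol_density (conformal v g) a x =
  v (cinv a x) `^ (2 * n%:R / (n%:R - 2)) * vol_density g a x.
Proof.
move=> v0; rewrite /vol_density indicE.
have [cx|ncx] := pselect (cod a x); last by rewrite memNset // !mulr0.
by rewrite mem_set // !mulr1 cinvE // sqrt_det_conformal.
Qed.

Lemma indic_chart_image a (A : set M) x : A `<=` dom a ->
  \1_(map a @` A) x = \1_A (cinv a x) * \1_(cod a) x :> R.
Proof.
move=> Ad; rewrite !indicE -natrM mulnb.
congr (_%:R); congr nat_of_bool; apply/idP/idP; rewrite !inE.
  move=> [p Ap <-]; have dp := Ad _ Ap; have cp := map_cod dp.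
  by apply/andP; split; rewrite inE // cinvE // chart_mapK.
move=> /andP[]; rewrite !inE => Ax cx; rewrite cinvE // in Ax.
by exists (inv a x); rewrite ?chart_invK.
Qed.

(** The witness is the measure with density [v^(2n/(n-2))] with respect to [mu]. *)
Lemma conformal_volume_exists v : Ck_fun 2 v -> (forall p, 0 < v p) ->
  exists nu : {measure set (borel M) -> \bar R}, is_volume (conformal v g) nu.
Proof.
move=> Cv v0.
pose rho p := v p `^ (2 * n%:R / (n%:R - 2)).
have crho : continuous rho := continuous_Ck_fun (Ck_fun_powR _ v0 Cv).
have mrho := continuous_borelM crho.
have [nu nuE] := density_measure mu mrho (fun p => powR_ge0 _ _).
have C0 c i j := Ck_on_le (isT : (0 <= 2)%N) (coord_C2 gM c i j).
exists nu => a A mA Ad; rewrite nuE //.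
have mf : measurable_fun setT (fun p : borel M => \1_A p * rho p : R).
  by apply: measurable_funM.
under eq_integral do rewrite -EFinM.
rewrite (integral_chart C0 muV (a := a) mf); last first.
  by move=> p nd; rewrite indicE memNset ?mul0r // => /Ad.
have E x : Num.sqrt (\det (coord_tensor (conformal v g) a x)) * \1_(map a @` A) x =
    \1_A (cinv a x) * rho (cinv a x) * vol_density g a x.
  rewrite indic_chart_image // mulrCA -/(vol_density (conformal v g) a x).
  by rewrite vol_density_conformal // mulrA.
rewrite integral_rV_lebV.
- by apply: eq_integral => x _; rewrite E.
- apply/measurable_EFinP; under eq_fun do rewrite E.
  apply: measurable_funM; last exact: (measurable_vol_density C0).
  exact: (measurableT_comp mf (measurable_cinv a)).
- by move=> x; rewrite lee_fin mulr_ge0 // sqrtr_ge0.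
Qed.

(** Both integrals are cut by a partition of unity and compared chart by chart, where the densities
    differ by the stated factor. The formula thus applies to whichever measure [volume] has
    selected. *)
Lemma integral_conformal v f (nu : {measure set (borel M) -> \bar R}) :
  Ck_fun 2 v -> (forall p, 0 < v p) -> is_volume (conformal v g) nu -> continuous f ->
  (\int[nu]_p (f p)%:E = \int[mu]_p (f p * v p `^ (2 * n%:R / (n%:R - 2)))%:E)%E.
Proof.
move=> Cv v0 nuV cf.
have vM := conformal_metric Cv v0 gM.
pose rho p := v p `^ (2 * n%:R / (n%:R - 2)).
have crho : continuous rho := continuous_Ck_fun (Ck_fun_powR _ v0 Cv).
have C0 c i j := Ck_on_le (isT : (0 <= 2)%N) (coord_C2 gM c i j).
have C0' c i j := Ck_on_le (isT : (0 <= 2)%N) (coord_C2 vM c i j).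
have [m [chi [a [K [H sumchi]]]]] := partition_of_unity M.
have cchi k : continuous (chi k) by have [_ _ Cc _] := H k; exact: (continuous_Ck_fun Cc).
have cfk k : continuous (fun p => chi k p * f p).
  by move=> p; exact: (continuousM (cchi k p) (cf p)).
have cfr k : continuous (fun p => chi k p * f p * rho p).
  by move=> p; exact: (continuousM (cfk k p) (crho p)).
have z k p : ~ dom (a k) p -> chi k p = 0.
  by have [_ Kd _ c0] := H k; move=> nd; apply: c0 => /Kd.
have L p : f p = \sum_k chi k p * f p by rewrite -mulr_suml sumchi mul1r.
transitivity (\int[nu]_p (\sum_k (chi k p * f p)%:E))%E.
  by apply: eq_integral => p _; rewrite sumEFin -L.
transitivity (\int[mu]_p (\sum_k (chi k p * f p * rho p)%:E))%E; last first.
  by apply: eq_integral => p _; rewrite sumEFin -mulr_suml -L.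
rewrite integral_sum //; last by move=> k; exact: (integrable_continuous vM nuV (cfk k)).
rewrite integral_sum //; last by move=> k; exact: (integrable_continuous gM muV (cfr k)).
apply: eq_bigr => k _.
rewrite (integral_chart C0' nuV (a := a k)); last 2 first.
- exact: (continuous_borelM (cfk k)).
- by move=> p nd; rewrite z ?mul0r.
rewrite (integral_chart C0 muV (a := a k)); last 2 first.
- exact: (continuous_borelM (cfr k)).
- by move=> p nd; rewrite z ?mul0r.
by apply: eq_integral => x _; rewrite vol_density_conformal // mulrA.
Qed.

End Volume.

Lemma volumeP g : (exists mu, is_volume g mu) -> is_volume g (volume g).
Proof. by rewrite /volume => gV; case: xgetP => // nV; case: gV => mu /nV. Qed.

Lemma total_scalar_no_volume g : (forall mu, ~ is_volume g mu) -> total_scalar g = 0.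
Proof.
move=> nV; rewrite /total_scalar.
rewrite /volume; case: xgetP => [mu _ /nV //|_].
by rewrite /Rintegral integral_measure_zero.
Qed.

Lemma total_scalar_no_curvature g : (forall S, ~ is_scalar_curvature g S) -> total_scalar g = 0.
Proof.
move=> /scalar_curvature_junk nS; rewrite /total_scalar nS.
by rewrite /Rintegral integral0.
Qed.

End ConformalChange.

(** * Lower semicontinuity of the total scalar curvature *)

Section ContinuousFunctions.
Context {R : realType} {T : topologicalType}.
Implicit Types (f h : T -> R).

Lemma continuous_scale (c : R) f : continuous f -> continuous (fun p => c * f p).
Proof. by move=> cf p; exact: (continuousM (@cst_continuous _ _ c p) (cf p)). Qed.

Lemma continuous_sum f h : continuous f -> continuous h -> continuous (fun p => f p + h p).
Proof. by move=> cf ch p; exact: (continuousD (cf p) (ch p)). Qed.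

Lemma continuous_subr (c : R) f : continuous f -> continuous (fun p => f p - c).
Proof. by move=> cf p; exact: (continuousB (cf p) (@cst_continuous _ _ c p)). Qed.

(* The absolute value matters: [powR] is 1 on negative numbers. *)
Lemma continuous_norm_powR (r : R) f : 0 < r -> continuous f ->
  continuous (fun p => `|f p| `^ r).
Proof.
move=> r0 cf p; have cn : {for p, continuous (fun p => `|f p|)}.
  exact: (continuous_comp (cf p) (@norm_continuous _ _ (f p))).
have [fp0|fpn0] := eqVneq (f p) 0; last first.
  apply: (@continuous_comp _ _ _ (fun p => `|f p|) (fun x => x `^ r)) => //.
  apply: differentiable_continuous; apply/derivable1_diffP.
  by apply: derivable_powR; rewrite in_itv /= normr_gt0 fpn0.
apply/(@cvgrPdist_le _ R^o) => e e0; rewrite fp0 normr0 powR0 ?gt_eqF //.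
have er0 : 0 < e `^ r^-1 by exact: powR_gt0.
have : (fun q => `|f q|) @ p --> `|f p| := cn.
rewrite fp0 normr0 => /(@cvgrPdist_le _ R^o) /(_ _ er0).
apply: filterS => x; rewrite !sub0r !normrN normr_id => xe.
rewrite ger0_norm ?powR_ge0 // (le_trans (ge0_ler_powR (ltW r0) _ _ xe)) ?nnegrE ?powR_ge0 //.
by rewrite -powRrM mulVf ?gt_eqF // powRr1 // ltW.
Qed.

End ContinuousFunctions.

(** * Lower bound and semicontinuity around a base metric *)

Section Semicontinuity.
Context {R : realType} {n : nat} (M : closed_manifold R n).
Hypothesis n_ge3 : (3 <= n)%N.
Implicit Types (p : M) (f v : M -> R) (g : tensor2 M).
Local Notation qexp := (2 * n%:R / (n%:R - 2) : R).

Let n2_gt0 : 0 < n%:R - 2 :> R.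
Proof. by rewrite subr_gt0 ltr_nat. Qed.

Let n2_neq0 : n%:R - 2 != 0 :> R.
Proof. by rewrite gt_eqF. Qed.

Lemma qexp_ge2 : 2 <= qexp.
Proof.
rewrite ler_pdivlMr // ler_pM2l // lerBlDr lerDl //.
Qed.

Section Base.
Variables (g : tensor2 M) (S : M -> R).
Hypotheses (gM : riemannian_metric 2 g) (gS : is_scalar_curvature g S)
  (gV : is_volume g (volume g)).
Local Notation mu := (volume g).

Let iC f (cf : continuous f) := integrable_continuous gM gV cf.

(** After the conformal law and the change of volume, the difference of the two sides is [-c] times
    the integral of [v] times its Laplacian, which is nonnegative. *)
Lemma total_scalar_conformal_ge v : Ck_fun 2 v -> (forall p, 0 < v p) ->
  \int[mu]_(p in [set: borel M]) (S p * v p ^+ 2) <= total_scalar (conformal v g).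
Proof.
move=> Cv v0.
have vM := conformal_metric Cv v0 gM.
have vV := volumeP (conformal_volume_exists n_ge3 gM gV Cv v0).
have vS := conformal_is_scalar_curvature n_ge3 gM gV Cv v0 gS.
have cS := is_scalar_curvature_continuous gM gS.
have cSv := is_scalar_curvature_continuous vM vS.
have cv := continuous_Ck_fun Cv.
have cl := laplacian_continuous gM gV Cv.
have cSv2 : continuous (fun p => S p * v p ^+ 2).
  rewrite (_ : (fun p => _) = (fun p => S p * (v p * v p))).
    by move=> p; exact: (continuousM (cS p) (continuousM (cv p) (cv p))).
  by apply/funext => p; rewrite expr2.
have cvl : continuous (fun p => v p * laplacian g v p).
  by move=> p; exact: (continuousM (cv p) (cl p)).
pose c : R := 4 * (n%:R - 1) / (n%:R - 2).
have c0 : 0 <= c.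
  by rewrite divr_ge0 ?(ltW n2_gt0) // mulr_ge0 // subr_ge0 ler1n (leq_trans _ n_ge3).
rewrite /total_scalar (scalar_curvatureE vS) [leRHS]/Rintegral.
rewrite (integral_conformal n_ge3 gM gV Cv v0 vV cSv).
have E p : (v p `^ (4 / (n%:R - 2)))^-1 * (S p - c * laplacian g v p / v p) * v p `^ qexp =
    S p * v p ^+ 2 - c * (v p * laplacian g v p).
  (* The power of the volume exceeds that of the curvature by exactly 2, which leaves [v^2]. *)
  have -> : qexp = 4 / (n%:R - 2) + 2%:R by field.
  have vp0 : v p != 0 by rewrite gt_eqF.
  rewrite powRD ?vp0 ?implybT // powR_mulrn ?ltW //.
  have : v p `^ (4 / (n%:R - 2)) != 0 by rewrite gt_eqF // powR_gt0.
  move: (v p `^ _) (S p) (laplacian g v p) => w s l w0; field.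
  by rewrite vp0 w0.
under eq_integral do rewrite E.
rewrite -[leRHS]/(\int[mu]_(p in [set: borel M]) (S p * v p ^+ 2 - c * (v p * laplacian g v p))).
rewrite RintegralB //; [|exact: (iC cSv2)|]; last first.
  exact: (iC (continuous_scale cvl)).
rewrite RintegralZl //; last exact: (iC cvl).
rewrite lerBrDr gerDl mulr_ge0_le0 //.
exact: (fine_le0 (integral_mul_laplacian_le0 gM gV Cv)).
Qed.

(* For [t = |v - 1|] the left-hand side bounds [|v^2 - 1|]. *)
Lemma linear_quadratic_le_powR (t e r : R) : 0 <= t -> 0 < e <= 1 -> 2 <= r ->
  2 * t + t ^+ 2 <= 3 * e + 3 * e / e `^ r * t `^ r.
Proof.
move=> t0 /andP[e0 e1] r2.
have er0 : 0 < e `^ r by exact: powR_gt0.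
(* For [t <= e <= 1] already [2t + t^2 <= 3e]. For [t > e] put [s = t/e]: then
   [1 <= s <= s^2 <= s^r], and each term is bounded by a multiple of [e s^r]. *)
have [te|et] := leP t e.
  apply: (@le_trans _ _ (3 * e)).
    have : t * t <= e * 1 by apply: ler_pM => //; exact: le_trans te e1.
    by rewrite expr2 mulr1; lra.
  by rewrite lerDl mulr_ge0 ?powR_ge0 // divr_ge0 ?(ltW er0) // mulr_ge0 // ltW.
have te1 : 1 <= t / e by rewrite ler_pdivlMr // mul1r ltW.
have H2 : (t / e) ^+ 2 <= (t / e) `^ r.
  by rewrite -powR_mulrn ?(le_trans ler01 te1) //; exact: ler_powR.
have H1 : t / e <= (t / e) ^+ 2 by rewrite expr2 ler_peMl // (le_trans ler01 te1).
have tE : t = e * (t / e) by rewrite mulrC divfK ?gt_eqF.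
have rE : 3 * e / e `^ r * t `^ r = 3 * e * (t / e) `^ r.
  rewrite {1}tE powRM ?(ltW e0) ?(le_trans ler01 te1) //.
  by rewrite mulrA divfK ?gt_eqF.
rewrite rE; apply: (@le_trans _ _ (3 * e * (t / e) `^ r)); last by rewrite lerDr mulr_ge0 // ltW.
apply: (@le_trans _ _ (3 * e * (t / e) ^+ 2)); last by rewrite ler_wpM2l // mulr_ge0 // ltW.
set s := t / e in tE H1 *; rewrite tE exprMn.
have s0 : 0 <= s ^+ 2 by exact: sqr_ge0.
have e2 : e ^+ 2 * s ^+ 2 <= e * s ^+ 2.
  by rewrite ler_wpM2r // expr2 ger_pMr.
have : 2 * (e * s) <= 2 * (e * s ^+ 2) by rewrite ler_pM2l // ler_pM2l.
by move=> H3; apply: (le_trans (lerD H3 e2)); lra.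
Qed.

Lemma total_scalar_le (kappa : R) :
  (forall eps : R, 0 < eps -> exists v : M -> R,
     [/\ Ck_fun 2 v, forall p, 0 < v p, total_scalar (conformal v g) <= kappa &
       \int[mu]_(p in [set: borel M]) (`|v p - 1| `^ qexp) <= eps]) ->
  total_scalar g <= kappa.
Proof.
move=> H.
have cS := is_scalar_curvature_continuous gM gS.
have [C C0 SC] := continuous_bounded cS.
rewrite /= in C C0 SC *; pose V := fine (mu [set: borel M]).
have V0 : 0 <= V by apply: fine_ge0; exact: measure_ge0.
have -> : total_scalar g = \int[mu]_(p in [set: borel M]) S p.
  by rewrite /total_scalar (scalar_curvatureE gS).
(* The error is linear in [e] with constants depending on [S] and the volume only; if the claim
   failed by [D > 0], a small [e] would contradict it. *)
suff K e : 0 < e <= 1 -> \int[mu]_(p in [set: borel M]) S p <= kappa + C * (3 * e * V + 3 * e).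
  rewrite leNgt; apply/negP => lt.
  pose D := \int[mu]_(p in [set: borel M]) S p - kappa.
  have D0 : 0 < D by rewrite subr_gt0.
  (* The summand 1 keeps [L] positive when [C] is 0. With [e <= D/(2L)] the error is at most
     [D/2]. *)
  pose L := C * (3 * V + 3) + 1.
  have L0 : 0 < L by rewrite ltr_wpDl // mulr_ge0 // addr_ge0 // mulr_ge0.
  pose e := Num.min 1 (D / (2 * L)).
  have e0 : 0 < e by rewrite lt_min ltr01 divr_gt0 // mulr_gt0.
  have e1 : e <= 1 by rewrite ge_min lexx.
  have eD : e <= D / (2 * L) by rewrite ge_min lexx orbT.
  have := K e; rewrite e0 e1 => /(_ isT); rewrite -lerBlDl -/D => DK.
  have : D <= L * e.
    apply: (le_trans DK); rewrite /L; have : 0 <= e by exact: ltW.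
    by move: e {e0 e1 eD DK} => e e0; nra.
  move=> DL; have : L * e <= D / 2.
    rewrite (le_trans (ler_wpM2l (ltW L0) eD)) //.
    have L0' : L != 0 by rewrite gt_eqF.
    by rewrite le_eqVlt; apply/orP; left; apply/eqP; field.
  lra.
move=> /andP[e0 e1].
have er0 : 0 < e `^ qexp by exact: powR_gt0.
(* This tolerance cancels the large factor [3e / e^q] in front of the integral of [|v - 1|^q],
   leaving [3e]. *)
have [v [Cv v0 vk vint]] := H (e `^ qexp) er0.
have cv := continuous_Ck_fun Cv.
pose w p := `|v p - 1|.
have cv1 : continuous (fun p => v p - 1).
  exact: continuous_subr.
have q0 : 0 < qexp by rewrite (lt_le_trans _ qexp_ge2).
have cwq : continuous (fun p => w p `^ qexp) := continuous_norm_powR q0 cv1.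
have cSv2 : continuous (fun p => S p * v p ^+ 2).
  rewrite (_ : (fun p => _) = (fun p => S p * (v p * v p))).
    by move=> p; exact: (continuousM (cS p) (continuousM (cv p) (cv p))).
  by apply/funext => p; rewrite expr2.
have pw p : S p <= S p * v p ^+ 2 + C * (3 * e + 3 * e / e `^ qexp * w p `^ qexp).
  have wq := @linear_quadratic_le_powR (w p) e qexp (normr_ge0 _) (introT andP (conj e0 e1)) qexp_ge2.
  have : S p - S p * v p ^+ 2 <= C * (2 * w p + w p ^+ 2).
    have -> : S p - S p * v p ^+ 2 = - (S p * (2 * (v p - 1) + (v p - 1) ^+ 2)) by ring.
    apply: (le_trans (ler_norm _)); rewrite normrN normrM ler_pM //.
    apply: (le_trans (ler_normD _ _)); rewrite normrM normrX ger0_norm //.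
  by have := ler_wpM2l C0 wq; lra.
have cst_int (k : R) : \int[mu]_(p in [set: borel M]) k = k * V.
  by rewrite Rintegral_cst.
have cD := continuous_scale (c := 3 * e / e `^ qexp) cwq.
have cB : continuous (fun p => 3 * e + 3 * e / e `^ qexp * w p `^ qexp).
  exact: (continuous_sum (fun p => @cst_continuous _ _ (3 * e) p) cD).
have cCB := continuous_scale (c := C) cB.
have cA : continuous (fun p => S p * v p ^+ 2 + C * (3 * e + 3 * e / e `^ qexp * w p `^ qexp)).
  exact: (continuous_sum cSv2 cCB).
apply: (le_trans (le_Rintegral measurableT (iC cS) (iC cA) (fun p _ => pw p))).
rewrite (RintegralD measurableT (iC cSv2) (iC cCB)) (RintegralZl _ measurableT (iC cB)).
rewrite (RintegralD measurableT (iC (@cst_continuous _ _ (3 * e))) (iC cD)).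
rewrite cst_int (RintegralZl _ measurableT (iC cwq)).
apply: lerD; first exact: le_trans (total_scalar_conformal_ge Cv v0) vk.
rewrite ler_wpM2l // lerD2l.
rewrite -[leRHS](divfK (lt0r_neq0 er0)).
by rewrite ler_wpM2l // divr_ge0 ?(ltW er0) // mulr_ge0 // ltW.
Qed.

End Base.
End Semicontinuity.

(** * Passage to the limit under either mode of convergence *)

Section Limit.
Context {R : realType} {n : nat} (M : closed_manifold R n).
Hypothesis n_ge3 : (3 <= n)%N.
Implicit Types (p : M) (f u v : M -> R) (g : tensor2 M).
Local Notation qexp := (2 * n%:R / (n%:R - 2) : R).

Let n2_gt0 : 0 < n%:R - 2 :> R.
Proof. by rewrite subr_gt0 ltr_nat. Qed.

Let qexp_gt0 : 0 < qexp.
Proof. by rewrite (lt_le_trans _ (qexp_ge2 n_ge3)). Qed.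

(* If [g] has no volume measure, or no scalar curvature, then neither has
   [conformal (v_ i) g], since [g] is conformal to it; both integrals then take
   the junk value 0. *)
Lemma total_scalar_semicontinuous g (v_ : nat -> M -> R) (kappa : R) :
  riemannian_metric 2 g -> (forall i, Ck_fun 2 (v_ i)) -> (forall i p, 0 < v_ i p) ->
  (forall i, total_scalar (conformal (v_ i) g) <= kappa) ->
  (is_volume g (volume g) -> forall eps : R, 0 < eps -> exists i,
     \int[volume g]_(p in [set: borel M]) (`|v_ i p - 1| `^ qexp) <= eps) ->
  total_scalar g <= kappa.
Proof.
move=> gM Cv v0 vk vlim.
have vM := conformal_metric (Cv 0%N) (v0 0%N) gM.
have Cw := Ck_fun_inv (v0 0%N) (Cv 0%N).
have w0 p : 0 < (v_ 0%N p)^-1 by rewrite invr_gt0.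
have gE := conformalK g (v0 0%N).
have [[mu muV]|nV] := pselect (exists mu, is_volume g mu); last first.
  rewrite total_scalar_no_volume => [|mu muV]; last by apply: nV; exists mu.
  rewrite -(_ : total_scalar (conformal (v_ 0%N) g) = 0) //.
  apply: total_scalar_no_volume => mu muV; apply: nV.
  (* A volume of the conformal metric would give one of [g], by the inverse conformal factor. *)
  by have := conformal_volume_exists n_ge3 vM muV Cw w0; rewrite gE.
have gV : is_volume g (volume g) by apply: volumeP; exists mu.
have vV := volumeP (conformal_volume_exists n_ge3 gM gV (Cv 0%N) (v0 0%N)).
have [[S gS]|nS] := pselect (exists S, is_scalar_curvature g S); last first.
  rewrite total_scalar_no_curvature => [|S gS]; last by apply: nS; exists S.
  rewrite -(_ : total_scalar (conformal (v_ 0%N) g) = 0) //.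
  apply: total_scalar_no_curvature => S vS; apply: nS.
  by have := conformal_is_scalar_curvature n_ge3 vM vV Cw w0 vS; rewrite gE => gS; eexists; exact: gS.
apply: (total_scalar_le n_ge3 gM gS gV) => eps eps0.
have [i vi] := vlim gV eps eps0; exists (v_ i).
by split; [exact: Cv|exact: v0|exact: vk|exact: vi].
Qed.

(** Continuity at 1 of the inverse of the power function, read off from strict monotonicity: [d] is
    the smaller distance from 1 to the powers of [1 - e] and [1 + e]. It recovers [v_i] from its
    power in the metric. *)
Lemma powR_near1 (r e : R) : 0 < r -> 0 < e < 1 ->
  exists2 d : R, 0 < d & forall x, 0 <= x -> `|x `^ r - 1| <= d -> `|x - 1| <= e.
Proof.
move=> r0 /andP[e0 e1].
have mono (x y : R) : 0 <= x -> x < y -> x `^ r < y `^ r.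
  move=> x0 xy; apply: (gt0_ltr_powR r0) => //; rewrite nnegrE //.
  exact: ltW (le_lt_trans x0 xy).
have A : 1 < (1 + e) `^ r by rewrite -[ltLHS](congr1 (@^~ r) (powR1 R)) mono // ltrDl.
have B : (1 - e) `^ r < 1 by rewrite -[ltRHS](congr1 (@^~ r) (powR1 R)) mono ?subr_ge0 ?(ltW e1) // gtrBl.
exists (Num.min ((1 + e) `^ r - 1) (1 - (1 - e) `^ r)); first by rewrite lt_min !subr_gt0 A B.
move=> x x0; rewrite le_min !ler_norml => /andP[/andP[_ xA] /andP[xB _]].
apply/andP; split; rewrite leNgt; apply/negP => lt.
  have : x < 1 - e by lra.
  by move=> /(mono _ _ x0); lra.
have : 1 + e < x by lra.
by move=> /mono => /(_ (addr_ge0 ler01 (ltW e0))); lra.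
Qed.

(** Evaluated on one nonzero tangent vector, the difference of the metrics is the difference of the
    factors times the squared length of the vector, which cancels. *)
Lemma C0_cvg_conformal g u (u_ : nat -> M -> R) : riemannian_metric 2 g ->
  C0_cvg g (fun i => conformal (u_ i) g) (conformal u g) ->
  forall eps : R, 0 < eps -> exists i, forall p,
    `|u_ i p `^ (4 / (n%:R - 2)) - u p `^ (4 / (n%:R - 2))| <= eps.
Proof.
move=> gM cvg eps /cvg[N _ /(_ N (leqnn N)) HN]; exists N => p.
have [a dp] := atlas_cover p.
have n0 : (0 < n)%N by exact: leq_trans n_ge3.
pose w : 'rV[R]_n := delta_mx 0 (Ordinal n0).
have w0 : w != 0.
  apply/eqP => /rowP /(_ (Ordinal n0)); rewrite !mxE !eqxx /=.
  exact/eqP/oner_neq0.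
have gw := metric_posdef gM dp w0.
have := HN a p w dp; rewrite /conformal -scalerBl {1}/quad -scalemxAr -scalemxAl mxE -/(quad (g a p) w).
by rewrite normrM (gtr0_norm gw) ler_pM2r.
Qed.

Lemma uniform_limit g (v_ : nat -> M -> R) :
  riemannian_metric 2 g -> is_volume g (volume g) ->
  (forall i, continuous (v_ i)) -> (forall i p, 0 < v_ i p) ->
  (forall d : R, 0 < d -> exists i, forall p, `|v_ i p `^ (4 / (n%:R - 2)) - 1| <= d) ->
  forall eps : R, 0 < eps -> exists i,
     \int[volume g]_(p in [set: borel M]) (`|v_ i p - 1| `^ qexp) <= eps.
Proof.
move=> gM gV cv v0 lim eps eps0.
pose V := fine (volume g [set: borel M]).
have V0 : 0 <= V by apply: fine_ge0; exact: measure_ge0.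
have V1 : 0 < V + 1 by rewrite ltr_wpDl.
(* Since [e < 1] and the exponent is at least 1, [|v - 1| <= e] gives [|v - 1|^q <= e], whose
   integral is at most [e V <= eps]; [V + 1] avoids division by 0. *)
pose e := Num.min 2^-1 (eps / (V + 1)).
have e0 : 0 < e by rewrite lt_min invr_gt0 ltr0n divr_gt0.
have e2 : e <= 2^-1 by rewrite ge_min lexx.
have e1 : e < 1 by lra.
have eE : e * (V + 1) <= eps by rewrite -ler_pdivlMr // ge_min lexx orbT.
have r0 : 0 < 4 / (n%:R - 2) :> R by rewrite divr_gt0.
have [d d0 dP] := powR_near1 r0 (introT andP (conj e0 e1)).
have [i vi] := lim d d0; exists i.
have le p : `|v_ i p - 1| `^ qexp <= e.
  have ve : `|v_ i p - 1| <= e by apply: dP => //; exact: ltW.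
  apply: (@le_trans _ _ (e `^ qexp)).
    by apply: ge0_ler_powR; rewrite ?nnegrE // ltW.
  have q1 : 1 <= qexp by rewrite (le_trans _ (qexp_ge2 n_ge3)) // ler1n.
  by have := ger_powR (introT andP (conj e0 (ltW e1))) q1; rewrite powRr1 // ltW.
have cq := continuous_norm_powR qexp_gt0 (continuous_subr (c := 1) (cv i)).
apply: le_trans eE.
apply: (@le_trans _ _ (\int[volume g]_(p in [set: borel M]) e)).
  apply: (le_Rintegral measurableT (integrable_continuous gM gV cq)) => //.
  exact: (integrable_continuous gM gV (@cst_continuous _ _ e)).
rewrite Rintegral_cst // -/V ler_pM2l // lerDl //.
Qed.

End Limit.

Theorem theorem1 (R : realType) (n : nat) (n_ge3 : (3 <= n)%N)
    (M : closed_manifold R n)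
    (g0 : tensor2 M) (g0_metric : riemannian_metric 2 g0)
    (u_ : nat -> M -> R) (u : M -> R)
    (u_C2 : forall i, Ck_fun 2 (u_ i)) (u_pos : forall i p, 0 < u_ i p)
    (uC2 : Ck_fun 2 u) (upos : forall p, 0 < u p)
    (kappa : R) :
  let g_ := fun i => conformal (u_ i) g0 in
  let g := conformal u g0 in
  let bound := forall i, total_scalar (g_ i) <= kappa in
  let lower_bound := exists delta : M -> R,
    continuous delta /\ forall i p, delta p <= scalar_curvature (g_ i) p in
  (C0_cvg g0 g_ g -> bound -> ((0 < yamabe g0)%E -> lower_bound) ->
     total_scalar g <= kappa)
  /\
  ((0 < yamabe g0)%E -> Lp_cvg g0 (2 * n%:R / (n%:R - 2)) u_ u ->
     bound -> lower_bound ->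
     total_scalar g <= kappa).
Proof.
move=> g_ g bound lower_bound.
have gM : riemannian_metric 2 g by exact: conformal_metric.
have Cu' : Ck_fun 2 (fun p => (u p)^-1) := Ck_fun_inv upos uC2.
pose v_ i p := u_ i p * (u p)^-1.
have Cv i : Ck_fun 2 (v_ i) := Ck_fun_mul (u_C2 i) Cu'.
have u'0 p : 0 < (u p)^-1 by rewrite invr_gt0.
have v0 i p : 0 < v_ i p by exact: mulr_gt0.
have cv i : continuous (v_ i) := continuous_Ck_fun (Cv i).
have g_E i : conformal (v_ i) g = g_ i.
  rewrite /g conformal_comp //; congr conformal; apply/funext => p.
  by rewrite mulfVK // gt_eqF.
have main : bound -> (is_volume g (volume g) -> forall eps : R, 0 < eps -> exists i,
     \int[volume g]_(p in [set: borel M]) (`|v_ i p - 1| `^ (2 * n%:R / (n%:R - 2))) <= eps) ->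
    total_scalar g <= kappa.
  move=> bd; apply: (total_scalar_semicontinuous n_ge3 gM Cv v0) => i.
  by rewrite g_E; exact: bd.
split=> [cvg bd _|_ cvg bd _]; apply: main => // gV eps eps0.
  apply: (uniform_limit n_ge3 gM gV cv v0) => // d d0.
  (* With [r = 4/(n-2)], [|v_i^r - 1|] equals [|u_i^r - u^r|] times [u^(-r)], and the last factor is
     bounded on the compact manifold. *)
  have [C C0 Cu] := continuous_bounded
    (continuous_Ck_fun (Ck_fun_powR (4 / (n%:R - 2)) u'0 Cu')).
  have C1 : 0 < C + 1 by rewrite ltr_wpDl.
  have [i ui] := C0_cvg_conformal n_ge3 g0_metric cvg (divr_gt0 d0 C1).
  exists i => p.
  have u1 : u p `^ (4 / (n%:R - 2)) * (u p)^-1 `^ (4 / (n%:R - 2)) = 1.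
    by rewrite -powRM ?ltW // divff ?powR1 // gt_eqF.
  rewrite /v_ powRM ?(ltW (u_pos _ _)) ?(ltW (u'0 _)) // -[X in _ - X]u1 -mulrBl normrM.
  rewrite -(divfK (lt0r_neq0 C1) d).
  apply: ler_pM => //.
  by rewrite (le_trans (Cu p)) // lerDl.
have g0E := conformalK g0 upos.
(* [Lp_cvg] refers to the volume of [g0]; it exists because [g0] is conformal to [g] with factor
   [1/u]. *)
have [mu] := conformal_volume_exists n_ge3 gM gV Cu' u'0.
rewrite g0E => muV; have g0V : is_volume g0 (volume g0) by apply: volumeP; exists mu.
have q0 : 0 < 2 * n%:R / (n%:R - 2) :> R.
  by rewrite (lt_le_trans _ (qexp_ge2 n_ge3)).
have /(@cvgrPdist_le _ R^o) /(_ _ eps0)[N _ /(_ N (leqnn N))] := cvg.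
rewrite sub0r normrN => /(le_trans (ler_norm _)) H; exists N.
apply: le_trans H; rewrite /Rintegral.
rewrite (integral_conformal n_ge3 g0_metric g0V uC2 upos gV
  (continuous_norm_powR q0 (continuous_subr (c := 1) (cv N)))).
rewrite le_eqVlt; apply/orP; left; apply/eqP; congr fine.
(* Conformal invariance of the critical norm: [|u_i/u - 1|^q u^q = |u_i - u|^q], so the two
   integrals coincide. *)
apply: eq_integral => p _; rewrite -powRM //; last exact: ltW.
congr (_ `^ _)%:E; rewrite -{1}(gtr0_norm (upos p)) -normrM.
by rewrite /v_ mulrBl mulfVK ?mul1r // gt_eqF.
Qed.
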